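(* Let $X,Y$ be computable metric spaces and $f:\subseteq X\rightrightarrows Y$ a problem. Then the following are equivalent: (1) $f:\subseteq X\rightrightarrows Y$ is limit computable; (2) $g\circ\mathsf{J}_X\sqsubseteq f$ for some computable (single-valued) $g:\subseteq\mathbb{N}^{\mathbb{N}}\to Y$.
   Context: $f:\subseteq X\rightrightarrows Y$ denotes a partial multi-valued function (nonempty values on its domain), $g:\subseteq X\to Y$ a partial single-valued function; compositions of single-valued partial functions have their natural domain. For $f,s:\subseteq X\rightrightarrows Y$, $s\sqsubseteq f$ means $\mathrm{dom}(f)\subseteq\mathrm{dom}(s)$ and $s(x)\subseteq f(x)$ for all $x\in\mathrm{dom}(f)$ (single values are identified with singletons). A computable metric space $(X,d,\alpha)$ is a metric space $(X,d)$ with a dense sequence $\alpha:\mathbb{N}\to X$ such that $d\circ(\alpha\times\alpha):\mathbb{N}^2\to\mathbb{R}$ is a computable (double) sequence of reals. It is represented by its Cauchy representation $\delta_X:\subseteq\mathbb{N}^{\mathbb{N}}\to X$, $\delta_X(p):=\lim_{n\to\infty}\alpha p(n)$ with $\mathrm{dom}(\delta_X)=\{p:(\forall k)(\forall n\geq k)\;d(\alpha p(n),\alpha p(k))<2^{-k}$ and $(\alpha p(n))_n$ converges$\}$. $\mathbb{N}^{\mathbb{N}}$ is represented by the identity. A problem is a partial multi-valued function between represented spaces. $F:\subseteq\mathbb{N}^{\mathbb{N}}\to\mathbb{N}^{\mathbb{N}}$ is a realizer of $f:\subseteq X\rightrightarrows Y$ if $\delta_YF(p)\in f\delta_X(p)$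 for all $p\in\mathrm{dom}(f\delta_X)$. A problem is computable (limit computable) if it has a realizer with that property. A partial function $F:\subseteq\mathbb{N}^{\mathbb{N}}\to\mathbb{N}^{\mathbb{N}}$ is computable if there is a Turing machine (infinite input tape, one-way output tape) that on each $p\in\mathrm{dom}(F)$ produces $F(p)$ in the long run; it is limit computable if there is a Turing machine with a two-way output tape (it may revise its output) that on each $p\in\mathrm{dom}(F)$ computes $F(p)$ such that each output position $n$ has, after finitely many steps, the content $F(p)(n)$ and is never changed again. Nothing is required outside $\mathrm{dom}(F)$. In a computable metric space $(X,d,\alpha)$ let $B_{\langle c,r\rangle}:=\{x\in X:d(x,\alpha(c))<\overline{r}\}$ for $c,r\in\mathbb{N}$, where $\langle\cdot,\cdot\rangle$ is the Cantor pairing and $\overline{\langle i,j,k\rangle}:=\frac{i-j}{k+1}$ encodes rationals via a standard triple coding. Let $W_i:=\{n\in\mathbb{N}:$ the $i$-th Turing machine halts on input $n\}$ and $U_i:=\bigcup_{n\in W_i}B_n$. The Turing jump of $X$ is $\mathsf{J}_X:X\to\mathbb{N}^{\mathbb{N}}$ with $\mathsf{J}_X(x)(i):=1$ if $x\in U_i$ and $\mathsf{J}_X(x)(i):=0$ otherwise. *)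

(* Defs.v *)
From Stdlib Require Import Reals List Arith Cantor ClassicalEpsilon.
Import ListNotations.
Open Scope nat_scope.

Definition Baire : Type := nat -> nat.

(** * Turing machines

    A machine has a read-only input tape, an output tape and finitely many work
    tapes.  Every tape is infinite to the right (a left move on cell 0 has no
    effect).  States and symbols are natural numbers; since a machine has
    finitely many rules, only finitely many of them matter.  The initial state
    is 0, and the machine halts when no rule applies. *)

Inductive move := Left | Stay | Right.

Record tape := Tape { pos : nat; cells : nat -> nat }.

Definition scanned (t : tape) : nat := cells t (pos t).

Definition shift_pos (m : move) (h : nat) : nat :=
  match m with Left => pred h | Stay => h | Right => S h end.

(* Applicable if the scanned symbol is [scan]; it is then replaced by [print]. *)
Record action := Action { scan : nat; print : nat; shift : move }.

Definition act (a : action) (t : tape) : tape :=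
  Tape (shift_pos (shift a) (pos t))
       (fun k => if k =? pos t then print a else cells t k).

Record rule := Rule {
  source : nat;
  target : nat;
  input_scan : nat;
  input_shift : move;
  output_action : action;
  work_actions : list action
}.

Record machine := Machine { work_tapes : nat; rules : list rule }.

Record config := Config {
  state : nat;
  input : tape;
  output : tape;
  work : list tape
}.

Fixpoint scans (l : list action) (ts : list tape) : bool :=
  match l, ts with
  | [], [] => true
  | a :: l', t :: ts' => (scan a =? scanned t) && scans l' ts'
  | _, _ => false
  end.

Definition applies (c : config) (r : rule) : bool :=
  (source r =? state c) && (input_scan r =? scanned (input c))
  && (scan (output_action r) =? scanned (output c))
  && scans (work_actions r) (work c).

Definition apply_rule (r : rule) (c : config) : config :=
  Config (target r)
         (Tape (shift_pos (input_shift r) (pos (input c))) (cells (input c)))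
         (act (output_action r) (output c))
         (map (fun at_ => act (fst at_) (snd at_))
              (combine (work_actions r) (work c))).

(* The first applicable rule is used, so machines are deterministic. *)
Definition step (M : machine) (c : config) : option config :=
  match find (applies c) (rules M) with
  | Some r => Some (apply_rule r c)
  | None => None
  end.

(* Tape alphabet for input and output: numbers are written in unary. *)
Definition blank : nat := 0.
Definition stroke : nat := 1.
Definition separator : nat := 2.

Definition blank_tape : tape := Tape 0 (fun _ => blank).

Definition initial (M : machine) (w : nat -> nat) : config :=
  Config 0 (Tape 0 w) blank_tape (repeat blank_tape (work_tapes M)).

Fixpoint run (M : machine) (w : nat -> nat) (t : nat) : config :=
  match t with
  | 0 => initial M w
  | S t' => let c := run M w t' in
            match step M c with Some c' => c' | None => c end
  end.

Definition halted (M : machine) (c : config) : Prop := step M c = None.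

(* The tape inscription |^n followed by blanks. *)
Definition finite_word (n : nat) : nat -> nat :=
  fun k => if k <? n then stroke else blank.

(* The [k]-th letter of the infinite word |^(p 0) # |^(p 1) # |^(p 2) # ... ,
   where | is [stroke] and # is [separator]. *)
Fixpoint infinite_word (p : Baire) (k : nat) : nat :=
  match k, p 0 with
  | 0, 0 => separator
  | 0, S _ => stroke
  | S k', 0 => infinite_word (fun i => p (S i)) k'
  | S k', S a => infinite_word (fun i => match i with 0 => a | S _ => p i end) k'
  end.

(** * Computability on natural numbers *)

Definition halts_on (M : machine) (n : nat) : Prop :=
  exists t, halted M (run M (finite_word n) t).

Definition computable_nat (h : nat -> nat) : Prop :=
  exists M : machine, forall n, exists t,
    halted M (run M (finite_word n) t) /\
    forall k, cells (output (run M (finite_word n) t)) k = finite_word (h n) k.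

Definition cpair (x y : nat) : nat := Cantor.to_nat (x, y).

Definition triple (i j k : nat) : nat := cpair (cpair i j) k.

Fixpoint code_list (l : list nat) : nat :=
  match l with [] => 0 | x :: l' => S (cpair x (code_list l')) end.

Definition code_move (m : move) : nat :=
  match m with Left => 0 | Stay => 1 | Right => 2 end.

Definition code_action (a : action) : nat :=
  triple (scan a) (print a) (code_move (shift a)).

Definition code_rule (r : rule) : nat :=
  code_list [source r; target r; input_scan r; code_move (input_shift r);
             code_action (output_action r);
             code_list (map code_action (work_actions r))].

Definition code_machine (M : machine) : nat :=
  cpair (work_tapes M) (code_list (map code_rule (rules M))).

Lemma cpair_inj x y x' y' : cpair x y = cpair x' y' -> x = x' /\ y = y'.
Proof.
  unfold cpair; intros E; apply (f_equal Cantor.of_nat) in E.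
  rewrite !Cantor.cancel_of_to in E; now injection E.
Qed.

Lemma code_list_map_inj {A : Type} (c : A -> nat) :
  (forall a b, c a = c b -> a = b) ->
  forall l l', code_list (map c l) = code_list (map c l') -> l = l'.
Proof.
  intros Hc l; induction l as [|a l IH]; intros [|b l']; simpl; try easy.
  intros E; injection E as E; apply cpair_inj in E as [E1 E2].
  f_equal; [now apply Hc | now apply IH].
Qed.

Lemma code_move_inj m m' : code_move m = code_move m' -> m = m'.
Proof. now destruct m, m'. Qed.

Lemma code_action_inj a b : code_action a = code_action b -> a = b.
Proof.
  destruct a, b; unfold code_action, triple; simpl; intros E.
  apply cpair_inj in E as [E E3]; apply cpair_inj in E as [E1 E2].
  apply code_move_inj in E3; now subst.
Qed.

Lemma code_rule_inj r s : code_rule r = code_rule s -> r = s.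
Proof.
  unfold code_rule; intros E.
  rewrite <- (map_id [source r; _; _; _; _; _]),
          <- (map_id [source s; _; _; _; _; _]) in E.
  apply code_list_map_inj in E; [|easy].
  destruct r, s; simpl in E; injection E as -> -> -> E1 E2 E3.
  apply code_move_inj in E1; apply code_action_inj in E2.
  apply (code_list_map_inj _ code_action_inj) in E3; now subst.
Qed.

Lemma code_machine_inj M N : code_machine M = code_machine N -> M = N.
Proof.
  destruct M, N; unfold code_machine; simpl; intros E.
  apply cpair_inj in E as [-> E].
  now apply (code_list_map_inj _ code_rule_inj) in E as ->.
Qed.

(* By [code_machine_inj] at most one machine has code [i]; if there is none,
   the [i]-th machine halts nowhere. *)
Definition W (i n : nat) : Prop :=
  exists M : machine, code_machine M = i /\ halts_on M n.

(** * Computability on Baire space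

    Partial functions and partial multi-valued functions are relations, so that
    values on the domain are automatically nonempty. *)

Definition dom {A B : Type} (f : A -> B -> Prop) (a : A) : Prop :=
  exists b, f a b.

Definition single_valued {A B : Type} (f : A -> B -> Prop) : Prop :=
  forall a b b', f a b -> f a b' -> b = b'.

(* Each cell of the output tape eventually contains the right letter for ever;
   nothing is required outside the domain of [F]. *)
Definition computes (M : machine) (F : Baire -> Baire -> Prop) : Prop :=
  forall p q, F p q -> forall k, exists t0, forall t, t0 <= t ->
    cells (output (run M (infinite_word p) t)) k = infinite_word q k.

(* The output tape is only ever printed on while moving to the next, still
   blank, cell; so in [computes] no letter is revised. *)
Definition one_way (M : machine) : Prop :=
  forall r, In r (rules M) ->
    match shift (output_action r) with
    | Left => False
    | Stay => print (output_action r) = scan (output_action r)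
    | Right => True
    end.

Definition computable_fun (F : Baire -> Baire -> Prop) : Prop :=
  exists M, one_way M /\ computes M F.

Definition limit_computable_fun (F : Baire -> Baire -> Prop) : Prop :=
  exists M, computes M F.

(** * Problems

    A representation of [X] is given by the relation "[p] is a name of [x]". *)

Definition realizes {X Y : Type} (dX : Baire -> X -> Prop)
    (dY : Baire -> Y -> Prop) (F : Baire -> Baire -> Prop)
    (f : X -> Y -> Prop) : Prop :=
  forall p x, dX p x -> dom f x -> exists q y, F p q /\ dY q y /\ f x y.

Definition computable {X Y : Type} (dX : Baire -> X -> Prop)
    (dY : Baire -> Y -> Prop) (f : X -> Y -> Prop) : Prop :=
  exists F, single_valued F /\ computable_fun F /\ realizes dX dY F f.

Definition limit_computable {X Y : Type} (dX : Baire -> X -> Prop)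
    (dY : Baire -> Y -> Prop) (f : X -> Y -> Prop) : Prop :=
  exists F, single_valued F /\ limit_computable_fun F /\ realizes dX dY F f.

(* [refines s f] is s ⊑ f. *)
Definition refines {X Y : Type} (s f : X -> Y -> Prop) : Prop :=
  forall x, dom f x -> dom s x /\ forall y, s x y -> f x y.

Definition baire_rep (p q : Baire) : Prop := p = q.

(** * Computable metric spaces *)

Definition rational (n : nat) : R :=
  let (ij, k) := Cantor.of_nat n in
  let (i, j) := Cantor.of_nat ij in
  ((INR i - INR j) / (INR k + 1))%R.

Definition computable_double_sequence (a : nat -> nat -> R) : Prop :=
  exists h, computable_nat h /\
    forall i j k, (Rabs (a i j - rational (h (triple i j k))) <= / 2 ^ k)%R.

Record computable_metric_space := {
  space :> Metric_Space;
  point : nat -> Base space;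
  point_dense : forall (x : Base space) (eps : R), (0 < eps)%R ->
    exists n, (dist space (point n) x < eps)%R;
  point_computable :
    computable_double_sequence (fun i j => dist space (point i) (point j))
}.

Definition cauchy_rep (X : computable_metric_space) (p : Baire) (x : Base X) :
    Prop :=
  (forall k n, k <= n ->
     (dist X (point X (p n)) (point X (p k)) < / 2 ^ k)%R) /\
  Un_cv (fun n => dist X (point X (p n)) x) 0%R.

Definition ball (X : computable_metric_space) (n : nat) (x : Base X) : Prop :=
  let (c, r) := Cantor.of_nat n in (dist X x (point X c) < rational r)%R.

Definition U (X : computable_metric_space) (i : nat) (x : Base X) : Prop :=
  exists n, W i n /\ ball X n x.

Definition turing_jump (X : computable_metric_space) (x : Base X) : Baire :=
  fun i => if excluded_middle_informative (U X i x) then 1 else 0.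

(* Main.v *)
(** From 2 to 1, the jump of [x] is limit computable from any name of [x], because
    membership in [U i] is semidecidable and so can only change from 0 to 1; a
    one-way machine reads finitely much of its input before it prints a letter,
    so running it for [n] steps on the [n]-th approximation of the jump converges
    letter by letter.

    From 1 to 2, a jump-computable name of [x] does not suffice: the limit of the
    given machine [M] on it has to be computed as well.  Both are built together by
    forcing with finite sequences that are tight for [x].  For a tight [l] and a
    cell [k], whether some tight extension of [l] changes cell [k] of the output of
    [M] is a question "is [x] in [U i]?" with [i] computable from [k] and [l], so
    the jump answers it.  If yes, replace [l] by such an extension; if no, the
    letter in cell [k] is final for every tight extension of [l].  Every tight
    infinite sequence is a name of [x], so [M] converges on the limit of the finite
    sequences and each cell is settled after finitely many changes.

    Every machine needed is an instance of one construction: a transducer whose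
    state, coded by a number, is updated by a function that a counter program
    computes, once per input letter. *)

(* The obstacle from 1 to 2: whether the output of [M] on a fixed name [p] still changes is a
   question about [p], while the jump of [x] answers only questions about [x]. Quantifying over all
   tight extensions removes [p]. A finite list is tight on an open set of points, because the
   inequalities are strict, and these sets can be enumerated as unions of balls; the bound 2^-(m+1),
   half of the Cauchy bound, makes the limit a name. The other demand is uniformity: the index of
   each question must be computed from the cell and the list. Therefore a transducer loads its
   initial state by a chain of states, and the code of the machine is a computable function of that
   state. A positive answer guarantees that a blind search through all codes of lists ends; a
   negative answer fixes a letter for good, as a one-way machine requires. The function [g] is
   single-valued although [f] need not be: the machine sees nothing but the jump, so the name it
   builds and the value it reaches are functions of the jump. *)
From Stdlib Require Import Reals List Arith Lia Lra Cantor ClassicalEpsilon FunctionalExtensionality.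
Require Import Defs.
Import ListNotations.
Open Scope bool_scope.
Open Scope nat_scope.

(** * Counter programs on Turing machines *)

(* Every work tape is a counter: cell 0 carries a mark, and the value is the
   position of the head. *)
Inductive instr :=
| IInit (q : nat)
| IJump (q : nat)
| IMove (r : nat) (m : move) (q : nat)
| ITest (r q q' : nat)
| IRead (r r' q : nat)
| IPrint (a q : nat)
| IRetreat (q : nat).

(** Scanning the mark 1 on a counter means that its value is zero, so [q] is the zero branch of a
    test. *)
Definition goto (i : instr) (ws : list nat) : nat :=
  match i with
  | ITest r q q' => if nth r ws 0 =? 1 then q else q'
  | IInit q | IJump q | IMove _ _ q | IRead _ _ q | IPrint _ q | IRetreat q => q
  end.

Definition in_shift (i : instr) : move :=
  match i with IRead _ _ _ => Right | _ => Stay end.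

Definition out_action (i : instr) (o : nat) : action :=
  match i with
  | IPrint a _ => Action o a Right
  | IRetreat _ => Action o o Left
  | _ => Action o o Stay
  end.

Definition work_print (i : instr) (s : nat) : nat :=
  match i with IInit _ => 1 | _ => s end.

(** Reading increments [r1] on a stroke and [r2] on a separator, and neither on a blank; the two
    counters together identify the letter. *)
Definition work_shift (i : instr) (a r : nat) : move :=
  match i with
  | IMove r' m _ => if r =? r' then m else Stay
  | IRead r1 r2 _ =>
      if ((a =? 1) && (r =? r1)) || ((a =? 2) && (r =? r2)) then Right else Stay
  | _ => Stay
  end.

Definition rule_of (w q : nat) (i : instr) (c : nat * (nat * list nat)) : rule :=
  let '(a, (o, ws)) := c in
  Rule q (goto i ws) a (in_shift i) (out_action i o)
    (map (fun r => Action (nth r ws 0) (work_print i (nth r ws 0))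
                          (work_shift i a r)) (seq 0 w)).

Fixpoint words (w : nat) : list (list nat) :=
  match w with
  | 0 => [[]]
  | S w' => flat_map (fun l => [0 :: l; 1 :: l]) (words w')
  end.

(** A rule prescribes every scanned symbol, so an instruction expands into one rule per combination:
    three letters on input and output, mark or no mark on each counter. *)
Definition contexts (w : nat) : list (nat * (nat * list nat)) :=
  list_prod [0; 1; 2] (list_prod [0; 1; 2] (words w)).

Definition table : Type := list (nat * instr).

Definition table_rules (w : nat) (T : table) : list rule :=
  flat_map (fun p => map (rule_of w (fst p) (snd p)) (contexts w)) T.

Lemma in_words l : (forall s, In s l -> s <= 1) -> In l (words (length l)).
Proof.
  induction l as [|s l IH]; intros H; simpl; [now left|].
  apply in_flat_map; exists l; split; [apply IH; intros; apply H; now right|].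
  assert (s <= 1) by (apply H; now left).
  destruct s as [|[|s]]; simpl; auto; lia.
Qed.

Lemma words_length w l : In l (words w) -> length l = w.
Proof.
  revert l; induction w as [|w IH]; intros l; simpl.
  - intros [<-|[]]; easy.
  - intros H; apply in_flat_map in H as [l' [H1 [<-|[<-|[]]]]]; simpl; auto.
Qed.

Lemma find_unique {A} (p : A -> bool) l r :
  In r l -> p r = true -> (forall r', In r' l -> p r' = true -> r' = r) ->
  find p l = Some r.
Proof.
  intros H1 H2 H3; destruct (find p l) as [r'|] eqn:E.
  - apply find_some in E as [E1 E2]; now rewrite (H3 r').
  - now rewrite (find_none _ _ E _ H1) in H2.
Qed.

Lemma NoDup_fst {A B} (l : list (A * B)) a b b' :
  NoDup (map fst l) -> In (a, b) l -> In (a, b') l -> b = b'.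
Proof.
  induction l as [|[x y] l IH]; simpl; [easy|].
  intros H; inversion_clear H as [|? ? N1 N2]; intros [E|I] [E'|I'].
  - congruence.
  - injection E as -> ->; destruct N1; now apply (in_map fst) in I'.
  - injection E' as -> ->; destruct N1; now apply (in_map fst) in I.
  - auto.
Qed.

Lemma scans_iff (f : nat -> action) (ts : list tape) n :
  scans (map f (seq n (length ts))) ts = true <->
  forall r, r < length ts -> scan (f (n + r)) = scanned (nth r ts blank_tape).
Proof.
  revert n; induction ts as [|t ts IH]; intros n; simpl; [split; [intros _ r L; lia|easy]|].
  rewrite Bool.andb_true_iff, Nat.eqb_eq, IH; split.
  - intros [H1 H2] [|r] L; [now rewrite Nat.add_0_r|].
    replace (n + S r) with (S n + r) by lia; apply H2; lia.
  - intros H; split.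
    + replace n with (n + 0) at 1 by lia; apply (H 0); lia.
    + intros r L; replace (S n + r) with (n + S r) by lia; apply (H (S r)); lia.
Qed.

(** Sources in the table are distinct and the scanned symbols determine the context, so exactly one
    rule applies, wherever it stands in the list. *)
Lemma step_table w T c i :
  NoDup (map fst T) -> In (state c, i) T -> length (work c) = w ->
  scanned (input c) <= 2 -> scanned (output c) <= 2 ->
  (forall t, In t (work c) -> scanned t <= 1) ->
  step (Machine w (table_rules w T)) c =
    Some (apply_rule (rule_of w (state c) i
      (scanned (input c), (scanned (output c), map scanned (work c)))) c).
Proof.
  intros ND HI HL H1 H2 H3; unfold step; simpl rules.
  assert (S3 : forall x, x <= 2 -> In x [0; 1; 2]) by (intros; simpl; lia).
  assert (ON : forall j o, scan (out_action j o) = o) by (now intros []).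
  assert (NT : forall r, nth r (map scanned (work c)) 0 =
                         scanned (nth r (work c) blank_tape))
    by (intros; apply (map_nth scanned _ blank_tape)).
  erewrite find_unique; [reflexivity| | |].
  - apply in_flat_map; exists (state c, i); split; auto; apply in_map; simpl fst.
    apply in_prod; auto; apply in_prod; auto.
    rewrite <- HL, <- (length_map scanned); apply in_words.
    intros s Hs; apply in_map_iff in Hs as [t [<- Ht]]; auto.
  - unfold applies; simpl; rewrite !Nat.eqb_refl, ON, Nat.eqb_refl; simpl.
    rewrite <- HL; apply scans_iff; intros r L; simpl; apply NT.
  - intros r Hr Ha; apply in_flat_map in Hr as [[q j] [Hq Hr]].
    apply in_map_iff in Hr as [[a [o ws]] [<- Hw]]; simpl in *.
    unfold applies in Ha; simpl in Ha; rewrite ON in Ha.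
    apply Bool.andb_true_iff in Ha as [Ha Hs]; apply Bool.andb_true_iff in Ha as [Ha Ho].
    apply Bool.andb_true_iff in Ha as [Hst Hi]; apply Nat.eqb_eq in Hst, Hi, Ho; subst.
    rewrite (NoDup_fst _ _ _ _ ND Hq HI).
    replace ws with (map scanned (work c)); auto.
    assert (L : length ws = length (work c)).
    { unfold contexts in Hw; apply in_prod_iff in Hw as [_ Hw].
      apply in_prod_iff in Hw as [_ Hw]; now apply words_length in Hw. }
    apply nth_ext with 0 0; rewrite length_map; [easy|].
    intros r Hr; rewrite NT; symmetry; now apply (proj1 (scans_iff _ _ 0) Hs).
Qed.

Definition mark (k : nat) : nat := if k =? 0 then 1 else 0.

Definition regs : Type := nat -> nat.

Definition upd (g : regs) (r v : nat) : regs := fun k => if k =? r then v else g k.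

Record pstate := PState { head : nat; out : tape; reg : regs }.

Definition counters (w : nat) (g : regs) : list tape :=
  map (fun r => Tape (g r) mark) (seq 0 w).

Definition conf (w : nat) (u : nat -> nat) (q : nat) (s : pstate) : config :=
  Config q (Tape (head s) u) (out s) (counters w (reg s)).

(** * Structured commands, their execution and their compilation *)

Inductive cmd :=
| Skip
| Inc (r : nat)
| Dec (r : nat)
| Seq (c c' : cmd)
| While (r : nat) (c : cmd)
| Read (r r' : nat)
| Print (a : nat)
| Retreat.

Fixpoint size (c : cmd) : nat :=
  match c with
  | Skip => 0
  | Seq c c' => size c + size c'
  | While _ c => 2 + size c
  | _ => 1
  end.

Fixpoint compile (a : nat) (c : cmd) : table :=
  match c with
  | Skip => []
  | Inc r => [(a, IMove r Right (S a))]
  | Dec r => [(a, IMove r Left (S a))]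
  | Seq c c' => compile a c ++ compile (a + size c) c'
  | While r c =>
      (a, ITest r (a + 2 + size c) (S a)) :: compile (S a) c ++
      [(S a + size c, IJump a)]
  | Read r r' => [(a, IRead r r' (S a))]
  | Print x => [(a, IPrint x (S a))]
  | Retreat => [(a, IRetreat (S a))]
  end.

Fixpoint wide (w : nat) (c : cmd) : Prop :=
  match c with
  | Inc r | Dec r => r < w
  | Seq c c' => wide w c /\ wide w c'
  | While r c => r < w /\ wide w c
  | Read r r' => r < w /\ r' < w
  | _ => True
  end.

Lemma wide_mono w w' c : w <= w' -> wide w c -> wide w' c.
Proof. intros L; induction c; simpl; intuition lia. Qed.

Lemma wide_exists c : exists w, wide w c.
Proof.
  induction c as [|r|r|c [w H] c' [w' H']|r c [w H]|r r'| |].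
  1, 7, 8: now exists 0.
  1, 2: exists (S r); simpl; lia.
  - exists (w + w'); split; [apply wide_mono with w|apply wide_mono with w']; auto; lia.
  - exists (S r + w); split; [lia|apply wide_mono with w; auto; lia].
  - exists (S (r + r')); simpl; lia.
Qed.

Lemma compile_sources c a : map fst (compile a c) = seq a (size c).
Proof.
  revert a; induction c; intros b; simpl; auto.
  - rewrite map_app, IHc1, IHc2; symmetry; apply seq_app.
  - rewrite map_app, IHc; simpl; f_equal.
    exact (eq_sym (seq_S (size c) (S b))).
Qed.

(* [P] holds of the output tape at the start of every elementary step. *)
Inductive exec (u : nat -> nat) (P : tape -> Prop) : cmd -> pstate -> pstate -> Prop :=
| exec_skip s : exec u P Skip s s
| exec_inc r s : P (out s) ->
    exec u P (Inc r) s (PState (head s) (out s) (upd (reg s) r (S (reg s r))))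
| exec_dec r s : P (out s) ->
    exec u P (Dec r) s (PState (head s) (out s) (upd (reg s) r (pred (reg s r))))
| exec_seq c c' s s' s'' : exec u P c s s' -> exec u P c' s' s'' ->
    exec u P (Seq c c') s s''
| exec_exit r c s : P (out s) -> reg s r = 0 -> exec u P (While r c) s s
| exec_loop r c s s' s'' : P (out s) -> P (out s') -> reg s r <> 0 ->
    exec u P c s s' -> exec u P (While r c) s' s'' -> exec u P (While r c) s s''
| exec_read r r' s : P (out s) -> r <> r' ->
    exec u P (Read r r') s (PState (S (head s)) (out s)
      (fun k => reg s k + (if ((u (head s) =? 1) && (k =? r))
                              || ((u (head s) =? 2) && (k =? r')) then 1 else 0)))
| exec_print a s : P (out s) ->
    exec u P (Print a) s
      (PState (head s) (act (Action (scanned (out s)) a Right) (out s)) (reg s))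
| exec_retreat s : P (out s) ->
    exec u P Retreat s
      (PState (head s) (act (Action (scanned (out s)) (scanned (out s)) Left) (out s))
              (reg s)).

(** [P] is carried along because convergence of an output concerns all times, also those in the
    middle of a command. *)
Inductive steps (M : machine) (P : tape -> Prop) : config -> config -> Prop :=
| steps_refl c : steps M P c c
| steps_cons c c' c'' : P (output c) -> step M c = Some c' -> steps M P c' c'' ->
    steps M P c c''.

Lemma steps_trans M P c c' c'' : steps M P c c' -> steps M P c' c'' -> steps M P c c''.
Proof. induction 1; intros; auto; econstructor; eauto. Qed.

Lemma steps_one M (P : tape -> Prop) c c' : P (output c) -> step M c = Some c' -> steps M P c c'.
Proof. intros; eapply steps_cons; eauto; constructor. Qed.

Lemma combine_map_map {A B C} (f : A -> B) (g : A -> C) l :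
  combine (map f l) (map g l) = map (fun x => (f x, g x)) l.
Proof. induction l; simpl; f_equal; auto. Qed.

Lemma act_same (t : tape) m : act (Action (scanned t) (scanned t) m) t =
  Tape (shift_pos m (pos t)) (cells t).
Proof.
  unfold act, scanned; simpl; f_equal; extensionality k.
  destruct (Nat.eqb_spec k (pos t)); congruence.
Qed.

Lemma act_stay (t : tape) : act (Action (scanned t) (scanned t) Stay) t = t.
Proof. destruct t; apply act_same. Qed.

(** Apart from the initialisation, every instruction reprints what it scans on the work tapes, so
    counters keep their mark and only their heads move. *)
Lemma apply_rule_conf w u q s i :
  (forall q', i <> IInit q') ->
  apply_rule (rule_of w q i (u (head s), (scanned (out s),
      map scanned (counters w (reg s))))) (conf w u q s) =
  Config (goto i (map scanned (counters w (reg s))))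
    (Tape (shift_pos (in_shift i) (head s)) u)
    (act (out_action i (scanned (out s))) (out s))
    (counters w (fun r => shift_pos (work_shift i (u (head s)) r) (reg s r))).
Proof.
  intros N; unfold apply_rule; simpl; f_equal.
  unfold counters at 3; rewrite combine_map_map, map_map; simpl.
  unfold counters; apply map_ext_in; intros r Hr; apply in_seq in Hr.
  rewrite map_map; simpl.
  rewrite (nth_indep _ 0 (scanned (Tape (reg s 0) mark))) by (rewrite length_map, length_seq; lia).
  rewrite (map_nth (fun r => scanned (Tape (reg s r) mark))), seq_nth by lia; simpl.
  replace (work_print i (mark (reg s r))) with (mark (reg s r))
    by (destruct i; auto; now edestruct N).
  exact (act_same (Tape (reg s r) mark) _).
Qed.

Lemma nth_counters w g r : r < w ->
  nth r (map scanned (counters w g)) 0 = mark (g r).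
Proof.
  intros H; unfold counters; rewrite map_map.
  rewrite (nth_indep _ 0 (scanned (Tape (g 0) mark))) by (rewrite length_map, length_seq; lia).
  now rewrite (map_nth (fun r => scanned (Tape (g r) mark))), seq_nth by lia.
Qed.

Lemma step_conf w u T q s i :
  NoDup (map fst T) -> (forall k, u k <= 2) -> (forall k, cells (out s) k <= 2) ->
  In (q, i) T -> (forall q', i <> IInit q') ->
  step (Machine w (table_rules w T)) (conf w u q s) = Some (
    Config (goto i (map scanned (counters w (reg s))))
      (Tape (shift_pos (in_shift i) (head s)) u)
      (act (out_action i (scanned (out s))) (out s))
      (counters w (fun r => shift_pos (work_shift i (u (head s)) r) (reg s r)))).
Proof.
  intros ND Hu Ho HI HN; rewrite step_table with (i := i); auto.
  - f_equal; simpl state; now apply apply_rule_conf.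
  - unfold conf, counters; simpl; now rewrite length_map, length_seq.
  - apply Hu.
  - apply Ho.
  - simpl; intros t Ht; apply in_map_iff in Ht as [r [<- _]].
    unfold scanned, mark; simpl; destruct (g _ =? 0) || destruct (_ =? 0); lia.
Qed.

Lemma config_eq q i i' o o' ts ts' :
  i = i' -> o = o' -> ts = ts' -> Config q i o ts = Config q i' o' ts'.
Proof. congruence. Qed.

(** Induction on the execution and not on the command: the remaining rounds of a loop are a smaller
    derivation for the same [While]. The address [a] stays general because subcommands sit at other
    addresses. *)
Lemma compile_steps w u T P c s s' :
  NoDup (map fst T) -> (forall k, u k <= 2) ->
  (forall o, P o -> forall k, cells o k <= 2) ->
  exec u P c s s' -> wide w c -> forall a, incl (compile a c) T ->
  steps (Machine w (table_rules w T)) P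
    (conf w u a s) (conf w u (a + size c) s').
Proof.
  intros ND Hu HP E.
  assert (X : forall q i s, In (q, i) T -> P (out s) -> (forall q', i <> IInit q') ->
    forall c', Config (goto i (map scanned (counters w (reg s))))
      (Tape (shift_pos (in_shift i) (head s)) u)
      (act (out_action i (scanned (out s))) (out s))
      (counters w (fun r => shift_pos (work_shift i (u (head s)) r) (reg s r))) = c' ->
    steps (Machine w (table_rules w T)) P (conf w u q s) c').
  { intros q i t HI Ht HN c' <-; apply steps_one; auto.
    apply step_conf; auto; now apply HP. }
  induction E as [s|r s H|r s H|c c' s s' s'' E1 IH1 E2 IH2|r c s H Z
    |r c s s' s'' H H' Z E1 IH1 E2 IH2|r r' s H H'|x s H|s H];
    intros Hw a HT; simpl in Hw, HT; simpl size;
    rewrite ?Nat.add_1_r.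
  - rewrite Nat.add_0_r; constructor.
  - eapply X; [apply HT; now left|auto|easy|]; simpl; unfold conf; simpl.
    apply config_eq; auto using act_stay; f_equal; extensionality k; unfold upd.
    destruct (Nat.eqb_spec k r); subst; auto.
  - eapply X; [apply HT; now left|auto|easy|]; simpl; unfold conf; simpl.
    apply config_eq; auto using act_stay; f_equal; extensionality k; unfold upd.
    destruct (Nat.eqb_spec k r); subst; auto.
  - apply incl_app_inv in HT as [HT1 HT2]; eapply steps_trans; [now apply IH1|].
    rewrite Nat.add_assoc; now apply IH2.
  - eapply X; [apply HT; now left|auto|easy|]; simpl; unfold conf; simpl.
    rewrite nth_counters, Z by tauto; simpl.
    replace (a + S (S (size c))) with (a + 2 + size c) by lia; now rewrite act_stay.
  - destruct Hw as [Hr Hw]; apply incl_cons_inv in HT as [HT1 HT2].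
    pose proof (incl_app_inv _ _ HT2) as [HT3 HT4].
    eapply steps_trans; [eapply X; [exact HT1|auto|easy|]; simpl; rewrite nth_counters by auto|].
    { unfold mark; destruct (Nat.eqb_spec (reg s r) 0); [contradiction|]; simpl.
      rewrite act_stay; reflexivity. }
    change (steps (Machine w (table_rules w T)) P (conf w u (S a) s)
      (conf w u (a + S (S (size c))) s'')).
    eapply steps_trans; [now apply IH1|].
    eapply steps_trans; [eapply X; [apply HT4; now left|auto|easy|]; simpl; now rewrite act_stay|].
    apply IH2; [now split|].
    intros x [<-|Hx]; auto.
  - eapply X; [apply HT; now left|auto|easy|]; simpl; unfold conf; simpl.
    apply config_eq; auto using act_stay; f_equal; extensionality k.
    destruct (_ || _); simpl; lia.
  - eapply X; [apply HT; now left|auto|easy|]; reflexivity.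
  - eapply X; [apply HT; now left|auto|easy|]; reflexivity.
Qed.

(** * Functions computed by counter programs *)

(** Pure computation: head and output rest. The quantifier over [P] lets such a command stand inside
    any larger execution, whatever is recorded there about the output. *)
Definition pexec (c : cmd) (g g' : regs) : Prop :=
  forall u (P : tape -> Prop) n o, P o ->
    exec u P c (PState n o g) (PState n o g').

Fixpoint forward (c : cmd) : Prop :=
  match c with
  | Seq c c' => forward c /\ forward c'
  | While _ c => forward c
  | Retreat => False
  | _ => True
  end.

Lemma pexec_seq c c' g g' g'' : pexec c g g' -> pexec c' g' g'' -> pexec (Seq c c') g g''.
Proof. intros H H' u P n o Po; econstructor; eauto. Qed.

Lemma pexec_inc r g g' : upd g r (S (g r)) = g' -> pexec (Inc r) g g'.
Proof. intros <- u P n o Po; now apply (exec_inc u P r (PState n o g)). Qed.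

Lemma pexec_dec r g g' : upd g r (pred (g r)) = g' -> pexec (Dec r) g g'.
Proof. intros <- u P n o Po; now apply (exec_dec u P r (PState n o g)). Qed.

(** A closed form [G] for the registers after [i] rounds replaces a separate induction for each loop
    below. *)
Lemma pexec_loop c r (G : nat -> regs) k :
  (forall i, i < k -> G i r <> 0 /\ pexec c (G i) (G (S i))) -> G k r = 0 ->
  pexec (While r c) (G 0) (G k).
Proof.
  revert G; induction k as [|k IH]; intros G H Z u P n o Po.
  - now constructor.
  - destruct (H 0) as [H1 H2]; [lia|].
    eapply exec_loop with (s' := PState n o (G 1)); auto.
    apply (IH (fun i => G (S i))); auto; intros i L; apply H; lia.
Qed.

Lemma pexec_eq c g g1 g2 : pexec c g g1 -> g1 = g2 -> pexec c g g2.
Proof. now intros H <-. Qed.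

Ltac regs_eq :=
  let k := fresh "k" in
  extensionality k; unfold upd;
  repeat match goal with
    |- context [?a =? ?b] => destruct (Nat.eqb_spec a b)
  end; subst; try lia; auto.

Ltac regs_at := unfold upd;
  repeat match goal with
    |- context [?a =? ?b] => destruct (Nat.eqb_spec a b); try lia
  end; auto.

Definition move_reg (r s : nat) : cmd := While r (Seq (Dec r) (Inc s)).

Lemma pexec_move r s g g' : r <> s ->
  upd (upd g s (g s + g r)) r 0 = g' -> pexec (move_reg r s) g g'.
Proof.
  intros N <-.
  set (G := fun i => upd (upd g s (g s + i)) r (g r - i)).
  replace g with (G 0) at 1 by (unfold G; regs_eq).
  replace (upd _ r 0) with (G (g r)) by (unfold G; regs_eq).
  apply pexec_loop; [|unfold G; regs_at].
  intros i L; split; [unfold G; regs_at|].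
  eapply pexec_seq; [now apply pexec_dec|apply pexec_inc]; unfold G; regs_eq.
Qed.

(** A counter is read by emptying it, so a second copy is made in the scratch register [t] and moved
    back. *)
Definition copy_reg (r s t : nat) : cmd :=
  Seq (While r (Seq (Dec r) (Seq (Inc s) (Inc t)))) (move_reg t r).

Lemma pexec_copy r s t g g' : r <> s -> r <> t -> s <> t -> g t = 0 ->
  upd g s (g s + g r) = g' -> pexec (copy_reg r s t) g g'.
Proof.
  intros N1 N2 N3 Z <-.
  set (G := fun i => upd (upd (upd g s (g s + i)) r (g r - i)) t i).
  apply pexec_seq with (G (g r)).
  - replace g with (G 0) at 1 by (unfold G; regs_eq).
    apply pexec_loop; [|unfold G; regs_at].
    intros i L; split; [unfold G; regs_at|].
    eapply pexec_seq; [now apply pexec_dec|].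
    eapply pexec_seq; [now apply pexec_inc|apply pexec_inc]; unfold G; regs_eq.
  - apply pexec_move; [easy|]; unfold G; regs_eq.
Qed.

Definition clear (r : nat) : cmd := While r (Dec r).

Lemma pexec_clear r g g' : upd g r 0 = g' -> pexec (clear r) g g'.
Proof.
  intros <-; set (G := fun i => upd g r (g r - i)).
  replace g with (G 0) at 1 by (unfold G; regs_eq).
  replace (upd g r 0) with (G (g r)) by (unfold G; regs_eq).
  apply pexec_loop; [|unfold G; regs_at].
  intros i L; split; [unfold G; regs_at|].
  apply pexec_dec; unfold G; regs_eq.
Qed.

(** Argument and result share register [b]. All registers above [b] are scratch space, zero before
    and again zero after, so programs can be combined by choosing larger bases. *)
Definition prog (f : nat -> nat) : Prop := forall b, exists c, forward c /\
  forall g, (forall r, b < r -> g r = 0) -> pexec c g (upd g b (f (g b))).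

Lemma prog_ext f f' : (forall n, f n = f' n) -> prog f -> prog f'.
Proof. intros E; now replace f' with f by now extensionality n. Qed.

Lemma prog_id : prog (fun n => n).
Proof.
  intros b; exists Skip; split; [easy|]; intros g _.
  replace (upd g b (g b)) with g by regs_eq; intros u P n o _; constructor.
Qed.

Lemma prog_succ : prog S.
Proof. intros b; exists (Inc b); split; [easy|]; intros; now apply pexec_inc. Qed.

Lemma prog_comp f f' : prog f -> prog f' -> prog (fun n => f (f' n)).
Proof.
  intros H H' b; destruct (H b) as [c [F C]], (H' b) as [c' [F' C']].
  exists (Seq c' c); split; [easy|]; intros g Z; eapply pexec_seq; [now apply C'|].
  eapply pexec_eq; [apply C; intros; regs_at|regs_eq].
Qed.

Lemma prog_const k : prog (fun _ => k).
Proof.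
  induction k as [|k IH].
  - intros b; exists (clear b); split; [easy|]; intros; now apply pexec_clear.
  - exact (prog_comp _ _ prog_succ IH).
Qed.

(** Written with [nat_rec] exactly as inside [Cantor.to_nat], so that [cpair x y] converts to
    [y + triangle (y + x)]. *)
Definition triangle (n : nat) : nat := nat_rec (fun _ => nat) 0 (fun i m => S i + m) n.

(** The first loop leaves x + y in [x] and y in [z]; the second adds x + y, then x + y - 1, and so
    on down to 1 to [z], which is the triangular number in Cantor's formula. *)
Definition pair_reg (x y z : nat) : cmd :=
  Seq (While y (Seq (Dec y) (Seq (Inc z) (Inc x))))
      (While x (Seq (copy_reg x z y) (Dec x))).

Lemma pexec_pair x y z g g' : x <> y -> x <> z -> y <> z -> g z = 0 ->
  upd (upd (upd g x 0) y 0) z (cpair (g x) (g y)) = g' ->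
  pexec (pair_reg x y z) g g'.
Proof.
  intros N1 N2 N3 Z <-; set (s := g x + g y).
  set (H := upd (upd (upd g x s) y 0) z (g y)).
  apply pexec_seq with H.
  - set (G := fun i => upd (upd (upd g x (g x + i)) y (g y - i)) z i).
    replace g with (G 0) at 1 by (unfold G; regs_eq).
    replace H with (G (g y)) by (unfold G, H; regs_eq).
    apply pexec_loop; [|unfold G; regs_at].
    intros i L; split; [unfold G; regs_at|].
    eapply pexec_seq; [now apply pexec_dec|].
    eapply pexec_seq; [now apply pexec_inc|apply pexec_inc]; unfold G; regs_eq.
  - set (G := fun i => upd (upd H x (s - i)) z (g y + (triangle s - triangle (s - i)))).
    assert (T : forall i, i < s -> triangle (s - i) = (s - i) + triangle (s - S i)).
    { intros i L; replace (s - i) with (S (s - S i)) by lia; reflexivity. }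
    assert (T' : forall i, triangle (s - i) <= triangle s).
    { induction i as [|i IH]; [now rewrite Nat.sub_0_r|].
      destruct (Nat.lt_ge_cases i s) as [L|L]; [specialize (T i L); lia|].
      now replace (s - S i) with (s - i) by lia. }
    replace H with (G 0) at 1 by (unfold G, H; regs_eq; rewrite Nat.sub_0_r; lia).
    replace (upd _ z _) with (G s).
    + apply pexec_loop; [|unfold G; regs_at].
      intros i L; split; [unfold G; regs_at|].
      specialize (T i L); pose proof (T' i).
      eapply pexec_seq; [apply pexec_copy; auto|apply pexec_dec]; unfold G, H; [regs_at|regs_eq].
    + unfold G, H; regs_eq; rewrite Nat.sub_diag; simpl.
      change (cpair (g x) (g y)) with (g y + triangle (g y + g x)).
      unfold s; rewrite (Nat.add_comm (g y) (g x)); lia.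
Qed.

Lemma prog_pair f f' : prog f -> prog f' -> prog (fun n => cpair (f n) (f' n)).
Proof.
  intros H H' b; destruct (H (2 + b)) as [c [F C]], (H' (1 + b)) as [c' [F' C']].
  exists (Seq (copy_reg b (1 + b) (2 + b)) (Seq c'
         (Seq (copy_reg b (2 + b) (3 + b)) (Seq c
         (Seq (clear b) (pair_reg (2 + b) (1 + b) b)))))); split; [repeat split; easy|].
  intros g Z.
  pose proof (Z (1 + b)) as Z1; pose proof (Z (2 + b)) as Z2; pose proof (Z (3 + b)) as Z3.
  eapply pexec_seq; [apply pexec_copy; auto; lia|].
  eapply pexec_seq; [apply C'; intros; regs_at; apply Z; lia|].
  eapply pexec_seq; [apply pexec_copy; try reflexivity; regs_at; lia|].
  eapply pexec_seq; [apply C; intros; regs_at; apply Z; lia|].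
  eapply pexec_seq; [now apply pexec_clear|].
  apply pexec_pair; try lia; [regs_at|].
  extensionality k; unfold upd.
  rewrite !Nat.eqb_refl.
  repeat (match goal with |- context [?a =? ?b] =>
    lazymatch a with k => fail | _ => replace (a =? b) with false
      by (symmetry; apply Nat.eqb_neq; lia) end end).
  rewrite Z1, Z2 by lia; simpl.
  repeat match goal with
    |- context [k =? ?b] => destruct (Nat.eqb_spec k b)
  end; subst; try lia; auto; rewrite Z; lia.
Qed.

(** The successor in Cantor's enumeration: one place along the diagonal, or from its end to the
    start of the next. Unpairing [n] walks [n] places and never inverts the triangular numbers. *)
Definition unpair_step (p : nat * nat) : nat * nat :=
  let '(x, y) := p in match x with S x => (x, S y) | _ => (S y, 0) end.

Lemma of_nat_iter n : of_nat n = Nat.iter n unpair_step (0, 0).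
Proof. induction n as [|n IH]; [easy|]; simpl; now rewrite <- IH. Qed.

(** Loops that run at most once serve as conditionals. The rest of [x] is parked in [v] so that the
    loop on [x] stops, and the flag [t] survives exactly when [x] was zero. *)
Definition unpair_reg (b : nat) : cmd :=
  let x := 1 + b in let y := 2 + b in let t := 3 + b in let v := 4 + b in
  While b (Seq (Dec b) (Seq (Inc t)
    (Seq (While x (Seq (Dec x) (Seq (Inc y) (Seq (Dec t) (move_reg x v)))))
    (Seq (move_reg v x)
         (While t (Seq (Dec t) (Seq (move_reg y x) (Inc x)))))))).

Lemma pexec_once c r g g' : g r <> 0 -> g' r = 0 -> pexec c g g' -> pexec (While r c) g g'.
Proof.
  intros H H' E; apply (pexec_loop c r (fun i => if i =? 0 then g else g') 1); auto.
  intros [|i] L; [easy|lia].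
Qed.

Lemma pexec_never c r g g' : g r = 0 -> g = g' -> pexec (While r c) g g'.
Proof. intros H <-; apply (pexec_loop c r (fun i => g) 0); auto; lia. Qed.

Lemma pexec_unpair b g g' : (forall r, b < r -> g r = 0) ->
  upd (upd (upd g b 0) (1 + b) (fst (of_nat (g b)))) (2 + b) (snd (of_nat (g b))) = g' ->
  pexec (unpair_reg b) g g'.
Proof.
  intros Z <-.
  assert (Z1 : g (1 + b) = 0) by (apply Z; lia).
  assert (Z2 : g (2 + b) = 0) by (apply Z; lia).
  assert (Z3 : g (3 + b) = 0) by (apply Z; lia).
  assert (Z4 : g (4 + b) = 0) by (apply Z; lia).
  set (G := fun i => upd (upd (upd g b (g b - i)) (1 + b) (fst (of_nat i))) (2 + b) (snd (of_nat i))).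
  replace g with (G 0) at 1 by (unfold G; regs_eq).
  replace (upd _ (2 + b) _) with (G (g b)) by (unfold G; regs_eq).
  apply pexec_loop; [|unfold G; regs_at].
  intros i L; split; [unfold G; regs_at|].
  assert (E : of_nat (S i) = unpair_step (of_nat i)) by now rewrite !of_nat_iter.
  unfold G; rewrite E; destruct (of_nat i) as [x y]; simpl fst; simpl snd.
  eapply pexec_seq; [now apply pexec_dec|].
  eapply pexec_seq; [now apply pexec_inc|].
  destruct x as [|x]; simpl unpair_step; cbv iota beta; simpl fst; simpl snd.
  - eapply pexec_seq; [apply pexec_never; [regs_at|reflexivity]|].
    eapply pexec_seq; [apply pexec_move; [lia|reflexivity]|].
    apply pexec_once; [regs_at|regs_at|].
    eapply pexec_seq; [now apply pexec_dec|].
    eapply pexec_seq; [apply pexec_move; [lia|reflexivity]|].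
    apply pexec_inc; regs_eq.
  - eapply pexec_seq; [eapply pexec_once with
      (g' := upd (upd (upd (upd (upd g b (g b - S i)) (1 + b) 0) (2 + b) (S y)) (3 + b) 0) (4 + b) x);
      [regs_at|regs_at|]|].
    + eapply pexec_seq; [now apply pexec_dec|].
      eapply pexec_seq; [now apply pexec_inc|].
      eapply pexec_seq; [now apply pexec_dec|].
      apply pexec_move; [lia|]; regs_eq.
    + eapply pexec_seq; [apply pexec_move; [lia|reflexivity]|].
      apply pexec_never; [regs_at|]; regs_eq.
Qed.

Lemma prog_fst : prog (fun n => fst (of_nat n)).
Proof.
  intros b; exists (Seq (unpair_reg b) (Seq (clear (2 + b)) (move_reg (1 + b) b))).
  split; [repeat split|]; intros g Z.
  eapply pexec_seq; [now apply pexec_unpair|].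
  eapply pexec_seq; [now apply pexec_clear|].
  apply pexec_move; [lia|]; regs_eq; rewrite Z; lia.
Qed.

Lemma prog_snd : prog (fun n => snd (of_nat n)).
Proof.
  intros b; exists (Seq (unpair_reg b) (Seq (clear (1 + b)) (move_reg (2 + b) b))).
  split; [repeat split|]; intros g Z.
  eapply pexec_seq; [now apply pexec_unpair|].
  eapply pexec_seq; [now apply pexec_clear|].
  apply pexec_move; [lia|]; regs_eq; rewrite Z; lia.
Qed.

(** Iteration is the only recursion scheme; case distinction, predecessor and recursion on lists are
    obtained from it by iterating on pairs. *)
Lemma prog_iter f : prog f ->
  prog (fun n => Nat.iter (fst (of_nat n)) f (snd (of_nat n))).
Proof.
  intros H b; destruct (H (2 + b)) as [c [F C]].
  exists (Seq (unpair_reg b) (Seq (While (1 + b) (Seq (Dec (1 + b)) c)) (move_reg (2 + b) b))).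
  split; [repeat split; easy|]; intros g Z.
  eapply pexec_seq; [now apply pexec_unpair|].
  destruct (of_nat (g b)) as [n x]; simpl fst; simpl snd.
  set (G := fun i => upd (upd (upd g b 0) (1 + b) (n - i)) (2 + b) (Nat.iter i f x)).
  apply pexec_seq with (G n).
  - replace (upd _ (2 + b) x) with (G 0) by (unfold G; regs_eq).
    apply pexec_loop; [|unfold G; regs_at].
    intros i L; split; [unfold G; regs_at|].
    eapply pexec_seq; [now apply pexec_dec|].
    eapply pexec_eq; [apply C; intros; unfold G; regs_at; apply Z; lia|].
    unfold G; regs_eq; simpl; rewrite Nat.eqb_refl; auto.
  - apply pexec_move; [lia|]; unfold G; regs_eq; rewrite Z; lia.
Qed.

(** * Computability of functions between encoded types *)

Class Enc (A : Type) := enc : A -> nat.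

#[export] Instance enc_nat : Enc nat := fun n => n.
#[export] Instance enc_bool : Enc bool := fun b => if b then 1 else 0.
#[export] Instance enc_prod A B `{Enc A} `{Enc B} : Enc (A * B) :=
  fun p => cpair (enc (fst p)) (enc (snd p)).
(** The same coding as in [code_machine], so that an index of a machine is itself the value of a
    computable function. *)
#[export] Instance enc_list A `{Enc A} : Enc (list A) := fun l => code_list (map enc l).
#[export] Instance enc_option A `{Enc A} : Enc (option A) :=
  fun x => match x with None => 0 | Some a => S (enc a) end.

(** [g] is constrained on codes only, so numbers that code nothing never have to be recognised. *)
Definition comp {A B} `{Enc A} `{Enc B} (f : A -> B) : Prop :=
  exists g, prog g /\ forall a, enc (f a) = g (enc a).

Lemma fst_cpair x y : fst (of_nat (cpair x y)) = x.
Proof. unfold cpair; now rewrite cancel_of_to. Qed.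

Lemma snd_cpair x y : snd (of_nat (cpair x y)) = y.
Proof. unfold cpair; now rewrite cancel_of_to. Qed.

Lemma prog_iter_of f n x : prog f -> prog n -> prog x ->
  prog (fun z => Nat.iter (n z) f (x z)).
Proof.
  intros Hf Hn Hx; eapply prog_ext;
    [|apply (prog_comp _ _ (prog_iter f Hf) (prog_pair _ _ Hn Hx))].
  intros z; simpl; now rewrite fst_cpair, snd_cpair.
Qed.

(** Iterating the map (a, b) to (b, b) on (g, h): zero rounds leave [g] in front, any positive
    number of rounds puts [h] there. *)
Lemma prog_cond f g h : prog f -> prog g -> prog h ->
  prog (fun n => if f n =? 0 then g n else h n).
Proof.
  intros Hf Hg Hh.
  eapply prog_ext; [|eapply (prog_comp _ _ prog_fst)].
  2: eapply (prog_iter_of (fun p => cpair (snd (of_nat p)) (snd (of_nat p))) f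
       (fun n => cpair (g n) (h n))); auto using prog_pair, prog_snd.
  intros n; simpl; destruct (f n) as [|k]; simpl; [now rewrite fst_cpair|].
  rewrite fst_cpair; clear; induction k as [|k IH]; simpl; rewrite snd_cpair; auto.
Qed.

(** Iterating (a, b) to (b, b + 1) from (0, 0), the first component lags one behind. *)
Lemma prog_pred : prog pred.
Proof.
  eapply prog_ext; [|eapply (prog_comp _ _ prog_fst)].
  2: eapply (prog_iter_of (fun p => cpair (snd (of_nat p)) (S (snd (of_nat p))))
       (fun n => n) (fun _ => cpair 0 0)); auto using prog_id, prog_const.
  2: apply prog_pair; [|apply (prog_comp S)]; auto using prog_snd, prog_succ.
  assert (E : forall n, Nat.iter n (fun p => cpair (snd (of_nat p)) (S (snd (of_nat p))))
    (cpair 0 0) = cpair (pred n) n).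
  { induction n as [|n IH]; [easy|]; simpl Nat.iter; rewrite IH, snd_cpair; easy. }
  intros n; simpl; now rewrite E, fst_cpair.
Qed.

Section Comp.

Context {A B C D : Type} `{Enc A} `{Enc B} `{Enc C} `{Enc D}.

Lemma comp_ext (f f' : A -> B) : (forall a, f a = f' a) -> comp f -> comp f'.
Proof. intros E; now replace f' with f by now extensionality a. Qed.

Lemma comp_comp (g : B -> C) (f : A -> B) : comp g -> comp f -> comp (fun a => g (f a)).
Proof.
  intros [g' [P' E']] [f' [P E]]; exists (fun n => g' (f' n)); split.
  - now apply prog_comp.
  - intros a; now rewrite E', E.
Qed.

Lemma comp_id : comp (fun a : A => a).
Proof. exists (fun n => n); split; auto using prog_id. Qed.

Lemma comp_const (b : B) : comp (fun _ : A => b).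
Proof. exists (fun _ => enc b); split; auto using prog_const. Qed.

Lemma comp_enc (f : A -> B) : comp f -> comp (fun a => enc (f a)).
Proof. intros [g [P E]]; now exists g. Qed.

Lemma comp_pair (f : A -> B) (g : A -> C) : comp f -> comp g -> comp (fun a => (f a, g a)).
Proof.
  intros [f' [P E]] [g' [P' E']]; exists (fun n => cpair (f' n) (g' n)).
  split; [now apply prog_pair|]; intros a; unfold enc at 1, enc_prod; simpl; now rewrite E, E'.
Qed.

Lemma comp_fst (f : A -> B * C) : comp f -> comp (fun a => fst (f a)).
Proof.
  intros [f' [P E]]; exists (fun n => fst (of_nat (f' n))).
  split; [apply (prog_comp _ _ prog_fst P)|]; intros a; rewrite <- E; symmetry.
  apply fst_cpair.
Qed.

Lemma comp_snd (f : A -> B * C) : comp f -> comp (fun a => snd (f a)).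
Proof.
  intros [f' [P E]]; exists (fun n => snd (of_nat (f' n))).
  split; [apply (prog_comp _ _ prog_snd P)|]; intros a; rewrite <- E; symmetry.
  apply snd_cpair.
Qed.

Lemma comp_S (f : A -> nat) : comp f -> comp (fun a => S (f a)).
Proof.
  intros [f' [P E]]; exists (fun n => S (f' n)).
  split; [apply (prog_comp _ _ prog_succ P)|]; intros a; now rewrite <- E.
Qed.

Lemma comp_pred (f : A -> nat) : comp f -> comp (fun a => pred (f a)).
Proof.
  intros [f' [P E]]; exists (fun n => pred (f' n)).
  split; [apply (prog_comp _ _ prog_pred P)|]; intros a; now rewrite <- E.
Qed.

Lemma comp_if (b : A -> bool) (f g : A -> B) : comp b -> comp f -> comp g ->
  comp (fun a => if b a then f a else g a).
Proof.
  intros [b' [Pb Eb]] [f' [P E]] [g' [P' E']].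
  exists (fun n => if b' n =? 0 then g' n else f' n); split; [now apply prog_cond|].
  intros a; rewrite <- Eb; now destruct (b a).
Qed.

Lemma comp_nat_case (n : A -> nat) (f : A -> B) (g : A -> nat -> B) :
  comp n -> comp f -> comp (fun p => g (fst p) (snd p)) ->
  comp (fun a => match n a with 0 => f a | S k => g a k end).
Proof.
  intros [n' [Pn En]] [f' [P E]] [g' [P' E']].
  exists (fun z => if n' z =? 0 then f' z else g' (cpair z (pred (n' z)))); split.
  - apply prog_cond; auto; apply (prog_comp g'); auto; apply prog_pair; auto using prog_id.
    now apply prog_comp; [apply prog_pred|].
  - intros a; rewrite <- En; unfold enc at 2 3, enc_nat.
    destruct (n a) as [|k]; [apply E|]; exact (E' (a, k)).
Qed.

(** The iterated map depends on the parameter, so the iteration runs on pairs that carry the code of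
    [a] along. *)
Lemma comp_iter (n : A -> nat) (F : A -> B -> B) (x : A -> B) :
  comp n -> comp (fun p => F (fst p) (snd p)) -> comp x ->
  comp (fun a => Nat.iter (n a) (F a) (x a)).
Proof.
  intros [n' [Pn En]] [F' [PF EF]] [x' [Px Ex]].
  set (G := fun z => cpair (fst (of_nat z)) (F' z)).
  exists (fun z => snd (of_nat (Nat.iter (n' z) G (cpair z (x' z))))); split.
  - apply (prog_comp _ _ prog_snd), prog_iter_of; auto using prog_pair, prog_id.
    apply prog_pair; auto using prog_fst.
  - intros a; rewrite <- En, <- Ex; unfold enc at 3, enc_nat.
    assert (E : forall k, Nat.iter k G (cpair (enc a) (enc (x a))) =
                cpair (enc a) (enc (Nat.iter k (F a) (x a)))).
    { induction k as [|k IH]; [easy|]; simpl Nat.iter; rewrite IH; unfold G at 1.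
      rewrite fst_cpair; f_equal; symmetry; exact (EF (a, Nat.iter k (F a) (x a))). }
    now rewrite E, snd_cpair.
Qed.

Lemma comp_cons (f : A -> B) (l : A -> list B) :
  comp f -> comp l -> comp (fun a => f a :: l a).
Proof.
  intros [f' [P E]] [l' [P' E']]; exists (fun n => S (cpair (f' n) (l' n))); split.
  - apply (prog_comp _ _ prog_succ), prog_pair; auto.
  - intros a; rewrite <- E, <- E'; reflexivity.
Qed.

Lemma comp_list_case (l : A -> list B) (f : A -> C) (g : A -> B -> list B -> C) :
  comp l -> comp f -> comp (fun p => g (fst p) (fst (snd p)) (snd (snd p))) ->
  comp (fun a => match l a with [] => f a | x :: t => g a x t end).
Proof.
  intros [l' [Pl El]] [f' [P E]] [g' [P' E']].
  exists (fun z => if l' z =? 0 then f' z else g' (cpair z (pred (l' z)))); split.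
  - apply prog_cond; auto; apply (prog_comp g'); auto; apply prog_pair; auto using prog_id.
    now apply prog_comp; [apply prog_pred|].
  - intros a; rewrite <- El; destruct (l a) as [|x t]; [apply E|].
    exact (E' (a, (x, t))).
Qed.

Lemma comp_Some (f : A -> B) : comp f -> comp (fun a => Some (f a)).
Proof.
  intros [f' [P E]]; exists (fun n => S (f' n)).
  split; [apply (prog_comp _ _ prog_succ P)|]; intros a; now rewrite <- E.
Qed.

Lemma comp_option_case (o : A -> option B) (f : A -> C) (g : A -> B -> C) :
  comp o -> comp f -> comp (fun p => g (fst p) (snd p)) ->
  comp (fun a => match o a with None => f a | Some x => g a x end).
Proof.
  intros [o' [Po Eo]] [f' [P E]] [g' [P' E']].
  exists (fun z => if o' z =? 0 then f' z else g' (cpair z (pred (o' z)))); split.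
  - apply prog_cond; auto; apply (prog_comp g'); auto; apply prog_pair; auto using prog_id.
    now apply prog_comp; [apply prog_pred|].
  - intros a; rewrite <- Eo; destruct (o a) as [x|]; [|apply E].
    exact (E' (a, x)).
Qed.

End Comp.

Ltac comp_lib := fail.

Ltac comp_step := first
  [ assumption | apply comp_const | apply comp_id
  | lazymatch goal with
    | |- comp (@fst _ _) => apply (comp_fst (fun x => x))
    | |- comp (@snd _ _) => apply (comp_snd (fun x => x))
    | |- comp S => apply (comp_S (fun x => x))
    | |- comp (fun x => fst (@?f x)) => apply (comp_fst f)
    | |- comp (fun x => snd (@?f x)) => apply (comp_snd f)
    | |- comp (fun x => (@?f x, @?g x)) => apply (comp_pair f g)
    | |- comp (fun x => S (@?f x)) => apply (comp_S f)
    | |- comp (fun x => pred (@?f x)) => apply (comp_pred f)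
    | |- comp (fun x => @?f x :: @?l x) => apply (comp_cons f l)
    | |- comp (fun x => Some (@?f x)) => apply (comp_Some f)
    | |- comp (fun x => enc (@?f x)) => apply (comp_enc f)
    | |- comp (fun x => if @?b x then @?f x else @?g x) => apply (comp_if b f g)
    end
  | comp_lib
  | apply comp_iter | apply comp_list_case | apply comp_option_case | apply comp_nat_case
  | lazymatch goal with |- comp (?F ?c) => change (comp (fun x => F c x)) end ].

Ltac comp := repeat (comp_step; cbv beta).

Lemma cpair_ge x y : x <= cpair x y /\ y <= cpair x y.
Proof.
  pose proof (to_nat_spec x y); unfold cpair; split; nia.
Qed.

(** The code of a list bounds the number of iterations needed to traverse it; surplus iterations
    find the empty list and are idle. *)
Lemma length_enc {A} `{Enc A} (l : list A) : length l <= enc l.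
Proof.
  induction l as [|x l IH]; [easy|]; simpl.
  change (enc (x :: l)) with (S (cpair (enc x) (enc l))).
  pose proof (cpair_ge (enc x) (enc l)); lia.
Qed.

Section Lists.

Context {A B C : Type} `{Enc A} `{Enc B} `{Enc C}.

Lemma comp_fold_left (F : A -> B -> C -> B) (l : A -> list C) (x : A -> B) :
  comp (fun p => F (fst p) (fst (snd p)) (snd (snd p))) -> comp l -> comp x ->
  comp (fun a => fold_left (F a) (l a) (x a)).
Proof.
  intros HF Hl Hx.
  set (G := fun (a : A) (p : B * list C) =>
    match snd p with [] => p | y :: t => (F a (fst p) y, t) end).
  apply comp_ext with (f := fun a => fst (Nat.iter (enc (l a)) (G a) (x a, l a))).
  - intros a; assert (E : forall n l x, length l <= n ->
      Nat.iter n (G a) (x, l) = (fold_left (F a) l x, [])).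
    { intros n; induction n as [|n IH]; intros [|y t] z L; simpl in L; try easy; try lia.
      - rewrite Nat.iter_succ_r; unfold G at 2; simpl; apply IH; simpl; lia.
      - rewrite Nat.iter_succ_r; unfold G at 2; simpl; apply IH; lia. }
    rewrite E; auto using length_enc.
  - apply comp_fst, comp_iter; [comp| |comp].
    unfold G; comp.
    apply (comp_comp (fun p => F (fst p) (fst (snd p)) (snd (snd p)))
      (fun p : (A * (B * list C)) * (C * list C) =>
         (fst (fst p), (fst (snd (fst p)), fst (snd p))))); comp.
Qed.

End Lists.

Section Arguments.

Context {A B C D E' F' : Type}
  `{Enc A} `{Enc B} `{Enc C} `{Enc D} `{Enc E'} `{Enc F'}.

Lemma comp2 (F : B -> C -> D) (f : A -> B) (g : A -> C) :
  comp (fun p => F (fst p) (snd p)) -> comp f -> comp g -> comp (fun a => F (f a) (g a)).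
Proof.
  intros HF Hf Hg; exact (comp_comp _ (fun a => (f a, g a)) HF (comp_pair f g Hf Hg)).
Qed.

Lemma comp3 (F : B -> C -> D -> E') (f : A -> B) (g : A -> C) (h : A -> D) :
  comp (fun p => F (fst p) (fst (snd p)) (snd (snd p))) ->
  comp f -> comp g -> comp h -> comp (fun a => F (f a) (g a) (h a)).
Proof.
  intros HF Hf Hg Hh; exact (comp_comp _ (fun a => (f a, (g a, h a))) HF
    (comp_pair f _ Hf (comp_pair g h Hg Hh))).
Qed.

Lemma comp4 (F : B -> C -> D -> E' -> F') (f : A -> B) (g : A -> C) (h : A -> D) (k : A -> E') :
  comp (fun p => F (fst p) (fst (snd p)) (fst (snd (snd p))) (snd (snd (snd p)))) ->
  comp f -> comp g -> comp h -> comp k -> comp (fun a => F (f a) (g a) (h a) (k a)).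
Proof.
  intros HF Hf Hg Hh Hk; exact (comp_comp _ (fun a => (f a, (g a, (h a, k a)))) HF
    (comp_pair f _ Hf (comp_pair g _ Hg (comp_pair h k Hh Hk)))).
Qed.

End Arguments.

Create HintDb comp.

Ltac comp_list := fail.

Ltac comp_lib ::= first
  [ lazymatch goal with
    | |- comp (fun x => ?F (@?f x) (@?g x) (@?h x) (@?k x)) =>
        apply (comp4 F f g h k); [solve [auto 1 with comp nocore]| | | |]
    end
  | lazymatch goal with
    | |- comp (fun x => ?F (@?f x) (@?g x) (@?h x)) =>
        apply (comp3 F f g h); [solve [auto 1 with comp nocore]| | |]
    end
  | lazymatch goal with
    | |- comp (fun x => ?F (@?f x) (@?g x)) =>
        apply (comp2 F f g); [solve [auto 1 with comp nocore]| |]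
    end
  | lazymatch goal with
    | |- comp (fun x => ?F (@?f x)) =>
        apply (comp_comp F f); [solve [auto 1 with comp nocore]|]
    end
  | solve [auto 1 with comp nocore]
  | apply comp_fold_left | comp_list ].

Lemma comp_add : comp (fun p : nat * nat => fst p + snd p).
Proof.
  apply comp_ext with (f := fun p : nat * nat => Nat.iter (fst p) S (snd p)); [|comp].
  intros [n m]; simpl; induction n; simpl; auto.
Qed.
#[export] Hint Resolve comp_add : comp.

Lemma comp_mul : comp (fun p : nat * nat => fst p * snd p).
Proof.
  apply comp_ext with (f := fun p : nat * nat => Nat.iter (fst p) (Nat.add (snd p)) 0); [|comp].
  intros [n m]; simpl; induction n; simpl; auto.
Qed.
#[export] Hint Resolve comp_mul : comp.

Lemma comp_pow : comp (fun p : nat * nat => fst p ^ snd p).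
Proof.
  apply comp_ext with (f := fun p : nat * nat => Nat.iter (snd p) (Nat.mul (fst p)) 1); [|comp].
  intros [n m]; simpl; induction m; simpl; auto.
Qed.
#[export] Hint Resolve comp_pow : comp.

Lemma comp_sub : comp (fun p : nat * nat => fst p - snd p).
Proof.
  apply comp_ext with (f := fun p : nat * nat => Nat.iter (snd p) pred (fst p)); [|comp].
  intros [n m]; simpl; induction m as [|m IH]; simpl; [lia|rewrite IH; lia].
Qed.
#[export] Hint Resolve comp_sub : comp.

Lemma comp_leb : comp (fun p : nat * nat => fst p <=? snd p).
Proof.
  apply comp_ext with (f := fun p : nat * nat => match fst p - snd p with 0 => true | S _ => false end);
    [|comp].
  intros [n m]; simpl; destruct (Nat.leb_spec n m), (n - m) eqn:E; auto; lia.
Qed.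
#[export] Hint Resolve comp_leb : comp.

Lemma comp_andb : comp (fun p : bool * bool => fst p && snd p).
Proof. apply comp_ext with (f := fun p : bool * bool => if fst p then snd p else false); [easy|comp]. Qed.

Lemma comp_orb : comp (fun p : bool * bool => fst p || snd p).
Proof. apply comp_ext with (f := fun p : bool * bool => if fst p then true else snd p); [easy|comp]. Qed.

Lemma comp_negb : comp negb.
Proof. apply comp_ext with (f := fun b : bool => if b then false else true); [easy|comp]. Qed.
#[export] Hint Resolve comp_andb comp_orb comp_negb : comp.

Lemma comp_eqb : comp (fun p : nat * nat => fst p =? snd p).
Proof.
  apply comp_ext with (f := fun p : nat * nat => (fst p <=? snd p) && (snd p <=? fst p)); [|comp].
  intros [n m]; simpl; destruct (Nat.leb_spec n m), (Nat.leb_spec m n), (Nat.eqb_spec n m);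
    auto; lia.
Qed.
#[export] Hint Resolve comp_eqb : comp.

Lemma comp_ltb : comp (fun p : nat * nat => fst p <? snd p).
Proof. unfold Nat.ltb; comp. Qed.
#[export] Hint Resolve comp_ltb : comp.

Lemma comp_of_nat : comp of_nat.
Proof.
  exists (fun n => n); split; [apply prog_id|]; intros n.
  exact (eq_trans (f_equal to_nat (eq_sym (surjective_pairing _))) (cancel_to_of n)).
Qed.

Lemma comp_cpair : comp (fun p : nat * nat => cpair (fst p) (snd p)).
Proof. exists (fun n => n); split; [apply prog_id|easy]. Qed.
#[export] Hint Resolve comp_of_nat comp_cpair : comp.

Section ListLib.

Context {A B C : Type} `{Enc A} `{Enc B} `{Enc C}.

Lemma comp_rev : comp (@rev A).
Proof.
  apply comp_ext with (f := fun l => fold_left (fun acc x => x :: acc) l []); [|comp].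
  intros l; rewrite <- fold_left_rev_right; induction (rev l); simpl; congruence.
Qed.

Lemma comp_app : comp (fun p => @app A (fst p) (snd p)).
Proof.
  apply comp_ext with (f := fun p => fold_left (fun acc x => x :: acc) (rev (fst p)) (snd p)).
  - intros [l m]; simpl; rewrite <- fold_left_rev_right, rev_involutive.
    induction l; simpl; congruence.
  - apply comp_fold_left; [comp|apply comp_comp; [apply comp_rev|comp]|comp].
Qed.

Lemma comp_length : comp (@length A).
Proof.
  apply comp_ext with (f := fun l => fold_left (fun n _ => S n) l 0); [|comp].
  assert (E : forall (l : list A) n, fold_left (fun n _ => S n) l n = n + length l).
  { intros l; induction l as [|x l IH]; intros n; simpl; [lia|rewrite IH; lia]. }
  intros l; apply E.
Qed.

Lemma comp_nth (k : A -> nat) (l : A -> list B) (d : A -> B) :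
  comp k -> comp l -> comp d -> comp (fun a => nth (k a) (l a) (d a)).
Proof.
  intros Hk Hl Hd.
  apply comp_ext with (f := fun a =>
    match Nat.iter (k a) (fun m => match m with [] => [] | _ :: t => t end) (l a) with
    | [] => d a | x :: _ => x end); [|comp].
  intros a; generalize (l a) as m; induction (k a) as [|n IH]; intros [|x t];
    simpl nth; try (rewrite Nat.iter_succ_r, IH; now destruct n); easy.
Qed.

Lemma comp_fold_right (F : A -> C -> B -> B) (l : A -> list C) (x : A -> B) :
  comp (fun p => F (fst p) (snd (snd p)) (fst (snd p))) -> comp l -> comp x ->
  comp (fun a => fold_right (F a) (x a) (l a)).
Proof.
  intros HF Hl Hx.
  apply comp_ext with (f := fun a => fold_left (fun b y => F a y b) (rev (l a)) (x a)).
  - intros a; now rewrite <- fold_left_rev_right, rev_involutive.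
  - apply comp_fold_left; auto.
    apply (comp_comp (@rev C) l); auto.
    apply comp_ext with (f := fun l => fold_left (fun acc x => x :: acc) l []); [|comp].
    intros m; rewrite <- fold_left_rev_right; induction (rev m); simpl; congruence.
Qed.

End ListLib.

#[export] Hint Resolve comp_rev comp_app comp_length : comp.

Ltac comp_list ::= first [ apply comp_nth | apply comp_fold_right ].

Section Map.

Context {A B C : Type} `{Enc A} `{Enc B} `{Enc C}.

Lemma comp_map (F : A -> B -> C) (l : A -> list B) :
  comp (fun p => F (fst p) (snd p)) -> comp l -> comp (fun a => map (F a) (l a)).
Proof.
  intros HF Hl.
  apply comp_ext with (f := fun a => fold_right (fun x m => F a x :: m) [] (l a)).
  - intros a; induction (l a); simpl; congruence.
  - apply (comp_fold_right (fun a x m => F a x :: m)); comp.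
Qed.

Lemma comp_combine (l : A -> list B) (m : A -> list C) :
  comp l -> comp m -> comp (fun a => combine (l a) (m a)).
Proof.
  intros Hl Hm.
  set (F := fun (p : list C * list (B * C)) (x : B) =>
    match fst p with [] => p | y :: t => (t, (x, y) :: snd p) end).
  apply comp_ext with (f := fun a => rev (snd (fold_left F (l a) (m a, [])))).
  - intros a; generalize (m a) as u; revert F; generalize (l a) as t.
    assert (E : forall t u acc, exists u', fold_left (fun (p : list C * list (B * C)) (x : B) =>
      match fst p with [] => p | y :: t => (t, (x, y) :: snd p) end) t (u, acc) =
      (u', rev (combine t u) ++ acc)).
    { intros t; induction t as [|x t IH]; intros u acc; simpl; [now exists u|].
      destruct u as [|y u]; simpl.
      - destruct (IH [] acc) as [u' ->]; exists u'; now destruct t.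
      - destruct (IH u ((x, y) :: acc)) as [u' ->]; exists u'; now rewrite <- app_assoc. }
    intros t F u; destruct (E t u []) as [u' E']; unfold F; rewrite E'; simpl.
    now rewrite app_nil_r, rev_involutive.
  - unfold F; comp.
Qed.

Lemma comp_seq : comp (fun p : nat * nat => seq (fst p) (snd p)).
Proof.
  apply comp_ext with (f := fun p : nat * nat =>
    Nat.iter (snd p) (fun l => l ++ [fst p + length l]) []); [|comp].
  intros [s n]; simpl; induction n as [|n IH]; [easy|].
  rewrite seq_S; simpl; now rewrite IH, length_seq.
Qed.

Lemma comp_repeat : comp (fun p : A * nat => repeat (fst p) (snd p)).
Proof.
  apply comp_ext with (f := fun p : A * nat => Nat.iter (snd p) (fun l => fst p :: l) []);
    [|comp].
  intros [x n]; simpl; induction n; simpl; congruence.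
Qed.

Lemma comp_flat_map (F : A -> B -> list C) (l : A -> list B) :
  comp (fun p => F (fst p) (snd p)) -> comp l -> comp (fun a => flat_map (F a) (l a)).
Proof.
  intros HF Hl.
  apply comp_ext with (f := fun a => fold_right (fun x m => F a x ++ m) [] (l a)).
  - intros a; induction (l a); simpl; congruence.
  - apply (comp_fold_right (fun a x m => F a x ++ m)); comp.
Qed.

Lemma comp_existsb (F : A -> B -> bool) (l : A -> list B) :
  comp (fun p => F (fst p) (snd p)) -> comp l -> comp (fun a => existsb (F a) (l a)).
Proof.
  intros HF Hl.
  apply comp_ext with (f := fun a => fold_right (fun x b => F a x || b) false (l a)).
  - intros a; induction (l a); simpl; congruence.
  - apply (comp_fold_right (fun a x b => F a x || b)); comp.
Qed.

Lemma comp_forallb (F : A -> B -> bool) (l : A -> list B) :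
  comp (fun p => F (fst p) (snd p)) -> comp l -> comp (fun a => forallb (F a) (l a)).
Proof.
  intros HF Hl.
  apply comp_ext with (f := fun a => fold_right (fun x b => F a x && b) true (l a)).
  - intros a; induction (l a); simpl; congruence.
  - apply (comp_fold_right (fun a x b => F a x && b)); comp.
Qed.

Lemma comp_find (F : A -> B -> bool) (l : A -> list B) :
  comp (fun p => F (fst p) (snd p)) -> comp l -> comp (fun a => find (F a) (l a)).
Proof.
  intros HF Hl.
  apply comp_ext with
    (f := fun a => fold_right (fun x o => if F a x then Some x else o) None (l a)).
  - intros a; induction (l a) as [|x t IH]; simpl; [easy|]; now rewrite IH.
  - apply (comp_fold_right (fun a x o => if F a x then Some x else o)); comp.
Qed.

End Map.

#[export] Hint Resolve comp_seq comp_repeat : comp.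

Ltac comp_list ::= first
  [ apply comp_nth | apply comp_fold_right | apply comp_map | apply comp_combine | apply comp_flat_map
  | apply comp_existsb | apply comp_forallb | apply comp_find ].

(** * Transducers *)

(** Action 4 means halting and leaves the tape alone. With [back] false action 3 is idle too, which
    keeps the machine one-way. *)
Definition out_step (back : bool) (a : nat) (o : tape) : tape :=
  match a with
  | 1 => act (Action (scanned o) stroke Right) o
  | 2 => act (Action (scanned o) separator Right) o
  | 3 => if back then act (Action (scanned o) (scanned o) Left) o else o
  | _ => o
  end.

(** Register 0 controls the main loop and register 3 holds the coded state; registers 1 and 2
    receive the letter, and those from 4 on are scratch, all zero between rounds. *)
Definition driver_regs (go s : nat) : regs := upd (upd (fun _ => 0) 0 go) 3 s.

Definition runs_at (b : nat) (c : cmd) (f : nat -> nat) : Prop :=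
  forward c /\ forall g, (forall r, b < r -> g r = 0) -> pexec c g (upd g b (f (g b))).

Definition emit (c x : cmd) : cmd :=
  Seq (copy_reg 3 4 5) (Seq c (While 4 (Seq (Dec 4) x))).

Lemma exec_emit u (P : tape -> Prop) c x f n o o' go go' s :
  runs_at 4 c f -> P o -> P o' ->
  (f s = 0 /\ o' = o /\ go' = go \/
   f s = 1 /\ exec u P x (PState n o (driver_regs go s)) (PState n o' (driver_regs go' s))) ->
  exec u P (emit c x) (PState n o (driver_regs go s)) (PState n o' (driver_regs go' s)).
Proof.
  intros [_ H] Po Po' C.
  set (g1 := upd (driver_regs go s) 4 (f s)).
  assert (E : exec u P (copy_reg 3 4 5) (PState n o (driver_regs go s))
    (PState n o (upd (driver_regs go s) 4 s))).
  { apply (pexec_copy 3 4 5); auto; unfold driver_regs; regs_eq. }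
  assert (E' : exec u P c (PState n o (upd (driver_regs go s) 4 s)) (PState n o g1)).
  { eapply pexec_eq; [apply H; intros; unfold driver_regs; regs_at|
      unfold g1, driver_regs; regs_eq|auto]. }
  eapply exec_seq; [exact E|]; eapply exec_seq; [exact E'|].
  destruct C as [[Z [-> ->]]|[Z X]]; unfold g1; rewrite Z.
  - replace (upd (driver_regs go s) 4 0) with (driver_regs go s)
      by (unfold driver_regs; regs_eq); now constructor.
  - apply exec_loop with (s' := PState n o' (driver_regs go' s)); auto.
    + eapply exec_seq; [|exact X].
      apply (pexec_dec 4 _ (driver_regs go s)); auto; unfold driver_regs; regs_eq.
    + now apply exec_exit.
Qed.

(** [c0] pairs the state with 0 and [c1] raises the second component, once for a stroke and twice
    for a separator; [c2] then applies the transition to the pair of state and letter. The tests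
    [f1] to [f4] recognise the actions 1 to 4. *)
Definition driver_body (back : bool) (c0 c1 c2 f1 f2 f3 f4 : cmd) : cmd :=
  Seq (Read 1 2) (Seq c0 (Seq (While 1 (Seq (Dec 1) c1))
    (Seq (While 2 (Seq (Dec 2) (Seq c1 c1))) (Seq c2
    (Seq (emit f1 (Print stroke)) (Seq (emit f2 (Print separator))
    (Seq (emit f3 (if back then Retreat else Skip)) (emit f4 (Dec 0))))))))).

Definition letter_up (z : nat) : nat := cpair (fst (of_nat z)) (S (snd (of_nat z))).

Lemma exec_driver_body back c0 c1 c2 f1 f2 f3 f4 next action u (P : tape -> Prop) n o s :
  runs_at 3 c0 (fun s => cpair s 0) -> runs_at 3 c1 letter_up ->
  runs_at 3 c2 next ->
  (forall i f, In (i, f) [(1, f1); (2, f2); (3, f3); (4, f4)] ->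
    exists h, runs_at 4 f h /\ h (next (cpair s (u n))) =
                               if action (next (cpair s (u n))) =? i then 1 else 0) ->
  u n <= 2 ->
  let s' := next (cpair s (u n)) in
  let o' := out_step back (action s') o in
  P o -> P o' ->
  exec u P (driver_body back c0 c1 c2 f1 f2 f3 f4) (PState n o (driver_regs 1 s))
    (PState (S n) o' (driver_regs (if action s' =? 4 then 0 else 1) s')).
Proof.
  intros H0 H1 H2 HF Hu s' o' Po Po'.
  set (fl := fun i => if u n =? i then 1 else 0).
  set (g := fun a b z => upd (upd (driver_regs 1 z) 1 a) 2 b).
  assert (C : forall c f a b z, runs_at 3 c f ->
    pexec c (g a b z) (g a b (f z))).
  { intros c f a b z [_ H]; eapply pexec_eq; [apply H; intros; unfold g, driver_regs; regs_at|].
    unfold g, driver_regs; regs_eq. }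
  assert (D1 : forall a b z, pexec (Dec 1) (g (S a) b z) (g a b z))
    by (intros; apply pexec_dec; unfold g, driver_regs; regs_eq).
  assert (D2 : forall a b z, pexec (Dec 2) (g a (S b) z) (g a b z))
    by (intros; apply pexec_dec; unfold g, driver_regs; regs_eq).
  assert (G0 : forall z, g 0 0 z = driver_regs 1 z)
    by (intros; unfold g, driver_regs; regs_eq).
  assert (L : forall z b, letter_up (cpair z b) = cpair z (S b))
    by (intros; unfold letter_up; now rewrite fst_cpair, snd_cpair).
  eapply exec_seq.
  { apply (exec_read u P 1 2 (PState n o (driver_regs 1 s))); auto. }
  simpl head; simpl out; simpl reg.
  replace (fun k => driver_regs 1 s k + _) with (g (fl 1) (fl 2) s).
  2: { unfold g, driver_regs, fl; extensionality k; unfold upd.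
       destruct (Nat.eqb_spec k 2), (Nat.eqb_spec k 1), (Nat.eqb_spec k 3),
         (Nat.eqb_spec k 0); subst; cbn; destruct (u n =? 1), (u n =? 2); cbn; lia. }
  eapply exec_seq; [now apply (C _ _ _ _ s H0)|]; cbv beta.
  apply exec_seq with (s' := PState (S n) o (g 0 (fl 2) (cpair s (fl 1)))).
  { assert (F : fl 1 = 0 \/ fl 1 = 1) by (unfold fl; destruct (u n =? 1); auto).
    destruct F as [-> | ->].
    - now apply pexec_never.
    - apply pexec_once; [discriminate|reflexivity| |auto].
      eapply pexec_seq; [apply D1|]; rewrite <- L; now apply C. }
  apply exec_seq with (s' := PState (S n) o (g 0 0 (cpair s (u n)))).
  { assert (F : fl 1 = 0 /\ fl 2 = 1 /\ u n = 2 \/ fl 2 = 0 /\ u n = fl 1)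
      by (unfold fl; destruct (u n) as [|[|[|]]]; simpl; auto; lia).
    destruct F as [[-> [-> ->]]|[-> ->]].
    - apply pexec_once; [discriminate|reflexivity| |auto].
      eapply pexec_seq; [apply D2|]; eapply pexec_seq; [apply (C c1 letter_up 0 0 _ H1)|].
      rewrite L, <- (L s 1); now apply C.
    - now apply pexec_never. }
  eapply exec_seq; [now apply (C _ _ _ _ _ H2)|]; fold s'; rewrite G0.
  (* At most one emission acts, so every intermediate tape is already [o] or [o']; [o1] and [o2] are
     the tapes after the first and the second emission. *)
  set (o1 := if action s' =? 1 then o' else o).
  set (o2 := if action s' <=? 2 then o' else o).
  assert (O4 : 4 <= action s' -> o' = o).
  { unfold o'; intros L'; destruct (action s') as [|[|[|[|]]]]; try lia; easy. }
  destruct (HF 1 f1) as [h1 [F1 E1]]; [simpl; auto|].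
  destruct (HF 2 f2) as [h2 [F2 E2]]; [simpl; auto|].
  destruct (HF 3 f3) as [h3 [F3 E3]]; [simpl; auto|].
  destruct (HF 4 f4) as [h4 [F4 E4]]; [simpl; auto 6|].
  fold s' in E1, E2, E3, E4.
  assert (Po1 : P o1) by (unfold o1; now destruct (_ =? _)).
  assert (Po2 : P o2) by (unfold o2; now destruct (_ <=? _)).
  apply exec_seq with (s' := PState (S n) o1 (driver_regs 1 s')).
  { apply (exec_emit u P f1 _ h1); auto; rewrite E1; unfold o1.
    destruct (Nat.eqb_spec (action s') 1) as [A|A]; [right; split; auto|left; auto].
    unfold o'; rewrite A; simpl; now apply (exec_print u P stroke (PState (S n) o _)). }
  apply exec_seq with (s' := PState (S n) o2 (driver_regs 1 s')).
  { apply (exec_emit u P f2 _ h2); auto; rewrite E2; unfold o1, o2.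
    destruct (Nat.eqb_spec (action s') 2) as [A|A]; [right; split; auto|left].
    - rewrite A; unfold o'; rewrite A; simpl.
      now apply (exec_print u P separator (PState (S n) o _)).
    - split; auto; split; auto.
      destruct (action s') as [|[|[|]]]; simpl; auto; lia. }
  apply exec_seq with (s' := PState (S n) o' (driver_regs 1 s')).
  { apply (exec_emit u P f3 _ h3); auto; rewrite E3; unfold o2.
    destruct (Nat.eqb_spec (action s') 3) as [A|A]; [right; split; auto|left].
    - rewrite A; unfold o'; rewrite A; simpl; destruct back; [|constructor].
      now apply (exec_retreat u P (PState (S n) o _)).
    - split; auto; split; auto.
      destruct (Nat.leb_spec (action s') 2); auto; apply O4; lia. }
  apply (exec_emit u P f4 _ h4); auto; rewrite E4.
  destruct (Nat.eqb_spec (action s') 4) as [A|A]; [right; split; auto|left; auto].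
  apply pexec_dec; auto; unfold driver_regs; regs_eq.
Qed.

Lemma out_step_le back a o : (forall k, cells o k <= 2) ->
  forall k, cells (out_step back a o) k <= 2.
Proof.
  intros H k; destruct a as [|[|[|[|a]]]]; simpl; auto.
  3: destruct back; auto; simpl.
  all: destruct (k =? pos o); unfold stroke, separator, scanned; auto.
Qed.

(** * Complete machines: start, main loop and exit *)

Lemma steps_run M P u t c : steps M P (run M u t) c ->
  exists t', t <= t' /\ run M u t' = c /\
    forall i, t <= i < t' -> P (output (run M u i)).
Proof.
  intros H; remember (run M u t) as c0 eqn:E; revert t E.
  induction H as [c|c c' c'' H1 H2 H3 IH]; intros t E.
  - exists t; repeat split; auto; lia.
  - destruct (IH (S t)) as [t' [L [R Q]]]; [simpl; now rewrite <- E, H2|].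
    exists t'; split; [lia|]; split; auto; intros i [L1 L2].
    destruct (Nat.eq_dec i t) as [->|]; [now rewrite <- E|apply Q; lia].
Qed.

Lemma halted_table w T c : ~ In (state c) (map fst T) ->
  halted (Machine w (table_rules w T)) c.
Proof.
  intros H; unfold halted, step; simpl.
  destruct (find _ _) as [r|] eqn:E; auto; exfalso; apply H.
  apply find_some in E as [E1 E2]; apply in_flat_map in E1 as [[q i] [Hq Hr]].
  apply in_map_iff in Hr as [[a [o ws]] [<- _]]; unfold applies in E2; simpl in E2.
  apply Bool.andb_true_iff in E2 as [E2 _]; apply Bool.andb_true_iff in E2 as [E2 _].
  apply Bool.andb_true_iff in E2 as [E2 _]; apply Nat.eqb_eq in E2; subst.
  now apply (in_map fst) in Hq.
Qed.

Lemma halted_stays M u t t' : t <= t' -> halted M (run M u t) -> run M u t' = run M u t.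
Proof.
  intros L H; induction L as [|t' L IH]; auto; simpl; rewrite IH; now rewrite H.
Qed.

(* The states from [N + e] down to [N] load [e] into register 3. *)
Definition start_table (N e : nat) : table :=
  (0, IInit (N + e)) :: map (fun j => (N + S j, IMove 3 Right (N + j))) (seq 0 e).

Definition driver_main (body : cmd) : cmd := Seq (Inc 0) (While 0 body).

(** The main loop occupies the states 1 to 3 + [size body]. State 4 + [size body] is its exit and
    has no instruction, so reaching it halts the machine; the loading states begin at the next
    number. *)
Definition driver_table (body : cmd) (e : nat) : table :=
  let N := 5 + size body in
  start_table N e ++ (N, IJump 1) :: compile 1 (driver_main body).

Definition driver (w : nat) (body : cmd) (e : nat) : machine :=
  Machine w (table_rules w (driver_table body e)).

Lemma driver_sources body e : map fst (driver_table body e) =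
  0 :: map (fun j => 5 + size body + S j) (seq 0 e) ++
  (5 + size body) :: seq 1 (3 + size body).
Proof.
  unfold driver_table, start_table; simpl map.
  rewrite map_app, map_map; simpl; do 6 f_equal.
  rewrite map_app, compile_sources; exact (eq_sym (seq_S (size body) 3)).
Qed.

Lemma driver_nodup body e : NoDup (map fst (driver_table body e)).
Proof.
  rewrite driver_sources; constructor.
  - intros H; apply in_app_iff in H as [H|[H|H]]; [|lia|].
    + apply in_map_iff in H as [j [H _]]; lia.
    + apply in_seq in H; lia.
  - apply NoDup_app.
    + apply NoDup_map_NoDup_ForallPairs; [intros i j _ _; lia|apply seq_NoDup].
    + constructor; [|apply seq_NoDup]; rewrite in_seq; lia.
    + intros x H [H'|H']; apply in_map_iff in H as [j [H _]]; [lia|].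
      apply in_seq in H'; lia.
Qed.

Lemma driver_exit body e : ~ In (4 + size body) (map fst (driver_table body e)).
Proof.
  rewrite driver_sources; intros [H|H]; [lia|].
  apply in_app_iff in H as [H|[H|H]]; [|lia|].
  - apply in_map_iff in H as [j [H _]]; lia.
  - apply in_seq in H; lia.
Qed.

Lemma driver_start w body e u : 3 < w -> (forall k, u k <= 2) ->
  exists t, run (driver w body e) u t = conf w u 2 (PState 0 blank_tape (driver_regs 1 e)) /\
    forall i, i < t -> output (run (driver w body e) u i) = blank_tape.
Proof.
  intros Hw Hu; set (T := driver_table body e); set (N := 5 + size body).
  set (P := fun o => o = blank_tape).
  assert (HP : forall o, P o -> forall k, cells o k <= 2) by (intros o -> k; simpl; unfold blank; lia).
  assert (A1 : steps (driver w body e) P (initial (driver w body e) u)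
    (conf w u (N + e) (PState 0 blank_tape (fun _ => 0)))).
  { apply steps_one; [reflexivity|].
    unfold driver; rewrite step_table with (i := IInit (N + e)); simpl; auto.
    - f_equal; unfold conf, apply_rule; simpl; f_equal; [apply act_stay|].
      unfold counters.
      replace (repeat blank_tape w) with (map (fun _ => blank_tape) (seq 0 w)).
      + rewrite map_map; simpl; rewrite combine_map_map, map_map; apply map_ext_in.
        intros r Hr; apply in_seq in Hr; unfold act, mark; reflexivity.
      + clear; generalize 0; induction w as [|w IH]; intros n; simpl; f_equal; auto.
    - apply driver_nodup.
    - now rewrite repeat_length.
    - intros t Ht; apply repeat_spec in Ht as ->; unfold scanned; simpl; auto. }
  assert (ND := driver_nodup body e); fold T in ND.
  assert (X : forall q i s, In (q, i) T -> P (out s) -> (forall q', i <> IInit q') ->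
    forall s', Config (goto i (map scanned (counters w (reg s))))
      (Tape (shift_pos (in_shift i) (head s)) u)
      (act (out_action i (scanned (out s))) (out s))
      (counters w (fun r => shift_pos (work_shift i (u (head s)) r) (reg s r))) = s' ->
    steps (driver w body e) P (conf w u q s) s').
  { intros q i s HI Ht HN s' <-; apply steps_one; auto.
    apply step_conf; auto; now apply HP. }
  assert (A2 : forall j, j <= e -> steps (driver w body e) P
    (conf w u (N + e) (PState 0 blank_tape (fun _ => 0)))
    (conf w u (N + (e - j)) (PState 0 blank_tape (upd (fun _ => 0) 3 j)))).
  { intros j; induction j as [|j IH]; intros L.
    - rewrite Nat.sub_0_r; replace (upd (fun _ => 0) 3 0) with (fun _ : nat => 0)
        by regs_eq; constructor.
    - eapply steps_trans; [apply IH; lia|].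
      apply X with (i := IMove 3 Right (N + (e - S j))); [|easy|easy|].
      + unfold T, driver_table, start_table; apply in_app_iff; left; right.
        apply in_map_iff; exists (e - S j); split; [|apply in_seq; lia].
        fold N; f_equal; lia.
      + unfold conf; simpl; apply config_eq; auto; [apply act_stay|].
        f_equal; extensionality k; unfold upd; destruct (k =? 3); simpl; auto. }
  specialize (A2 e (le_n e)); rewrite Nat.sub_diag, Nat.add_0_r in A2.
  assert (A3 : steps (driver w body e) P
    (conf w u N (PState 0 blank_tape (upd (fun _ => 0) 3 e)))
    (conf w u 1 (PState 0 blank_tape (upd (fun _ => 0) 3 e)))).
  { apply X with (i := IJump 1); [|easy|easy|].
    - unfold T, driver_table; apply in_app_iff; right; now left.
    - unfold conf; simpl; apply config_eq; auto; apply act_stay. }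
  assert (A4 : steps (driver w body e) P
    (conf w u 1 (PState 0 blank_tape (upd (fun _ => 0) 3 e)))
    (conf w u 2 (PState 0 blank_tape (driver_regs 1 e)))).
  { apply X with (i := IMove 0 Right 2); [|easy|easy|].
    - unfold T, driver_table; apply in_app_iff; right; right; now left.
    - unfold conf; simpl; apply config_eq; auto; [apply act_stay|].
      f_equal; extensionality k; unfold driver_regs, upd.
      destruct (Nat.eqb_spec k 0), (Nat.eqb_spec k 3); subst; auto; easy. }
  assert (A : steps (driver w body e) P (run (driver w body e) u 0)
    (conf w u 2 (PState 0 blank_tape (driver_regs 1 e))))
    by (simpl run; repeat (eapply steps_trans; [eassumption|]); constructor).
  apply steps_run in A as [t [_ [R Q]]].
  exists t; split; auto; intros i L; apply Q; lia.
Qed.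

Lemma driver_loop w body e u t n n' o o' s s' go :
  wide w body -> 3 < w -> (forall k, u k <= 2) ->
  (forall k, cells o k <= 2) -> (forall k, cells o' k <= 2) ->
  exec u (fun x => x = o \/ x = o') body (PState n o (driver_regs 1 s))
    (PState n' o' (driver_regs go s')) ->
  run (driver w body e) u t = conf w u 2 (PState n o (driver_regs 1 s)) ->
  step (driver w body e) (run (driver w body e) u t) <> None /\
  exists t', t < t' /\
    run (driver w body e) u t' = conf w u 2 (PState n' o' (driver_regs go s')) /\
    (forall i, t <= i <= t' -> output (run (driver w body e) u i) = o \/
                               output (run (driver w body e) u i) = o').
Proof.
  intros Hw H3 Hu Ho Ho' E R; set (T := driver_table body e).
  assert (HI : incl (compile 2 (While 0 body)) T)
    by (intros x Hx; apply in_app_iff; right; right; now right).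
  set (P := fun x => x = o \/ x = o').
  assert (HP : forall x, P x -> forall k, cells x k <= 2) by (intros x [->| ->]; auto).
  assert (B : step (driver w body e) (run (driver w body e) u t) =
              Some (conf w u 3 (PState n o (driver_regs 1 s)))).
  { rewrite R; unfold driver; rewrite step_conf with (i := ITest 0 (4 + size body) 3); auto.
    - f_equal; unfold conf; simpl; rewrite nth_counters by lia; simpl.
      apply config_eq; auto; apply act_stay.
    - apply driver_nodup.
    - apply HI; now left.
    - easy. }
  split; [now rewrite B|].
  assert (A1 : steps (driver w body e) P (run (driver w body e) u (S t))
    (conf w u (3 + size body) (PState n' o' (driver_regs go s')))).
  { simpl run; rewrite B; apply (compile_steps w u T); auto.
    - apply driver_nodup.
    - intros x Hx; apply HI; simpl; right; apply in_app_iff; now left. }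
  assert (A2 : steps (driver w body e) P
    (conf w u (3 + size body) (PState n' o' (driver_regs go s')))
    (conf w u 2 (PState n' o' (driver_regs go s')))).
  { apply steps_one; [now right|].
    unfold driver; rewrite step_conf with (i := IJump 2); auto.
    - f_equal; apply config_eq; auto; apply act_stay.
    - apply driver_nodup.
    - apply HI; simpl; right; apply in_app_iff; right; now left.
    - easy. }
  destruct (steps_run _ _ _ _ _ (steps_trans _ _ _ _ _ A1 A2)) as [t' [L [R' Q]]].
  exists t'; split; [lia|]; split; auto.
  intros i [L1 L2]; destruct (Nat.eq_dec i t) as [->|N1]; [rewrite R; now left|].
  destruct (Nat.eq_dec i t') as [->|N2]; [rewrite R'; now right|apply Q; lia].
Qed.

Lemma driver_halts w body e u t n o s : 3 < w -> (forall k, u k <= 2) ->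
  (forall k, cells o k <= 2) ->
  run (driver w body e) u t = conf w u 2 (PState n o (driver_regs 0 s)) ->
  halted (driver w body e) (run (driver w body e) u (1 + t)).
Proof.
  intros H3 Hu Ho R; simpl run; rewrite R.
  unfold driver at 2; rewrite step_conf with (i := ITest 0 (4 + size body) 3); auto.
  - apply halted_table; simpl goto; rewrite nth_counters by lia; apply driver_exit.
  - apply driver_nodup.
  - apply in_app_iff; right; right; right; now left.
  - easy.
Qed.

Lemma forward_compile c a q q' : forward c -> ~ In (q, IRetreat q') (compile a c).
Proof.
  revert a; induction c as [| | |c1 IH1 c2 IH2|r c IH| | |]; intros b F H; simpl in *;
    try (destruct H as [H|H]; easy); auto.
  - apply in_app_iff in H as [H|H]; [eapply IH1|eapply IH2]; try apply F; eassumption.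
  - destruct H as [H|H]; [easy|]; apply in_app_iff in H as [H|[H|[]]]; [|easy].
    eapply IH; eassumption.
Qed.

Lemma driver_one_way w body e : forward body -> one_way (driver w body e).
Proof.
  intros F r Hr; apply in_flat_map in Hr as [[q i] [Hq Hr]].
  apply in_map_iff in Hr as [[a [o ws]] [<- _]]; simpl.
  destruct i as [| | | | | |q']; simpl; auto.
  unfold driver_table in Hq; apply in_app_iff in Hq as [[Hq|Hq]|[Hq|Hq]]; try easy.
  - apply in_map_iff in Hq as [j [Hq _]]; discriminate.
  - now apply (forward_compile (driver_main body)) in Hq.
Qed.

Lemma code_list_enc (l : list nat) : code_list l = enc l.
Proof. unfold enc, enc_list; unfold enc, enc_nat; now rewrite map_id. Qed.

(** The part of a rule's code after source and target; for the loading instructions it is the same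
    for all [e]. *)
Definition rule_tail (w : nat) (i : instr) (c : nat * (nat * list nat)) : list nat :=
  let '(a, (o, ws)) := c in
  [a; code_move (in_shift i); code_action (out_action i o);
   code_list (map code_action
     (map (fun r => Action (nth r ws 0) (work_print i (nth r ws 0))
                           (work_shift i a r)) (seq 0 w)))].

Lemma table_rules_app w T T' :
  table_rules w (T ++ T') = table_rules w T ++ table_rules w T'.
Proof. apply flat_map_app. Qed.

Lemma code_rules w (T : table) f : (forall q i ws, In (q, i) T -> goto i ws = f i) ->
  map code_rule (table_rules w T) =
  flat_map (fun p => map (fun tl => code_list (fst p :: f (snd p) :: tl))
                         (map (rule_tail w (snd p)) (contexts w))) T.
Proof.
  intros G; unfold table_rules; induction T as [|[q i] T IH]; simpl; auto.
  rewrite map_app, IH by (intros; eapply G; right; eassumption); f_equal.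
  rewrite !map_map; apply map_ext; intros [a [o ws]]; simpl.
  unfold code_rule; simpl; rewrite (G q i ws) by (now left); reflexivity.
Qed.

(** An s-m-n theorem for this family of machines: [e] enters only through the number of loading
    states and their names, and all remaining rules form the fixed list [K2]. *)
Lemma comp_driver_code w body : comp (fun e => code_machine (driver w body e)).
Proof.
  set (N := 5 + size body).
  set (K0 := map (rule_tail w (IInit 0)) (contexts w)).
  set (K1 := map (rule_tail w (IMove 3 Right 0)) (contexts w)).
  set (K2 := map code_rule (table_rules w ((N, IJump 1) :: compile 1 (driver_main body)))).
  apply comp_ext with (f := fun e => cpair w (enc (
    map (fun tl : list nat => enc (0 :: N + e :: tl)) K0 ++
    flat_map (fun j => map (fun tl => enc (N + S j :: N + j :: tl)) K1) (seq 0 e) ++ K2))).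
  - intros e; change (code_machine (driver w body e)) with (cpair w (code_list (map code_rule
      (table_rules w (start_table N e ++ (N, IJump 1) :: compile 1 (driver_main body)))))).
    rewrite code_list_enc; do 2 f_equal; rewrite table_rules_app, map_app; fold K2.
    rewrite code_rules with (f := fun i => goto i []).
    2: { intros q i ws [H|H]; [injection H as <- <-; easy|].
         apply in_map_iff in H as [j [H _]]; injection H as <- <-; easy. }
    unfold start_table; simpl flat_map; rewrite <- app_assoc; f_equal.
    + apply map_ext; intros tl; now rewrite code_list_enc.
    + f_equal; induction (seq 0 e) as [|j l IH]; simpl; auto; rewrite IH; f_equal.
      apply map_ext; intros tl; now rewrite code_list_enc.
  - comp.
Qed.

Fixpoint tr_state {S : Type} (next : S -> nat -> S) (u : nat -> nat) (s : S) (n : nat) : S :=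
  match n with 0 => s | Datatypes.S n => next (tr_state next u s n) (u n) end.

Fixpoint tr_output {S : Type} (back : bool) (next : S -> nat -> S) (action : S -> nat)
    (u : nat -> nat) (s : S) (n : nat) : tape :=
  match n with
  | 0 => blank_tape
  | Datatypes.S n => out_step back (action (tr_state next u s (Datatypes.S n)))
                                   (tr_output back next action u s n)
  end.

(** Within a round the tape is always the one before or the one after it, hence the conclusion about
    some [m] beyond [n] for every late time. Actions are taken after reading a letter, hence the
    index [1 + n]. *)
Theorem transducer_machine {S : Type} `{Enc S} (back : bool)
    (next : S -> nat -> S) (action : S -> nat) :
  comp (fun p => next (fst p) (snd p)) -> comp action ->
  exists D : S -> machine,
    comp (fun s => code_machine (D s)) /\
    (back = false -> forall s, one_way (D s)) /\
    forall s u, (forall k, u k <= 2) ->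
      ((forall n, action (tr_state next u s (1 + n)) <> 4) ->
        (forall t, ~ halted (D s) (run (D s) u t)) /\
        forall n, exists t0, forall t, t0 <= t ->
          exists m, n <= m /\ output (run (D s) u t) = tr_output back next action u s m) /\
      ((exists n, action (tr_state next u s (1 + n)) = 4) ->
        exists t, halted (D s) (run (D s) u t)).
Proof.
  intros [next' [Pn En]] Ca.
  assert (Cf : forall i, comp (fun s => if action s =? i then 1 else 0)) by (intros; comp).
  destruct (prog_pair _ _ prog_id (prog_const 0) 3) as [c0 H0].
  assert (P1 : prog letter_up).
  { apply prog_pair; [apply prog_fst|apply (prog_comp _ _ prog_succ prog_snd)]. }
  destruct (P1 3) as [c1 H1], (Pn 3) as [c2 H2].
  destruct (Cf 1) as [h1 [Q1 E1]], (Q1 4) as [f1 F1].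
  destruct (Cf 2) as [h2 [Q2 E2]], (Q2 4) as [f2 F2].
  destruct (Cf 3) as [h3 [Q3 E3]], (Q3 4) as [f3 F3].
  destruct (Cf 4) as [h4 [Q4 E4]], (Q4 4) as [f4 F4].
  set (body := driver_body back c0 c1 c2 f1 f2 f3 f4).
  assert (W : exists w, 3 < w /\ wide w body).
  { destruct (wide_exists body) as [w Hw]; exists (4 + w); split; [lia|].
    apply wide_mono with w; auto; lia. }
  destruct W as [w [H3 Hw]].
  exists (fun s => driver w body (enc s)); split; [|split].
  { apply (comp_comp (fun e => code_machine (driver w body e)) (fun s : S => enc s));
      [apply comp_driver_code|apply comp_enc, comp_id]. }
  { intros -> s; apply driver_one_way; unfold body, driver_body, emit; simpl.
    unfold runs_at in *; intuition. }
  intros s u Hu.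
  set (st := tr_state next u s); set (ot := tr_output back next action u s).
  assert (Ho : forall n k, cells (ot n) k <= 2).
  { induction n as [|n IH]; [simpl; unfold blank; lia|]; now apply out_step_le. }
  assert (E : forall n, exec u (fun x => x = ot n \/ x = ot (1 + n)) body
    (PState n (ot n) (driver_regs 1 (enc (st n))))
    (PState (1 + n) (ot (1 + n))
      (driver_regs (if action (st (1 + n)) =? 4 then 0 else 1) (enc (st (1 + n)))))).
  { intros n.
    (* The action recovered from the four tests on codes. It can differ from [action] only above 4,
       where neither value has any effect. *)
    set (act' := fun z => if h1 z =? 1 then 1 else if h2 z =? 1 then 2 else
                 if h3 z =? 1 then 3 else if h4 z =? 1 then 4 else 0).
    assert (A : forall z, (forall i, act' (enc z) = i <-> action z = i) \/
                          (act' (enc z) = 0 /\ 4 < action z)).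
    { intros z; unfold act'; rewrite <- E1, <- E2, <- E3, <- E4.
      unfold enc, enc_nat; destruct (action z) as [|[|[|[|[|a]]]]]; simpl;
        first [left; intros i; split; trivial; fail | right; lia]. }
    assert (NE : enc (st (1 + n)) = next' (cpair (enc (st n)) (u n)))
      by exact (En (st n, u n)).
    pose proof (exec_driver_body back c0 c1 c2 f1 f2 f3 f4 next' act' u
      (fun x => x = ot n \/ x = ot (1 + n)) n (ot n) (enc (st n)) H0 H1 H2) as X.
    rewrite <- NE in X; cbv zeta in X.
    assert (A' : (act' (enc (st (1 + n))) =? 4) = (action (st (1 + n)) =? 4) /\
       out_step back (act' (enc (st (1 + n)))) (ot n) = ot (1 + n)).
    { change (ot (1 + n)) with (out_step back (action (st (1 + n))) (ot n)).
      destruct (A (st (1 + n))) as [A'|[-> A']].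
      - now rewrite (proj2 (A' _) eq_refl).
      - destruct (action (st (1 + n))) as [|[|[|[|[|a]]]]]; try lia; auto. }
    destruct A' as [A1 A2]; rewrite A1, A2 in X; apply X; auto.
    intros i f HI; destruct (A (st (1 + n))) as [A'|[A' L]].
    - assert (A3 := proj2 (A' _) eq_refl); rewrite A3.
      destruct HI as [HI|[HI|[HI|[HI|[]]]]]; injection HI as <- <-; eexists; split;
        try eassumption; rewrite <- ?E1, <- ?E2, <- ?E3, <- ?E4; reflexivity.
    - rewrite A'.
      destruct HI as [HI|[HI|[HI|[HI|[]]]]]; injection HI as <- <-; eexists; split;
        try eassumption; rewrite <- ?E1, <- ?E2, <- ?E3, <- ?E4;
        destruct (action (st (1 + n))) as [|[|[|[|[|a]]]]]; try lia; reflexivity. }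
  destruct (driver_start w body (enc s) u H3 Hu) as [t1 [R1 _]].
  change (run (driver w body (enc s)) u t1 =
    conf w u 2 (PState 0 (ot 0) (driver_regs 1 (enc (st 0))))) in R1.
  assert (L : forall n t, run (driver w body (enc s)) u t =
      conf w u 2 (PState n (ot n) (driver_regs 1 (enc (st n)))) ->
    step (driver w body (enc s)) (run (driver w body (enc s)) u t) <> None /\
    exists t', t < t' /\ run (driver w body (enc s)) u t' =
      conf w u 2 (PState (1 + n) (ot (1 + n))
        (driver_regs (if action (st (1 + n)) =? 4 then 0 else 1) (enc (st (1 + n))))) /\
    (forall i, t <= i <= t' -> output (run (driver w body (enc s)) u i) = ot n \/
       output (run (driver w body (enc s)) u i) = ot (1 + n))).
  { intros n t R; eapply driver_loop; eauto. }
  split.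
  - intros NH.
    assert (L' : forall n k t, run (driver w body (enc s)) u t =
      conf w u 2 (PState n (ot n) (driver_regs 1 (enc (st n)))) ->
      exists t', t + k <= t' /\ run (driver w body (enc s)) u t' =
        conf w u 2 (PState (n + k) (ot (n + k)) (driver_regs 1 (enc (st (n + k))))) /\
      (forall i, t <= i <= t' -> exists m, n <= m /\
        output (run (driver w body (enc s)) u i) = ot m)).
    { intros n k; revert n; induction k as [|k IH]; intros n t R.
      - exists t; rewrite !Nat.add_0_r; repeat split; auto.
        intros i Hi; exists n; split; auto; replace i with t by lia; now rewrite R.
      - destruct (L n t R) as [_ [t' [Lt [R' Q]]]].
        replace (action (st (1 + n)) =? 4) with false in R'
          by (symmetry; apply Nat.eqb_neq, NH).
        destruct (IH (1 + n) t' R') as [t2 [Lt2 [R2 Q2']]].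
        exists t2; split; [lia|]; rewrite <- Nat.add_succ_comm; split; auto.
        intros i [I1 I2]; destruct (Nat.le_ge_cases i t') as [C|C].
        + destruct (Q i) as [-> | ->]; auto; [now exists n|exists (1 + n); split; auto; lia].
        + destruct (Q2' i) as [m [M1 M2]]; auto; exists m; split; auto; lia. }
    split.
    (* A machine halted at time [t] would stay in that configuration until the start of a later
       round, where a step is possible. *)
    + intros t Ht; destruct (L' 0 t t1 R1) as [t' [Lt [R' _]]].
      apply (L (0 + t) t' R').
      rewrite (halted_stays _ _ t t'); auto; lia.
    + intros n; destruct (L' 0 n t1 R1) as [t0 [_ [R0 _]]]; simpl in R0.
      exists t0; intros t Lt; destruct (L' n t t0 R0) as [t' [Lt' [_ Q]]].
      apply Q; lia.
  - intros [n Hn].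
    assert (M : exists m, action (st (1 + m)) = 4 /\ forall i, i < m -> action (st (1 + i)) <> 4).
    { clear - Hn; induction n as [n IH] using (well_founded_induction lt_wf).
      destruct (excluded_middle_informative (exists i, i < n /\ action (st (1 + i)) = 4)) as [[i [Hi A]]|N].
      - now apply (IH i).
      - exists n; split; auto; intros i Hi A; apply N; now exists i. }
    destruct M as [m [M1 M2]].
    assert (L' : forall k, k <= m -> exists t, run (driver w body (enc s)) u t =
      conf w u 2 (PState k (ot k) (driver_regs 1 (enc (st k))))).
    { induction k as [|k IH]; intros Lk; [now exists t1|].
      destruct IH as [t R]; [lia|]; destruct (L k t R) as [_ [t' [_ [R' _]]]].
      exists t'; rewrite R'; replace (action (st (1 + k)) =? 4) with false; auto.
      symmetry; apply Nat.eqb_neq, M2; lia. }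
    destruct (L' m) as [t R]; auto.
    destruct (L m t R) as [_ [t' [_ [R' _]]]]; rewrite M1 in R'; simpl in R'.
    exists (1 + t'); apply (driver_halts _ _ _ _ _ _ _ _ H3 Hu (Ho (1 + m)) R').
Qed.

(** * Simulation of Turing machines *)

#[export] Instance enc_move : Enc move := code_move.
#[export] Instance enc_action : Enc action := code_action.
#[export] Instance enc_rule : Enc rule := code_rule.
#[export] Instance enc_machine : Enc machine := code_machine.

Lemma comp_of_enc {A B} `{Enc A} `{Enc B} (f : A -> B) : comp (fun a => enc (f a)) -> comp f.
Proof. intros [g [P E]]; now exists g. Qed.

Fixpoint nat_list_fuel (k n : nat) : list nat :=
  match k, n with
  | S k, S m => fst (of_nat m) :: nat_list_fuel k (snd (of_nat m))
  | _, _ => []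
  end.

(** The inverse of the coding of lists, defined on all numbers: running through the numbers runs
    through all lists. The fuel [n] suffices because the code of a tail is smaller. *)
Definition nat_list (n : nat) : list nat := nat_list_fuel n n.

Lemma enc_nat_list n : enc (nat_list n) = n.
Proof.
  unfold nat_list.
  assert (E : forall k n, n <= k -> enc (nat_list_fuel k n) = n).
  { induction k as [|k IH]; intros [|m] L; try easy; try lia.
    change (enc (nat_list_fuel (S k) (S m))) with
      (S (cpair (fst (of_nat m)) (enc (nat_list_fuel k (snd (of_nat m)))))).
    assert (C : cpair (fst (of_nat m)) (snd (of_nat m)) = m)
      by (unfold cpair; rewrite <- surjective_pairing; apply cancel_to_of).
    pose proof (cpair_ge (fst (of_nat m)) (snd (of_nat m))).
    rewrite IH, C; lia. }
  now apply E.
Qed.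

Lemma enc_list_nat_inj (l l' : list nat) : enc l = enc l' -> l = l'.
Proof.
  rewrite <- !code_list_enc; intros E; apply (code_list_map_inj (fun n : nat => n)); auto.
  now rewrite !map_id.
Qed.

Lemma nat_list_enc (l : list nat) : nat_list (enc l) = l.
Proof. apply enc_list_nat_inj, enc_nat_list. Qed.

Lemma nat_list_code {A} `{Enc A} (l : list A) : nat_list (enc l) = map enc l.
Proof. apply enc_list_nat_inj; rewrite enc_nat_list, <- code_list_enc; reflexivity. Qed.

Lemma comp_nat_list : comp nat_list.
Proof.
  apply comp_of_enc, comp_ext with (f := fun n => n); [|comp].
  intros; now rewrite enc_nat_list.
Qed.
#[export] Hint Resolve comp_nat_list : comp.

Definition decode_move (n : nat) : move :=
  match n with 0 => Left | 1 => Stay | _ => Right end.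

Definition decode_action (n : nat) : action :=
  Action (fst (of_nat (fst (of_nat n)))) (snd (of_nat (fst (of_nat n))))
         (decode_move (snd (of_nat n))).

Definition decode_rule (n : nat) : rule :=
  let l := nat_list n in
  Rule (nth 0 l 0) (nth 1 l 0) (nth 2 l 0) (decode_move (nth 3 l 0))
    (decode_action (nth 4 l 0)) (map decode_action (nat_list (nth 5 l 0))).

(** Total: a number that is no code yields a machine whose own code differs from it, which
    [halts_within] detects by encoding again. *)
Definition decode_machine (n : nat) : machine :=
  Machine (fst (of_nat n)) (map decode_rule (nat_list (snd (of_nat n)))).

Lemma decode_move_enc m : decode_move (enc m) = m.
Proof. now destruct m. Qed.

Lemma decode_action_enc a : decode_action (enc a) = a.
Proof.
  destruct a as [s p m]; unfold decode_action.
  change (enc (Action s p m)) with (cpair (cpair s p) (enc m)).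
  now rewrite !fst_cpair, !snd_cpair, decode_move_enc.
Qed.

Lemma decode_rule_enc r : decode_rule (enc r) = r.
Proof.
  destruct r as [q q' i m a l]; unfold decode_rule.
  change (enc (Rule q q' i m a l)) with (code_list [q; q'; i; enc m; enc a; enc l]).
  rewrite code_list_enc, nat_list_enc; cbn [nth].
  rewrite decode_move_enc, decode_action_enc, nat_list_code, map_map.
  f_equal; rewrite <- (map_id l) at 2; apply map_ext, decode_action_enc.
Qed.

Lemma decode_machine_enc M : decode_machine (enc M) = M.
Proof.
  destruct M as [w l]; unfold decode_machine.
  change (enc (Machine w l)) with (cpair w (enc l)).
  rewrite fst_cpair, snd_cpair, nat_list_code, map_map.
  f_equal; rewrite <- (map_id l) at 2; apply map_ext, decode_rule_enc.
Qed.

Lemma comp_decode_move : comp decode_move.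
Proof.
  apply comp_of_enc, comp_ext with
    (f := fun n => if n =? 0 then 0 else if n =? 1 then 1 else 2); [|comp].
  now intros [|[|n]].
Qed.
#[export] Hint Resolve comp_decode_move : comp.

Lemma comp_decode_action : comp decode_action.
Proof.
  apply comp_of_enc, comp_ext with
    (f := fun n => cpair (cpair (fst (of_nat (fst (of_nat n)))) (snd (of_nat (fst (of_nat n)))))
      (enc (decode_move (snd (of_nat n))))); [easy|comp].
Qed.
#[export] Hint Resolve comp_decode_action : comp.

Lemma comp_decode_rule : comp decode_rule.
Proof.
  apply comp_of_enc, comp_ext with (f := fun n => let l := nat_list n in
    enc [nth 0 l 0; nth 1 l 0; nth 2 l 0; enc (decode_move (nth 3 l 0));
     enc (decode_action (nth 4 l 0)); enc (map decode_action (nat_list (nth 5 l 0)))]); [|cbv zeta; comp].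
  intros n; cbv zeta; now rewrite <- code_list_enc.
Qed.
#[export] Hint Resolve comp_decode_rule : comp.

Lemma comp_decode_machine : comp decode_machine.
Proof.
  apply comp_of_enc, comp_ext with (f := fun n => cpair (fst (of_nat n))
    (enc (map decode_rule (nat_list (snd (of_nat n)))))); [easy|comp].
Qed.
#[export] Hint Resolve comp_decode_machine : comp.

Lemma comp_decoded {A B} `{Enc A} `{Enc B} (d : nat -> A) (f : A -> B) :
  (forall a, d (enc a) = a) -> comp (fun n => f (d n)) -> comp f.
Proof.
  intros E C; apply comp_ext with (f := fun a => f (d (enc a))); [intros; now rewrite E|].
  apply (comp_comp (fun n => f (d n)) (fun a => enc a)); [auto|apply comp_enc, comp_id].
Qed.

Lemma comp_scan : comp scan.
Proof.
  apply (comp_decoded decode_action _ decode_action_enc); unfold decode_action, scan; comp.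
Qed.

Lemma comp_print : comp print.
Proof.
  apply (comp_decoded decode_action _ decode_action_enc); unfold decode_action, print; comp.
Qed.

Lemma comp_shift : comp shift.
Proof.
  apply (comp_decoded decode_action _ decode_action_enc); unfold decode_action, shift; comp.
Qed.

Lemma comp_source : comp source.
Proof.
  apply (comp_decoded decode_rule _ decode_rule_enc); unfold decode_rule, source; comp.
Qed.

Lemma comp_target : comp target.
Proof.
  apply (comp_decoded decode_rule _ decode_rule_enc); unfold decode_rule, target; comp.
Qed.

Lemma comp_input_scan : comp input_scan.
Proof.
  apply (comp_decoded decode_rule _ decode_rule_enc); unfold decode_rule, input_scan; comp.
Qed.

Lemma comp_input_shift : comp input_shift.
Proof.
  apply (comp_decoded decode_rule _ decode_rule_enc); unfold decode_rule, input_shift; comp.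
Qed.

Lemma comp_output_action : comp output_action.
Proof.
  apply (comp_decoded decode_rule _ decode_rule_enc); unfold decode_rule, output_action; comp.
Qed.

Lemma comp_work_actions : comp work_actions.
Proof.
  apply (comp_decoded decode_rule _ decode_rule_enc); unfold decode_rule, work_actions; comp.
Qed.

Lemma comp_work_tapes : comp work_tapes.
Proof.
  apply (comp_decoded decode_machine _ decode_machine_enc); unfold decode_machine, work_tapes; comp.
Qed.

Lemma comp_rules : comp rules.
Proof.
  apply (comp_decoded decode_machine _ decode_machine_enc); unfold decode_machine, rules; comp.
Qed.
#[export] Hint Resolve comp_scan comp_print comp_shift comp_source comp_target comp_input_scan
  comp_input_shift comp_output_action comp_work_actions comp_work_tapes comp_rules : comp.

Lemma comp_shift_pos : comp (fun p => shift_pos (fst p) (snd p)).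
Proof.
  apply comp_ext with (f := fun p : move * nat =>
    if enc (fst p) =? 0 then pred (snd p) else if enc (fst p) =? 1 then snd p else S (snd p));
    [|comp].
  now intros [[] h].
Qed.
#[export] Hint Resolve comp_shift_pos : comp.

(** * Simulation with finitely represented tapes *)

(* A tape is represented by the head position and the list of all writes, the
   most recent one first. *)
Notation ftape := (nat * list (nat * nat))%type.
Notation fconfig := (nat * (nat * (ftape * list ftape)))%type.

(** The first match is the latest write; the default 0 is [blank]. *)
Definition lookup (l : list (nat * nat)) (k : nat) : nat :=
  fold_right (fun e r => if k =? fst e then snd e else r) 0 l.

Definition fscanned (t : ftape) : nat := lookup (snd t) (fst t).

Definition fact (a : action) (t : ftape) : ftape :=
  (shift_pos (shift a) (fst t), (fst t, print a) :: snd t).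

Definition fscans (l : list action) (ts : list ftape) : bool :=
  (length l =? length ts) &&
  forallb (fun p => scan (fst p) =? fscanned (snd p)) (combine l ts).

Definition fapplies (inp : list nat) (c : fconfig) (r : rule) : bool :=
  (source r =? fst c) && (input_scan r =? nth (fst (snd c)) inp 0)
  && (scan (output_action r) =? fscanned (fst (snd (snd c))))
  && fscans (work_actions r) (snd (snd (snd c))).

Definition fapply (r : rule) (c : fconfig) : fconfig :=
  (target r, (shift_pos (input_shift r) (fst (snd c)),
    (fact (output_action r) (fst (snd (snd c))),
     map (fun p => fact (fst p) (snd p)) (combine (work_actions r) (snd (snd (snd c))))))).

Definition fstep (M : machine) (inp : list nat) (c : fconfig) : option fconfig :=
  match find (fapplies inp c) (rules M) with Some r => Some (fapply r c) | None => None end.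

Definition frun (M : machine) (inp : list nat) (t : nat) : fconfig :=
  Nat.iter t (fun c => match fstep M inp c with Some c' => c' | None => c end)
    (0, (0, ((0, []), repeat (0, []) (work_tapes M)))).

Definition fhalted (M : machine) (inp : list nat) (t : nat) : bool :=
  match fstep M inp (frun M inp t) with Some _ => false | None => true end.

Definition fcell (M : machine) (inp : list nat) (t k : nat) : nat :=
  lookup (snd (fst (snd (snd (frun M inp t))))) k.

Lemma comp_lookup : comp (fun p => lookup (fst p) (snd p)).
Proof. unfold lookup; comp. Qed.
#[export] Hint Resolve comp_lookup : comp.

Lemma comp_fscanned : comp fscanned.
Proof. unfold fscanned; comp. Qed.
#[export] Hint Resolve comp_fscanned : comp.

Lemma comp_fact : comp (fun p => fact (fst p) (snd p)).
Proof. unfold fact; comp. Qed.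
#[export] Hint Resolve comp_fact : comp.

Lemma comp_fscans : comp (fun p => fscans (fst p) (snd p)).
Proof. unfold fscans; comp. Qed.
#[export] Hint Resolve comp_fscans : comp.

Lemma comp_fapplies : comp (fun p => fapplies (fst p) (fst (snd p)) (snd (snd p))).
Proof. unfold fapplies; comp. Qed.
#[export] Hint Resolve comp_fapplies : comp.

Lemma comp_fapply : comp (fun p => fapply (fst p) (snd p)).
Proof. unfold fapply; comp. Qed.
#[export] Hint Resolve comp_fapply : comp.

Lemma comp_fstep : comp (fun p => fstep (fst p) (fst (snd p)) (snd (snd p))).
Proof. unfold fstep; comp. Qed.
#[export] Hint Resolve comp_fstep : comp.

Lemma comp_frun : comp (fun p => frun (fst p) (fst (snd p)) (snd (snd p))).
Proof. unfold frun; comp. Qed.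
#[export] Hint Resolve comp_frun : comp.

Lemma comp_fhalted : comp (fun p => fhalted (fst p) (fst (snd p)) (snd (snd p))).
Proof. unfold fhalted; comp. Qed.

Lemma comp_fcell :
  comp (fun p => fcell (fst p) (fst (snd p)) (fst (snd (snd p))) (snd (snd (snd p)))).
Proof. unfold fcell; comp. Qed.
#[export] Hint Resolve comp_fhalted comp_fcell : comp.

Definition tape_of (t : ftape) : tape := Tape (fst t) (lookup (snd t)).

Definition word_of (inp : list nat) (k : nat) : nat := nth k inp 0.

Definition config_of (inp : list nat) (c : fconfig) : config :=
  Config (fst c) (Tape (fst (snd c)) (word_of inp))
    (tape_of (fst (snd (snd c)))) (map tape_of (snd (snd (snd c)))).

Lemma scans_fscans l ts : scans l (map tape_of ts) = fscans l ts.
Proof.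
  revert ts; induction l as [|a l IH]; intros [|t ts]; simpl; auto; rewrite IH.
  unfold fscans; simpl; destruct (length l =? length ts); simpl; auto.
  now rewrite Bool.andb_false_r.
Qed.

Lemma step_config_of M inp c :
  step M (config_of inp c) = option_map (config_of inp) (fstep M inp c).
Proof.
  unfold step, fstep.
  replace (applies (config_of inp c)) with (fapplies inp c).
  2: { extensionality r; unfold fapplies, applies; simpl; now rewrite scans_fscans. }
  destruct (find _ _) as [r|]; simpl; auto; f_equal.
  unfold apply_rule, fapply, config_of; simpl; f_equal.
  generalize (snd (snd (snd c))) as ts; induction (work_actions r) as [|a l IH];
    intros [|t ts]; simpl; auto; now rewrite IH.
Qed.

Lemma run_frun M inp t : run M (word_of inp) t = config_of inp (frun M inp t).
Proof.
  induction t as [|t IH].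
  - simpl; unfold initial, config_of; simpl; f_equal.
    induction (work_tapes M); simpl; f_equal; auto.
  - simpl run; rewrite IH, step_config_of.
    change (frun M inp (S t)) with
      (match fstep M inp (frun M inp t) with Some c' => c' | None => frun M inp t end).
    now destruct (fstep M inp (frun M inp t)).
Qed.

Lemma fcell_run M inp t k : fcell M inp t k = cells (output (run M (word_of inp) t)) k.
Proof. now rewrite run_frun. Qed.

Lemma fhalted_run M inp t :
  fhalted M inp t = true <-> halted M (run M (word_of inp) t).
Proof.
  unfold halted, fhalted; rewrite run_frun, step_config_of.
  destruct (fstep _ _ _); simpl; split; congruence.
Qed.

Lemma word_of_repeat n : word_of (repeat stroke n) = finite_word n.
Proof.
  extensionality k; unfold word_of, finite_word; destruct (Nat.ltb_spec k n).
  - now apply nth_repeat_lt.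
  - apply nth_overflow; now rewrite repeat_length.
Qed.

Lemma run_input M u t : cells (input (run M u t)) = u.
Proof.
  induction t as [|t IH]; simpl; auto; unfold step.
  destruct (find _ _); simpl; auto.
Qed.

Lemma run_pos M u t : pos (input (run M u t)) <= t.
Proof.
  induction t as [|t IH]; simpl; auto; unfold step.
  destruct (find _ _) as [r|]; simpl; auto; destruct (input_shift r); simpl; lia.
Qed.

(** The input head moves at most one cell per step, so the first [t] steps read only cells below
    [t]. *)
Lemma run_local M u u' t : (forall k, k < t -> u k = u' k) ->
  state (run M u t) = state (run M u' t) /\
  pos (input (run M u t)) = pos (input (run M u' t)) /\
  output (run M u t) = output (run M u' t) /\ work (run M u t) = work (run M u' t).
Proof.
  induction t as [|t IH]; intros H; simpl; auto.
  destruct IH as [I1 [I2 [I3 I4]]]; [intros; apply H; lia|].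
  unfold step; replace (applies (run M u' t)) with (applies (run M u t)).
  - destruct (find _ _); simpl; rewrite ?I1, ?I2, ?I3, ?I4; auto.
  - extensionality r; unfold applies; rewrite I1, I3, I4; unfold scanned at 1 3.
    rewrite !run_input, <- I2, H; auto; pose proof (run_pos M u t); lia.
Qed.

(** Invariant: all cells from the output head onwards are blank. A rule that stays reprints what is
    there, and a rule that advances prints on a blank cell. *)
Lemma one_way_step M c c' : one_way M -> step M c = Some c' ->
  (forall k, pos (output c) <= k -> cells (output c) k = blank) ->
  (forall k, pos (output c') <= k -> cells (output c') k = blank) /\
  forall k, cells (output c) k <> blank -> cells (output c') k = cells (output c) k.
Proof.
  intros O E B; unfold step in E; destruct (find _ _) as [r|] eqn:F; [|easy].
  injection E as <-; apply find_some in F as [F1 F2]; specialize (O r F1).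
  unfold applies in F2; apply Bool.andb_true_iff in F2 as [F2 _].
  apply Bool.andb_true_iff in F2 as [_ F2]; apply Nat.eqb_eq in F2.
  simpl; destruct (shift (output_action r)); [easy| |]; simpl.
  - rewrite O, F2; unfold scanned; split; intros k; destruct (Nat.eqb_spec k (pos (output c)));
      subst; auto.
  - split; intros k; destruct (Nat.eqb_spec k (pos (output c))); subst; auto; try lia.
    + intros; apply B; lia.
    + intros N; now rewrite B in N.
Qed.

Lemma one_way_keeps M u s t k : one_way M -> s <= t ->
  cells (output (run M u s)) k <> blank ->
  cells (output (run M u t)) k = cells (output (run M u s)) k.
Proof.
  intros O L N.
  assert (B : forall t k, pos (output (run M u t)) <= k -> cells (output (run M u t)) k = blank).
  { intros i; induction i as [|i IH]; simpl; auto.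
    destruct (step M (run M u i)) eqn:E; auto; now apply (one_way_step M _ _ O E). }
  induction L as [|t L IH]; auto; simpl.
  destruct (step M (run M u t)) as [c|] eqn:E; auto.
  rewrite <- IH; apply (one_way_step M _ _ O E); auto; now rewrite IH.
Qed.

(** * Timed halting and timed values *)

Definition halts_within (i n t : nat) : bool :=
  (enc (decode_machine i) =? i) && fhalted (decode_machine i) (repeat stroke n) t.

Lemma comp_halts_within :
  comp (fun p => halts_within (fst p) (fst (snd p)) (snd (snd p))).
Proof. unfold halts_within; comp. Qed.
#[export] Hint Resolve comp_halts_within : comp.

Lemma halted_later M u t t' : t <= t' -> halted M (run M u t) -> halted M (run M u t').
Proof. intros L H; now rewrite (halted_stays M u t t'). Qed.

Lemma halts_within_mono i n t t' : t <= t' ->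
  halts_within i n t = true -> halts_within i n t' = true.
Proof.
  unfold halts_within; rewrite !Bool.andb_true_iff, !fhalted_run.
  intros L [H1 H2]; split; auto; now apply halted_later with t.
Qed.

Lemma W_halts_within i n : W i n <-> exists t, halts_within i n t = true.
Proof.
  unfold W, halts_on, halts_within; split.
  - intros [M [E [t H]]]; exists t.
    change (enc M = i) in E; rewrite <- E, decode_machine_enc, Nat.eqb_refl; simpl.
    now rewrite fhalted_run, word_of_repeat.
  - intros [t H]; apply Bool.andb_true_iff in H as [H1 H2]; apply Nat.eqb_eq in H1.
    exists (decode_machine i); split; auto; exists t.
    now rewrite fhalted_run, word_of_repeat in H2.
Qed.

(** For an output consisting of a block of strokes, a blank in cell [t] certifies that the whole
    block lies below [t], so counting there gives the value. *)
Definition value_within (M : machine) (n t : nat) : option nat :=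
  let inp := repeat stroke n in
  if fhalted M inp t && (fcell M inp t t =? blank)
  then Some (length (flat_map (fun k => if fcell M inp t k =? stroke then [k] else []) (seq 0 t)))
  else None.

Lemma comp_value_within : comp (fun p => value_within (fst p) (fst (snd p)) (snd (snd p))).
Proof. unfold value_within; cbv zeta; comp. Qed.
#[export] Hint Resolve comp_value_within : comp.

Definition computes_nat (M : machine) (h : nat -> nat) : Prop :=
  forall n, exists t, halted M (run M (finite_word n) t) /\
    forall k, cells (output (run M (finite_word n) t)) k = finite_word (h n) k.

Lemma count_strokes v t : v <= t ->
  length (flat_map (fun k => if finite_word v k =? stroke then [k] else []) (seq 0 t)) = v.
Proof.
  intros L; induction L as [|t L IH].
  - assert (E : forall m, m <= v ->
      length (flat_map (fun k => if finite_word v k =? stroke then [k] else []) (seq 0 m)) = m).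
    { induction m as [|m IH]; intros L; auto.
      rewrite seq_S, flat_map_app, length_app, IH by lia; simpl; unfold finite_word.
      destruct (Nat.ltb_spec m v); simpl; lia. }
    now apply E.
  - rewrite seq_S, flat_map_app, length_app, IH; simpl; unfold finite_word.
    destruct (Nat.ltb_spec t v); simpl; lia.
Qed.

Lemma value_within_spec M h n : computes_nat M h -> exists t0,
  (forall t, t0 <= t -> value_within M n t = Some (h n)) /\
  forall t v, value_within M n t = Some v -> v = h n.
Proof.
  intros C; destruct (C n) as [t0 [H0 O0]].
  assert (V : forall t, value_within M n t =
    if fhalted M (repeat stroke n) t && (fcell M (repeat stroke n) t t =? blank)
    then Some (h n) else None).
  { intros t; unfold value_within.
    destruct (fhalted M (repeat stroke n) t) eqn:E1; simpl; auto.
    destruct (Nat.eqb_spec (fcell M (repeat stroke n) t t) blank) as [E2|]; auto.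
    rewrite fhalted_run, word_of_repeat in E1.
    assert (E : forall k, fcell M (repeat stroke n) t k = finite_word (h n) k).
    { intros k; rewrite fcell_run, word_of_repeat, <- O0.
      destruct (Nat.le_ge_cases t t0) as [L|L];
        [rewrite (halted_stays _ _ t t0)|rewrite (halted_stays _ _ t0 t)]; auto. }
    rewrite E in E2; f_equal.
    rewrite (flat_map_ext _ (fun k => if finite_word (h n) k =? stroke then [k] else []))
      by (intros; now rewrite E).
    apply count_strokes; unfold finite_word in E2.
    destruct (Nat.ltb_spec t (h n)); [discriminate|lia]. }
  (* Time [t0] to halt, and [h n] cells to have the whole output in view. *)
  exists (t0 + h n); split.
  - intros t L; rewrite V.
    rewrite (proj2 (fhalted_run _ _ _)), fcell_run, word_of_repeat, (halted_stays _ _ t0 t), O0; auto; try lia.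
    + unfold finite_word; destruct (Nat.ltb_spec t (h n)); [lia|auto].
    + rewrite word_of_repeat; apply halted_later with t0; auto; lia.
  - intros t v; rewrite V; destruct (_ && _); congruence.
Qed.

(** * Words of sequences *)

Definition letters (l : list nat) : list nat :=
  flat_map (fun a => repeat stroke a ++ [separator]) l.

Lemma infinite_word_eq p k : infinite_word p k =
  if k <? p 0 then stroke else if k =? p 0 then separator
  else infinite_word (fun i => p (S i)) (k - S (p 0)).
Proof.
  revert p; induction k as [|k IH]; intros p; simpl; destruct (p 0) as [|a] eqn:E;
    rewrite ?Nat.sub_0_r, ?IH; auto.
Qed.

Lemma infinite_word_letter p k : infinite_word p k = stroke \/ infinite_word p k = separator.
Proof.
  revert p; induction k as [|k IH]; intros p; simpl; destruct (p 0); auto.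
Qed.

Lemma letters_length l : length l <= length (letters l).
Proof.
  induction l as [|a l IH]; simpl; auto; rewrite !length_app; simpl; lia.
Qed.

Lemma nth_letters l p k : (forall i, i < length l -> p i = nth i l 0) ->
  k < length (letters l) -> nth k (letters l) 0 = infinite_word p k.
Proof.
  revert p k; induction l as [|a l IH]; intros p k H L; [simpl in L; lia|].
  rewrite infinite_word_eq, (H 0) by (simpl; lia); simpl nth at 2 3 4.
  simpl in L |- *; rewrite <- app_assoc in L |- *; rewrite !length_app, repeat_length in L; simpl in L.
  destruct (Nat.ltb_spec k a).
  - rewrite app_nth1 by (rewrite repeat_length; lia); now apply nth_repeat_lt.
  - rewrite app_nth2, repeat_length by (rewrite repeat_length; lia).
    destruct (Nat.eqb_spec k a) as [->|]; [now rewrite Nat.sub_diag|].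
    replace (k - a) with (S (k - S a)) by lia; simpl; apply IH; [|lia].
    intros i Hi; apply (H (S i)); simpl; lia.
Qed.

Lemma infinite_word_inj p q : (forall k, infinite_word p k = infinite_word q k) -> p = q.
Proof.
  intros H; extensionality i; revert p q H; induction i as [|i IH]; intros p q H;
  (assert (E : p 0 = q 0);
   [destruct (Nat.lt_trichotomy (p 0) (q 0)) as [L|[L|L]]; auto;
    [specialize (H (p 0))|specialize (H (q 0))];
    rewrite (infinite_word_eq p), (infinite_word_eq q), Nat.ltb_irrefl, Nat.eqb_refl in H;
    apply Nat.ltb_lt in L; rewrite L in H; discriminate|]); auto.
  apply (IH (fun i => p (S i)) (fun i => q (S i))); intros k.
  specialize (H (S (p 0) + k)); rewrite (infinite_word_eq p), (infinite_word_eq q), <- E in H.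
  destruct (Nat.ltb_spec (S (p 0) + k) (p 0)), (Nat.eqb_spec (S (p 0) + k) (p 0)); try lia.
  now replace (S (p 0) + k - S (p 0)) with k in H by lia.
Qed.

(* The reader's state: the numbers read so far and the strokes seen since. *)
Definition read_letter (r : list nat * nat) (a : nat) : list nat * nat :=
  if a =? stroke then (fst r, S (snd r)) else (fst r ++ [snd r], 0).

Lemma comp_read_letter : comp (fun p => read_letter (fst p) (snd p)).
Proof. unfold read_letter; comp. Qed.
#[export] Hint Resolve comp_read_letter : comp.

(** The place where the block of [q m] begins; each block ends with its separator, whence the
    successor. *)
Fixpoint offset (q : Baire) (m : nat) : nat :=
  match m with 0 => 0 | S m => offset q m + S (q m) end.

Lemma infinite_word_offset q m k :
  infinite_word q (offset q m + k) = infinite_word (fun i => q (m + i)) k.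
Proof.
  revert k; induction m as [|m IH]; intros k; simpl; auto.
  rewrite <- Nat.add_assoc, IH, infinite_word_eq, Nat.add_0_r.
  destruct (Nat.ltb_spec (S (q m) + k) (q m)), (Nat.eqb_spec (S (q m) + k) (q m)); try lia.
  replace (S (q m) + k - S (q m)) with k by lia; f_equal.
  extensionality i; f_equal; lia.
Qed.

Lemma reader_state q n : exists m, offset q m <= n <= offset q m + q m /\
  tr_state read_letter (infinite_word q) ([], 0) n = (map q (seq 0 m), n - offset q m).
Proof.
  induction n as [|n [m [L E]]]; [exists 0; simpl; split; auto; lia|].
  simpl tr_state; rewrite E; unfold read_letter; simpl fst; simpl snd.
  replace (infinite_word q n) with (infinite_word q (offset q m + (n - offset q m)))
    by (f_equal; lia).
  rewrite infinite_word_offset, infinite_word_eq, Nat.add_0_r.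
  destruct (Nat.ltb_spec (n - offset q m) (q m)).
  - exists m; change (stroke =? stroke) with true; cbv iota; split; [lia|f_equal; lia].
  - destruct (Nat.eqb_spec (n - offset q m) (q m)) as [E'|]; [|lia].
    exists (S m); change (separator =? stroke) with false; cbv iota; simpl offset; split; [lia|].
    rewrite seq_S, map_app, E'; apply f_equal2; [reflexivity|lia].
Qed.

Lemma reader_length q m : exists n0, forall n, n0 <= n ->
  m <= length (fst (tr_state read_letter (infinite_word q) ([], 0) n)).
Proof.
  exists (offset q m); intros n L; destruct (reader_state q n) as [m' [L' ->]]; simpl.
  rewrite length_map, length_seq; destruct (Nat.le_gt_cases m m') as [|G]; auto; exfalso.
  assert (X : offset q (S m') <= offset q m).
  { clear - G; induction G as [|m G IH]; auto; simpl in *; lia. }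
  simpl in X; lia.
Qed.

(** * Approximation of distances *)

(* ((a, b), d) stands for (a - b) / d. *)
Notation frac := (nat * nat * nat)%type.

Definition fval (x : frac) : R :=
  ((INR (fst (fst x)) - INR (snd (fst x))) / INR (snd x))%R.

Definition fadd (x y : frac) : frac :=
  (fst (fst x) * snd y + fst (fst y) * snd x, snd (fst x) * snd y + snd (fst y) * snd x,
   snd x * snd y).

Definition flt (x y : frac) : bool :=
  fst (fst x) * snd y + snd (fst y) * snd x <? fst (fst y) * snd x + snd (fst x) * snd y.

Definition frat (n : nat) : frac := (of_nat (fst (of_nat n)), S (snd (of_nat n))).

Definition fpow (k : nat) : frac := (1, 0, 2 ^ k).

Lemma comp_fadd : comp (fun p => fadd (fst p) (snd p)).
Proof. unfold fadd; comp. Qed.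

Lemma comp_flt : comp (fun p => flt (fst p) (snd p)).
Proof. unfold flt; comp. Qed.

Lemma comp_frat : comp frat.
Proof. unfold frat; comp. Qed.

Lemma comp_fpow : comp fpow.
Proof. unfold fpow; comp. Qed.
#[export] Hint Resolve comp_fadd comp_flt comp_frat comp_fpow : comp.

Lemma fval_add x y : 0 < snd x -> 0 < snd y -> fval (fadd x y) = (fval x + fval y)%R.
Proof.
  intros Hx Hy; apply lt_INR in Hx, Hy; unfold fval, fadd; simpl in *.
  rewrite !plus_INR, !mult_INR; field; lra.
Qed.

Lemma flt_spec x y : 0 < snd x -> 0 < snd y -> flt x y = true <-> (fval x < fval y)%R.
Proof.
  destruct x as [[a b] d], y as [[a' b'] d']; unfold flt, fval; simpl; intros Hx Hy.
  rewrite Nat.ltb_lt; apply lt_INR in Hx, Hy; simpl in Hx, Hy.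
  assert (E : ((INR a' - INR b') / INR d' - (INR a - INR b) / INR d =
     (INR (a' * d + b * d') - INR (a * d' + b' * d)) / (INR d * INR d'))%R)
    by (rewrite !plus_INR, !mult_INR; field; lra).
  assert (P : (0 < / (INR d * INR d'))%R) by (apply Rinv_0_lt_compat; nra).
  unfold Rdiv in E at 3; split; intros H.
  - apply lt_INR in H; nra.
  - apply INR_lt; nra.
Qed.

Lemma fval_rat n : fval (frat n) = rational n.
Proof.
  unfold fval, frat, rational; simpl snd; rewrite S_INR.
  destruct (of_nat n) as [ij k]; simpl; now destruct (of_nat ij).
Qed.

Lemma pow2_pos k : 0 < 2 ^ k.
Proof. apply Nat.neq_0_lt_0, Nat.pow_nonzero; lia. Qed.

Lemma fval_pow k : fval (fpow k) = (/ 2 ^ k)%R.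
Proof.
  unfold fval, fpow; simpl; rewrite pow_INR; simpl.
  replace (1 + 1)%R with 2%R by lra; unfold Rdiv; lra.
Qed.

Lemma inv_pow2_pos k : (0 < / 2 ^ k)%R.
Proof. apply Rinv_0_lt_compat, pow_lt; lra. Qed.

Lemma inv_pow2_small (eps : R) : (0 < eps)%R ->
  exists k0, forall k, k0 <= k -> (/ 2 ^ k < eps)%R.
Proof.
  intros He; destruct (pow_lt_1_zero (/ 2)) with (y := eps) as [N HN]; auto.
  - rewrite Rabs_pos_eq; lra.
  - exists N; intros k Hk; specialize (HN k Hk); rewrite pow_inv in HN.
    rewrite Rabs_pos_eq in HN; auto; apply Rlt_le, inv_pow2_pos.
Qed.

Lemma inv_pow2_S k : (/ 2 ^ S k = / 2 ^ k / 2)%R.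
Proof. simpl; rewrite Rinv_mult; lra. Qed.

Lemma inv_pow2_mono k k' : k <= k' -> (/ 2 ^ k' <= / 2 ^ k)%R.
Proof.
  induction 1 as [|m L IH]; [lra|rewrite inv_pow2_S; pose proof (inv_pow2_pos m); lra].
Qed.

Lemma Rabs_le_both (a b : R) : (Rabs a <= b -> - b <= a <= b)%R.
Proof.
  intros H; pose proof (Rle_abs a); pose proof (Rle_abs (- a)) as G; rewrite Rabs_Ropp in G; lra.
Qed.

(** A strict inequality is semidecidable: the error 2^-k is added on the smaller side, so [true] is
    always correct, and a true inequality is confirmed once the precision [k] and then the time [t]
    are large enough. *)
Definition dist_lt (M : machine) (i j k t : nat) (x y : frac) : bool :=
  match value_within M (triple i j k) t with
  | Some v => flt (fadd (fadd (frat v) (fpow k)) x) y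
  | None => false
  end.

Lemma comp_triple : comp (fun p => triple (fst p) (fst (snd p)) (snd (snd p))).
Proof. unfold triple; comp. Qed.
#[export] Hint Resolve comp_triple : comp.

Lemma comp_dist_lt {A} `{Enc A} (M : A -> machine) (i j k t : A -> nat) (x y : A -> frac) :
  comp M -> comp i -> comp j -> comp k -> comp t -> comp x -> comp y ->
  comp (fun a => dist_lt (M a) (i a) (j a) (k a) (t a) (x a) (y a)).
Proof. intros; unfold dist_lt; comp. Qed.

Definition approximates (X : computable_metric_space) (M : machine) : Prop :=
  exists h, computes_nat M h /\ forall i j k,
    (Rabs (dist X (point X i) (point X j) - rational (h (triple i j k))) <= / 2 ^ k)%R.

Lemma approximates_exists X : exists M, approximates X M.
Proof.
  destruct (point_computable X) as [h [[M HM] Hh]]; exists M, h; split; [exact HM|exact Hh].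
Qed.

Lemma dist_lt_sound X M i j k t x y : approximates X M -> 0 < snd x -> 0 < snd y ->
  dist_lt M i j k t x y = true -> (dist X (point X i) (point X j) + fval x < fval y)%R.
Proof.
  intros [h [C A]] Hx Hy H; unfold dist_lt in H.
  destruct (value_within M (triple i j k) t) as [v|] eqn:E; [|easy].
  destruct (value_within_spec M h (triple i j k) C) as [_ [_ V]].
  apply V in E; subst; pose proof (pow2_pos k).
  apply flt_spec in H; simpl; try nia; rewrite !fval_add in H; simpl; try nia.
  rewrite fval_rat, fval_pow in H; specialize (A i j k).
  apply Rabs_le_both in A; lra.
Qed.

Lemma dist_lt_complete X M i j x y : approximates X M -> 0 < snd x -> 0 < snd y ->
  (dist X (point X i) (point X j) + fval x < fval y)%R ->
  exists k0, forall k, k0 <= k -> exists t0, forall t, t0 <= t ->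
    dist_lt M i j k t x y = true.
Proof.
  intros [h [C A]] Hx Hy H.
  (* Half of the gap, since 2^-k is lost twice: as error of the approximation and as added
     margin. *)
  destruct (inv_pow2_small ((fval y - fval x - dist X (point X i) (point X j)) / 2))
    as [k0 K]; [lra|].
  exists k0; intros k Hk; specialize (K k Hk); specialize (A i j k).
  destruct (value_within_spec M h (triple i j k) C) as [t0 [V _]].
  exists t0; intros t Ht; unfold dist_lt; rewrite V by auto; pose proof (pow2_pos k).
  apply flt_spec; simpl; try nia; rewrite !fval_add; simpl; try nia.
  rewrite fval_rat, fval_pow; apply Rabs_le_both in A; lra.
Qed.

Lemma name_dist X p x k : cauchy_rep X p x -> (dist X (point X (p k)) x <= / 2 ^ k)%R.
Proof.
  intros [H1 H2]; apply le_epsilon; intros eps He.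
  destruct (H2 eps He) as [N HN]; specialize (HN (N + k) ltac:(lia)).
  unfold Rdist in HN; rewrite Rminus_0_r in HN; apply Rabs_def2 in HN as [HN _].
  specialize (H1 k (N + k) ltac:(lia)).
  pose proof (dist_tri X (point X (p k)) x (point X (p (N + k)))) as T.
  rewrite (dist_sym X (point X (p k)) (point X (p (N + k)))) in T; lra.
Qed.

Lemma name_unique X p x x' : cauchy_rep X p x -> cauchy_rep X p x' -> x = x'.
Proof.
  intros H H'; apply dist_refl; apply Rle_antisym; [|apply Rge_le, dist_pos].
  apply le_epsilon; intros eps He.
  destruct (inv_pow2_small (eps / 2)) as [k K]; [lra|]; specialize (K k (le_n k)).
  pose proof (name_dist X p x k H); pose proof (name_dist X p x' k H').
  pose proof (dist_tri X x x' (point X (p k))) as T.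
  rewrite (dist_sym X x (point X (p k))) in T; lra.
Qed.

(** * The jump in the limit *)

(** Since entry [j] of a name lies within 2^-j of the point, the point is in the ball as soon as the
    distance from that entry to the centre plus 2^-j is below the radius. *)
Definition jump_bit (M : machine) (l : list nat) (n i : nat) : bool :=
  existsb (fun m => halts_within i m n &&
    existsb (fun j => existsb (fun k =>
      dist_lt M (nth j l 0) (fst (of_nat m)) k n (fpow j) (frat (snd (of_nat m))))
      (seq 0 n)) (seq 0 (length l))) (seq 0 n).

Lemma comp_jump_bit (M : machine) :
  comp (fun p => jump_bit M (fst p) (fst (snd p)) (snd (snd p))).
Proof.
  unfold jump_bit; comp; apply comp_dist_lt; comp.
Qed.

Lemma ball_eq X n x : ball X n x <->
  (dist X x (point X (fst (of_nat n))) < rational (snd (of_nat n)))%R.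
Proof. unfold ball; now destruct (of_nat n). Qed.

Lemma jump_bit_sound X M p x m n i : approximates X M -> cauchy_rep X p x ->
  jump_bit M (map p (seq 0 m)) n i = true -> U X i x.
Proof.
  intros A N H; apply existsb_exists in H as [c [_ H]].
  apply Bool.andb_true_iff in H as [H1 H]; apply existsb_exists in H as [j [Hj H]].
  apply existsb_exists in H as [k [_ H]].
  exists c; split; [apply W_halts_within; now exists n|].
  rewrite length_map, length_seq in Hj; apply in_seq in Hj.
  rewrite (nth_indep _ 0 (p 0)), map_nth, seq_nth in H by (rewrite ?length_map, ?length_seq; lia).
  apply (dist_lt_sound X) in H; auto; [|apply pow2_pos|simpl; lia].
  rewrite fval_pow, fval_rat in H; apply ball_eq.
  pose proof (name_dist X p x j N).
  pose proof (dist_tri X x (point X (fst (of_nat c))) (point X (p j))) as T.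
  rewrite (dist_sym X x (point X (p j))) in T; simpl in H; lra.
Qed.

Lemma jump_bit_complete X M p x i : approximates X M -> cauchy_rep X p x -> U X i x ->
  exists n0, forall m n, n0 <= m -> n0 <= n -> jump_bit M (map p (seq 0 m)) n i = true.
Proof.
  intros A N [c [H1 H2]]; apply W_halts_within in H1 as [t1 H1]; apply ball_eq in H2.
  set (d := (rational (snd (of_nat c)) - dist X x (point X (fst (of_nat c))))%R).
  destruct (inv_pow2_small (d / 2)) as [j J]; [unfold d; lra|]; specialize (J j (le_n j)).
  destruct (dist_lt_complete X M (p j) (fst (of_nat c)) (fpow j) (frat (snd (of_nat c))))
    as [k0 K]; auto; [apply pow2_pos|simpl; lia| |].
  { rewrite fval_pow, fval_rat; pose proof (name_dist X p x j N).
    pose proof (dist_tri X (point X (p j)) (point X (fst (of_nat c))) x); unfold d in J; lra. }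
  destruct (K k0 (le_n k0)) as [t2 T].
  exists (S (c + t1 + j + k0 + t2)); intros m n Lm Ln.
  apply existsb_exists; exists c; split; [apply in_seq; lia|].
  rewrite (halts_within_mono i c t1 n) by (auto; lia); simpl andb.
  apply existsb_exists; exists j; split; [apply in_seq; rewrite length_map, length_seq; lia|].
  apply existsb_exists; exists k0; split; [apply in_seq; lia|].
  rewrite (nth_indep _ 0 (p 0)), map_nth, seq_nth by (rewrite ?length_map, ?length_seq; lia).
  apply T; lia.
Qed.

Lemma jump_bit_limit X M p x i : approximates X M -> cauchy_rep X p x ->
  exists n0, forall m n, n0 <= m -> n0 <= n ->
    (if jump_bit M (map p (seq 0 m)) n i then 1 else 0) = turing_jump X x i.
Proof.
  intros A N; unfold turing_jump.
  destruct (excluded_middle_informative (U X i x)) as [H|H].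
  - destruct (jump_bit_complete X M p x i A N H) as [n0 E].
    exists n0; intros; now rewrite E.
  - exists 0; intros m n _ _.
    destruct (jump_bit M _ n i) eqn:E; auto; destruct H; now apply (jump_bit_sound X M p x m n i).
Qed.

Definition converges (M : machine) (u : nat -> nat) (r : Baire) : Prop :=
  forall k, exists t0, forall t, t0 <= t ->
    cells (output (run M u t)) k = infinite_word r k.

(** Every number contributes at least its separator, so letter [k] lies within the blocks of the
    first [k + 1] numbers. *)
Lemma infinite_word_local p q k : (forall i, i <= k -> p i = q i) ->
  infinite_word p k = infinite_word q k.
Proof.
  revert p q; induction k as [k IH] using (well_founded_induction lt_wf); intros p q H.
  rewrite (infinite_word_eq p), (infinite_word_eq q), <- H by lia.
  destruct (Nat.ltb_spec k (p 0)); auto; destruct (Nat.eqb_spec k (p 0)); auto.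
  apply IH; [lia|]; intros i L; apply H; lia.
Qed.

Lemma infinite_word_le p k : infinite_word p k <= 2.
Proof. destruct (infinite_word_letter p k) as [-> | ->]; unfold stroke, separator; lia. Qed.

Lemma word_of_letters l q t : t <= length l -> (forall i, i < t -> nth i l 0 = q i) ->
  forall k, k < t -> word_of (letters l) k = infinite_word q k.
Proof.
  intros L H k Hk; unfold word_of.
  rewrite (nth_letters l (fun i => nth i l 0)); auto.
  - apply infinite_word_local; intros i Hi; apply H; lia.
  - pose proof (letters_length l); lia.
Qed.

(* In round [s] of the sweep the cells 0, ..., s - 1 are printed again, and then
   the head goes back to cell 0. *)
Definition sweep_next (z : nat * nat) : nat * nat :=
  if S (snd z) <? 2 * fst z then (fst z, S (snd z)) else (S (fst z), 0).

Definition sweep (n : nat) : nat * nat := Nat.iter n sweep_next (0, 0).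

(** Cell [k] is printed at arbitrarily late times, so it suffices that the guesses for it
    converge. *)
Lemma sweep_visits k n0 : exists n s, n0 <= n /\ k < s /\ sweep n = (s, k).
Proof.
  assert (A : forall s m j, sweep m = (s, 0) -> j < 2 * s -> sweep (j + m) = (s, j)).
  { intros s m j E; induction j as [|j IH]; intros L; auto.
    change (sweep (S j + m)) with (sweep_next (sweep (j + m))); rewrite IH by lia; unfold sweep_next; cbn [fst snd].
    destruct (Nat.ltb_spec (S j) (2 * s)); auto; lia. }
  assert (B : forall s, exists m, s <= m /\ sweep m = (S s, 0)).
  { induction s as [|s [m [L E]]]; [exists 1; split; auto; lia|].
    exists (S (S (2 * s) + m)); split; [lia|].
    change (sweep_next (sweep (S (2 * s) + m)) = (S (S s), 0)).
    rewrite (A (S s) m (S (2 * s)) E) by lia; unfold sweep_next; cbn [fst snd].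
    destruct (Nat.ltb_spec (S (S (2 * s))) (2 * S s)); auto; lia. }
  destruct (B (k + n0)) as [m [L E]].
  exists (k + m), (S (k + n0)); repeat split; try lia; apply A; auto; lia.
Qed.

Notation lstate := (list nat * nat * (nat * (nat * nat)))%type.

Definition limit_next (st : lstate) (a : nat) : lstate :=
  (read_letter (fst st) a, (S (fst (snd st)), sweep_next (snd (snd st)))).

Definition jump_list (M : machine) (l : list nat) (n : nat) : list nat :=
  map (fun i => if jump_bit M l n i then 1 else 0) (seq 0 n).

(** Always a printable letter: a cell that is still blank is guessed to be a stroke, and later
    sweeps correct the guess. *)
Definition limit_guess (M G : machine) (l : list nat) (n k : nat) : nat :=
  if fcell G (letters (jump_list M l n)) n k =? separator then separator else stroke.

Definition limit_action (M G : machine) (st : lstate) : nat :=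
  if snd (snd (snd st)) <? fst (snd (snd st))
  then limit_guess M G (fst (fst st)) (fst (snd st)) (snd (snd (snd st)))
  else 3.

Lemma comp_letters : comp letters.
Proof. unfold letters; comp. Qed.
#[export] Hint Resolve comp_letters : comp.

Lemma comp_limit_next : comp (fun p => limit_next (fst p) (snd p)).
Proof. unfold limit_next, sweep_next; comp. Qed.

Lemma comp_limit_action M G : comp (limit_action M G).
Proof.
  pose proof (comp_jump_bit M).
  unfold limit_action, limit_guess, jump_list; comp.
Qed.

Lemma limit_state u n :
  tr_state limit_next u ([], 0, (0, (0, 0))) n = (tr_state read_letter u ([], 0) n, (n, sweep n)).
Proof. induction n as [|n IH]; auto; simpl; now rewrite IH. Qed.

Lemma limit_guess_letter M G l n k :
  limit_guess M G l n k = stroke \/ limit_guess M G l n k = separator.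
Proof. unfold limit_guess; destruct (_ =? _); auto. Qed.

Lemma limit_output M G u n :
  let o := tr_output true limit_next (limit_action M G) u ([], 0, (0, (0, 0))) in
  let z := sweep n in
  pos (o n) = (if S (snd z) <=? fst z then S (snd z) else 2 * fst z - S (snd z)) /\
  forall k, cells (o (S n)) k =
    if (snd (sweep (S n)) <? fst (sweep (S n))) && (k =? snd (sweep (S n)))
    then limit_guess M G (fst (tr_state read_letter u ([], 0) (S n))) (S n) k
    else cells (o n) k.
Proof.
  intros o z.
  assert (P : forall n, o (S n) = out_step true (limit_action M G
    (tr_state read_letter u ([], 0) (S n), (S n, sweep (S n)))) (o n)).
  { intros m; rewrite <- limit_state; reflexivity. }
  (* On the way out the head is one beyond the cell just printed, on the way back it mirrors that,
     and each round ends in cell 0. The last conjunct is the purpose: the head stands where the next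
     letter belongs. *)
  assert (Q : forall m, pos (o m) =
    (if S (snd (sweep m)) <=? fst (sweep m) then S (snd (sweep m))
     else 2 * fst (sweep m) - S (snd (sweep m))) /\ pos (o m) <= 2 * fst (sweep m) /\
     (snd (sweep (S m)) < fst (sweep (S m)) -> pos (o m) = snd (sweep (S m)))).
  { intros m; induction m as [|m IH]; [simpl; auto|].
    rewrite P; unfold limit_action; cbn [fst snd].
    change (sweep (S (S m))) with (sweep_next (sweep (S m))).
    destruct IH as [I1 [I2 I3]].
    change (sweep (S m)) with (sweep_next (sweep m)) in *.
    destruct (sweep m) as [s d]; unfold sweep_next in *; cbn [fst snd] in *.
    destruct (limit_guess_letter M G (fst (tr_state read_letter u ([], 0) (S m))) (S m)
      (snd (if S d <? 2 * s then (s, S d) else (S s, 0)))) as [E|E];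
    destruct (Nat.ltb_spec (S d) (2 * s)); cbn [fst snd] in *;
    repeat match goal with
    | |- context [?a <? ?b] => destruct (Nat.ltb_spec a b); cbn [fst snd] in *
    | |- context [?a <=? ?b] => destruct (Nat.leb_spec a b); cbn [fst snd] in *
    | H : context [?a <=? ?b] |- _ => destruct (Nat.leb_spec a b); cbn [fst snd] in *
    end; try lia; rewrite ?E; cbn [out_step act pos shift_pos shift stroke separator]; lia. }
  destruct (Q n) as [Q1 [_ Q2]]; split; [exact Q1|]; intros k; rewrite P.
  unfold limit_action; cbn [fst snd]; destruct (Nat.ltb_spec (snd (sweep (S n))) (fst (sweep (S n)))).
  - specialize (Q2 H); rewrite <- Q2; cbn [andb].
    destruct (limit_guess_letter M G (fst (tr_state read_letter u ([], 0) (S n))) (S n)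
      (pos (o n))) as [E|E]; rewrite E; cbn [out_step act cells print stroke separator];
    destruct (Nat.eqb_spec k (pos (o n))) as [->|]; auto.
  - cbn [out_step andb]; now rewrite act_same.
Qed.

Lemma finite_uniform (P : nat -> nat -> Prop) t :
  (forall i, i < t -> exists n0, forall n, n0 <= n -> P i n) ->
  exists n0, forall n, n0 <= n -> forall i, i < t -> P i n.
Proof.
  induction t as [|t IH]; intros H; [exists 0; lia|].
  destruct IH as [n1 H1]; [intros; apply H; lia|]; destruct (H t) as [n2 H2]; auto.
  exists (n1 + n2); intros n L i Hi; destruct (Nat.eq_dec i t) as [->|].
  - apply H2; lia.
  - apply H1; lia.
Qed.

Lemma limit_guess_converges X M G p x r : approximates X M -> one_way G ->
  cauchy_rep X p x -> converges G (infinite_word (turing_jump X x)) r ->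
  forall k, exists n0, forall n, n0 <= n ->
    limit_guess M G (fst (tr_state read_letter (infinite_word p) ([], 0) n)) n k =
    infinite_word r k.
Proof.
  intros A O N C k; destruct (C k) as [t0 T]; set (q := turing_jump X x) in *.
  destruct (finite_uniform (fun i n =>
    (if jump_bit M (fst (tr_state read_letter (infinite_word p) ([], 0) n)) n i
     then 1 else 0) = q i) t0) as [n0 E].
  { intros i _; destruct (jump_bit_limit X M p x i A N) as [n0 E].
    destruct (reader_length p n0) as [n1 R]; exists (n0 + n1); intros n L.
    specialize (R n ltac:(lia)); destruct (reader_state p n) as [m [_ E']].
    rewrite E' in R |- *; simpl in R |- *; rewrite length_map, length_seq in R.
    apply E; lia. }
  exists (n0 + t0); intros n L; unfold limit_guess; rewrite fcell_run.
  set (l := jump_list M _ n).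
  assert (W : forall i, i < t0 -> word_of (letters l) i = infinite_word q i).
  { apply word_of_letters; unfold l, jump_list.
    - rewrite length_map, length_seq; lia.
    - intros i Hi.
      set (f := fun j => if jump_bit _ _ _ j then 1 else 0).
      rewrite (nth_indep _ 0 (f 0)), (map_nth f), seq_nth
        by (rewrite ?length_map, ?length_seq; lia).
      apply (E n); lia. }
  (* Both runs agree up to time [t0]. Afterwards the approximate input may mislead [G], but a
     one-way machine cannot revise the letter already printed. *)
  destruct (run_local G (word_of (letters l)) (infinite_word q) t0 W) as [_ [_ [I _]]].
  specialize (T t0 (le_n t0)); rewrite <- I in T.
  rewrite (one_way_keeps G _ t0 n k O); try lia; rewrite T.
  - destruct (infinite_word_letter r k) as [-> | ->]; reflexivity.
  - destruct (infinite_word_letter r k) as [-> | ->]; discriminate.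
Qed.

Lemma limit_machine X G : one_way G -> exists L, forall p x r, cauchy_rep X p x ->
  converges G (infinite_word (turing_jump X x)) r -> converges L (infinite_word p) r.
Proof.
  intros O; destruct (approximates_exists X) as [M A].
  destruct (transducer_machine true limit_next (limit_action M G) comp_limit_next
    (comp_limit_action M G)) as [D [_ [_ HD]]].
  exists (D ([], 0, (0, (0, 0)))); intros p x r N C k.
  destruct (HD ([], 0, (0, (0, 0))) (infinite_word p) (infinite_word_le p)) as [[_ HO] _].
  { intros n; rewrite limit_state; unfold limit_action; cbn [fst snd].
    destruct (_ <? _); [|easy].
    match goal with |- limit_guess ?a ?b ?c ?d ?e <> _ =>
      destruct (limit_guess_letter a b c d e) as [-> | ->]; discriminate end. }
  set (o := tr_output _ _ _ _ _) in HO.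
  destruct (limit_guess_converges X M G p x r A O N C k) as [n0 H].
  destruct (sweep_visits k (S n0)) as [n1 [s [L [Hs E]]]].
  destruct n1 as [|n1]; [lia|].
  assert (F : forall m, S n1 <= m -> cells (o m) k = infinite_word r k).
  { intros m Lm; induction Lm as [|m Lm IH].
    - unfold o; rewrite (proj2 (limit_output M G (infinite_word p) n1)), E; simpl.
      rewrite (proj2 (Nat.ltb_lt k s) Hs), Nat.eqb_refl; apply (H (S n1)); lia.
    - unfold o; rewrite (proj2 (limit_output M G (infinite_word p) m)).
      destruct (_ && _); [|exact IH]; apply (H (S m)); lia. }
  destruct (HO (S n1)) as [t0 T]; exists t0; intros t Lt.
  destruct (T t Lt) as [m [Lm ->]]; auto.
Qed.

(** * Names with a computable limit *)

(* A sequence whose finite prefixes all satisfy this is a name of [x]; unlike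
   the conditions defining a name, each of these is an open condition on [x]. *)
Definition tight (X : computable_metric_space) (x : Base X) (l : list nat) : Prop :=
  forall m, m < length l -> (dist X x (point X (nth m l 0%nat)) < / 2 ^ S m)%R.

Definition is_prefix (l l' : list nat) : bool :=
  (length l <=? length l') && forallb (fun i => nth i l 0 =? nth i l' 0) (seq 0 (length l)).

Lemma is_prefix_spec l l' : is_prefix l l' = true <->
  length l <= length l' /\ forall i, i < length l -> nth i l 0 = nth i l' 0.
Proof.
  unfold is_prefix; rewrite Bool.andb_true_iff, Nat.leb_le, forallb_forall.
  split; intros [H1 H2]; split; auto; intros i Hi.
  - apply Nat.eqb_eq, H2, in_seq; lia.
  - apply Nat.eqb_eq, H2; apply in_seq in Hi; lia.
Qed.

(** In [length l] steps the machine reads fewer letters than [letters l] provides, since every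
    number contributes one at least; so this is the true run on any infinite extension of [l]. *)
Definition cell_after (M : machine) (l : list nat) (k : nat) : nat :=
  fcell M (letters l) (length l) k.

Definition changes (M : machine) (k : nat) (l l' : list nat) : bool :=
  is_prefix l l' && negb (cell_after M l' k =? cell_after M l k).

(* With the flag [true] the question is only whether [l] is tight for [x]. *)
Definition query_test (M : machine) (e : bool * (nat * list nat)) (l : list nat) : bool :=
  is_prefix (snd (snd e)) l && (fst e || changes M (fst (snd e)) (snd (snd e)) l).

(** Distance of the centre from each entry plus the radius is below the tightness bound: then [l] is
    tight for all points of the ball. *)
Definition ball_test (M : machine) (n : nat) (l : list nat) (k t : nat) : bool :=
  forallb (fun m => dist_lt M (fst (of_nat n)) (nth m l 0) k t
                      (frat (snd (of_nat n))) (fpow (S m))) (seq 0 (length l)).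

Definition witness_test (Md M : machine) (e : bool * (nat * list nat)) (n s : nat) : bool :=
  query_test M e (nat_list (fst (of_nat s))) &&
  ball_test Md n (nat_list (fst (of_nat s)))
    (fst (of_nat (snd (of_nat s)))) (snd (of_nat (snd (of_nat s)))).

Notation qstate := ((bool * (nat * list nat)) * (nat * nat))%type.

(** Strokes are counted to obtain [n]; every blank after them advances the candidate witness, so the
    blank rest of the tape drives an unbounded search. *)
Definition query_next (st : qstate) (a : nat) : qstate :=
  if a =? stroke then (fst st, (S (fst (snd st)), snd (snd st)))
  else (fst st, (fst (snd st), S (snd (snd st)))).

Definition query_action (Md M : machine) (st : qstate) : nat :=
  match snd (snd st) with
  | 0 => 0
  | S s => if witness_test Md M (fst st) (fst (snd st)) s then 4 else 0
  end.

Lemma comp_is_prefix : comp (fun p => is_prefix (fst p) (snd p)).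
Proof. unfold is_prefix; comp. Qed.
#[export] Hint Resolve comp_is_prefix : comp.

Lemma comp_cell_after M : comp (fun p => cell_after M (fst p) (snd p)).
Proof. unfold cell_after; comp. Qed.
#[export] Hint Resolve comp_cell_after : comp.

Lemma comp_changes M : comp (fun p => changes M (fst p) (fst (snd p)) (snd (snd p))).
Proof. unfold changes; comp. Qed.
#[export] Hint Resolve comp_changes : comp.

Lemma comp_query_test M : comp (fun p => query_test M (fst p) (snd p)).
Proof. unfold query_test; comp. Qed.
#[export] Hint Resolve comp_query_test : comp.

Lemma comp_query_next : comp (fun p => query_next (fst p) (snd p)).
Proof. unfold query_next; comp. Qed.

Lemma comp_query_action Md M : comp (query_action Md M).
Proof. unfold query_action, witness_test, ball_test; comp; apply comp_dist_lt; comp. Qed.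

Lemma query_state e n m : tr_state query_next (finite_word n) (e, (0, 0)) m =
  if m <=? n then (e, (m, 0)) else (e, (n, m - n)).
Proof.
  induction m as [|m IH]; auto; cbn [tr_state]; rewrite IH; unfold query_next, finite_word.
  destruct (Nat.ltb_spec m n), (Nat.leb_spec m n), (Nat.leb_spec (S m) n); try lia;
    cbn [fst snd stroke blank Nat.eqb]; auto.
  - replace m with n by lia; f_equal; f_equal; lia.
  - f_equal; f_equal; lia.
Qed.

Lemma query_machine Md M : exists index : bool * (nat * list nat) -> nat, comp index /\
  forall e n, W (index e) n <-> exists s, witness_test Md M e n s = true.
Proof.
  destruct (transducer_machine false query_next (query_action Md M) comp_query_next
    (comp_query_action Md M)) as [D [CD [_ HD]]].
  exists (fun e => code_machine (D (e, (0, 0)))); split.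
  { apply (comp_comp (fun s => code_machine (D s)) (fun e => (e, (0, 0)))); auto; comp. }
  intros e n.
  assert (L : forall k, finite_word n k <= 2)
    by (intros k; unfold finite_word, stroke, blank; destruct (_ <? _); lia).
  destruct (HD (e, (0, 0)) (finite_word n) L) as [H1 H2].
  assert (A : forall m, query_action Md M (tr_state query_next (finite_word n) (e, (0, 0)) (1 + m)) = 4
     <-> n <= m /\ witness_test Md M e n (m - n) = true).
  { intros m; rewrite query_state; unfold query_action.
    destruct (Nat.leb_spec (1 + m) n); cbn [fst snd]; [split; [easy|lia]|].
    replace (1 + m - n) with (S (m - n)) by lia.
    destruct (witness_test _ _ _ _ _); split; try easy; intros _; split; auto; lia. }
  split.
  - intros [N [E [t H]]]; apply code_machine_inj in E; subst N.
    destruct (excluded_middle_informative (exists s, witness_test Md M e n s = true))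
      as [|NE]; auto; exfalso; destruct H1 as [H1 _]; [|now apply (H1 t)].
    intros m Hm; apply A in Hm as [_ Hm]; apply NE; eauto.
  - intros [s Hs]; exists (D (e, (0, 0))); split; auto; apply H2.
    exists (n + s); apply A; split; [lia|]; now replace (n + s - n) with s by lia.
Qed.

Lemma rational_inv_pow2 j : rational (cpair (cpair 1 0) (pred (2 ^ j))) = (/ 2 ^ j)%R.
Proof.
  rewrite <- fval_rat, <- fval_pow; unfold frat; rewrite fst_cpair, snd_cpair.
  pose proof (pow2_pos j); unfold cpair; rewrite cancel_of_to.
  now replace (S (pred (2 ^ j))) with (2 ^ j) by lia.
Qed.

Lemma ball_test_sound X Md n l k t x : approximates X Md ->
  ball_test Md n l k t = true -> ball X n x -> tight X x l.
Proof.
  intros A T B m Hm; apply ball_eq in B.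
  unfold ball_test in T; rewrite forallb_forall in T.
  specialize (T m ltac:(apply in_seq; lia)); apply (dist_lt_sound X) in T; auto;
    [|simpl; lia|apply pow2_pos].
  rewrite fval_rat, fval_pow in T.
  pose proof (dist_tri X x (point X (nth m l 0)) (point X (fst (of_nat n)))); lra.
Qed.

Lemma ball_test_complete X Md x l : approximates X Md -> tight X x l ->
  exists n k t, ball X n x /\ ball_test Md n l k t = true.
Proof.
  intros A T.
  (* The slack of each strict inequality must exceed 2^-j twice: for the distance from the centre to
     [x] and for the radius. *)
  destruct (finite_uniform (fun m j =>
    (2 * / 2 ^ j < / 2 ^ S m - dist X x (point X (nth m l 0%nat)))%R) (length l)) as [j J].
  { intros m Hm; specialize (T m Hm).
    destruct (inv_pow2_small ((/ 2 ^ S m - dist X x (point X (nth m l 0%nat))) / 2)) as [j J];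
      [lra|]; exists j; intros i Hi; specialize (J i Hi); lra. }
  specialize (J j (le_n j)).
  destruct (point_dense X x (/ 2 ^ j)%R (inv_pow2_pos j)) as [c Hc].
  set (rc := cpair (cpair 1 0) (pred (2 ^ j))).
  destruct (finite_uniform (fun m k => exists t0, forall t, t0 <= t ->
    dist_lt Md c (nth m l 0) k t (frat rc) (fpow (S m)) = true) (length l)) as [k K].
  { intros m Hm; apply (dist_lt_complete X); auto; [simpl; lia|apply pow2_pos|].
    unfold rc; rewrite fval_rat, fval_pow, rational_inv_pow2; specialize (J m Hm).
    pose proof (dist_tri X (point X c) (point X (nth m l 0)) x); lra. }
  destruct (finite_uniform (fun m t =>
    dist_lt Md c (nth m l 0) k t (frat rc) (fpow (S m)) = true) (length l)) as [t H].
  { intros m Hm; exact (K k (le_n k) m Hm). }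
  exists (cpair c rc), k, t; split.
  - apply ball_eq; rewrite fst_cpair, snd_cpair; unfold rc; rewrite rational_inv_pow2.
    now rewrite dist_sym.
  - unfold ball_test; rewrite fst_cpair, snd_cpair; apply forallb_forall; intros m Hm.
    apply in_seq in Hm; apply (H t); lia.
Qed.

(** The points with a tight list that passes the test form a union of balls listed by a machine, so
    the question is one bit of the jump. Its position is computed from the question alone, for all
    [x] at once. *)
Lemma query_index X M : exists index : bool * (nat * list nat) -> nat, comp index /\
  forall e x, turing_jump X x (index e) = 1 /\ (exists l, query_test M e l = true /\ tight X x l) \/
    turing_jump X x (index e) = 0 /\ ~ (exists l, query_test M e l = true /\ tight X x l).
Proof.
  destruct (approximates_exists X) as [Md A], (query_machine Md M) as [index [C H]].
  exists index; split; auto; intros e x.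
  assert (E : U X (index e) x <-> exists l, query_test M e l = true /\ tight X x l).
  { split.
    - intros [n [Hn B]]; apply H in Hn as [s Hs]; apply Bool.andb_true_iff in Hs as [H1 H2].
      eexists; split; [exact H1|]; now apply (ball_test_sound X Md n _ _ _ x A H2).
    - intros [l [Hl T]]; destruct (ball_test_complete X Md x l A T) as [n [k [t [B Ht]]]].
      exists n; split; auto; apply H; exists (cpair (enc l) (cpair k t)).
      unfold witness_test; rewrite !snd_cpair, !fst_cpair, nat_list_enc, Hl; exact Ht. }
  unfold turing_jump; destruct (excluded_middle_informative _) as [Y|Y];
    [left|right]; split; auto; now rewrite <- E.
Qed.

(** (k, (l, m)): the cell to be settled, the list reached so far, and the code of the next list to
    be tried as an extension. [sstate] adds the reader's state and the letter to print. *)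
Notation search := (nat * (list nat * nat))%type.
Notation sstate := ((list nat * nat) * (search * nat))%type.

Definition fix_letter (a : nat) : nat := if a =? separator then separator else stroke.

(* [q] is the known prefix of the oracle; the result is the next state of the
   search and the letter to print, 0 standing for none; [None] asks for more of
   the oracle. *)
Definition search_next (index : bool * (nat * list nat) -> nat) (M : machine)
    (q : list nat) (s : search) : option (search * nat) :=
  let k := fst s in let l := fst (snd s) in let m := snd (snd s) in
  if index (false, (k, l)) <? length q then
    if nth (index (false, (k, l))) q 0 =? 0
    then Some ((S k, (l, 0)), fix_letter (cell_after M l k))
    (* The jump has promised a suitable extension, so trying all codes ends. Whether a given list
       changes the cell is decided directly; whether it is tight is asked of the jump. *)
    else if changes M k l (nat_list m) then
      if index (true, (k, nat_list m)) <? length q then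
        if nth (index (true, (k, nat_list m))) q 0 =? 0
        then Some ((k, (l, S m)), 0) else Some ((k, (nat_list m, 0)), 0)
      else None
    else Some ((k, (l, S m)), 0)
  else None.

Definition oracle_next index (M : machine) (st : sstate) (a : nat) : sstate :=
  let r := read_letter (fst st) a in
  (r, match search_next index M (fst r) (fst (snd st)) with
      | Some z => z
      | None => (fst (snd st), 0)
      end).

Definition oracle_action (st : sstate) : nat := snd (snd st).

Lemma comp_oracle_next index M : comp index ->
  comp (fun p => oracle_next index M (fst p) (snd p)).
Proof.
  intros C; unfold oracle_next, search_next, fix_letter; cbv zeta; pose proof (comp_changes M).
  pose proof (comp_cell_after M); comp.
Qed.

(** The moves of the search in terms of what is true of [x], without the oracle. [step_skip] keeps
    the existence of a suitable [l'] as a premise. *)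
Inductive search_step (X : computable_metric_space) M (x : Base X) : search -> search -> nat -> Prop :=
| step_emit k l m : (forall l', tight X x l' -> changes M k l l' = false) ->
    search_step X M x (k, (l, m)) (S k, (l, 0)) (fix_letter (cell_after M l k))
| step_extend k l l' m : tight X x l' -> changes M k l l' = true ->
    search_step X M x (k, (l, m)) (k, (l', 0)) 0
| step_skip k l l' m : tight X x l' -> changes M k l l' = true ->
    ~ (tight X x (nat_list m) /\ changes M k l (nat_list m) = true) ->
    search_step X M x (k, (l, m)) (k, (l, S m)) 0.

Lemma tight_prefix X x l l' : is_prefix l l' = true -> tight X x l' -> tight X x l.
Proof.
  intros P T m Hm; apply is_prefix_spec in P as [P1 P2]; rewrite P2 by auto; apply T; lia.
Qed.

Lemma is_prefix_refl l : is_prefix l l = true.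
Proof. apply is_prefix_spec; auto. Qed.

Lemma is_prefix_trans l1 l2 l3 :
  is_prefix l1 l2 = true -> is_prefix l2 l3 = true -> is_prefix l1 l3 = true.
Proof.
  rewrite !is_prefix_spec; intros [H1 H2] [H3 H4]; split; [lia|].
  intros i Hi; rewrite H2 by auto; apply H4; lia.
Qed.

Lemma changes_prefix M k l l' : changes M k l l' = true -> is_prefix l l' = true.
Proof. unfold changes; now intros H%Bool.andb_true_iff. Qed.

Lemma changes_cell M k l l' : changes M k l l' = true -> cell_after M l' k <> cell_after M l k.
Proof.
  unfold changes; intros H%Bool.andb_true_iff; destruct H as [_ H].
  now apply Bool.negb_true_iff, Nat.eqb_neq in H.
Qed.

(** A prefix of equal length is the list itself and leaves the cell as it is. *)
Lemma changes_length M k l l' : changes M k l l' = true -> length l < length l'.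
Proof.
  intros H; pose proof (changes_cell _ _ _ _ H) as N.
  apply changes_prefix, is_prefix_spec in H as [H1 H2].
  destruct (Nat.eq_dec (length l) (length l')) as [E|]; [|lia].
  rewrite (nth_ext l l' 0 0 E H2) in N; easy.
Qed.

Lemma search_next_spec (X : computable_metric_space) M index (x : Base X) :
  (forall e, turing_jump X x (index e) = 1 /\
               (exists l, query_test M e l = true /\ tight X x l) \/
             turing_jump X x (index e) = 0 /\
               ~ (exists l, query_test M e l = true /\ tight X x l)) ->
  forall s, exists n0, forall n,
    (forall z, search_next index M (map (turing_jump X x) (seq 0 n)) s = Some z ->
      search_step X M x s (fst z) (snd z)) /\
    (n0 <= n -> search_next index M (map (turing_jump X x) (seq 0 n)) s <> None).
Proof.
  intros H [k [l m]].
  set (i := index (false, (k, l))); set (j := index (true, (k, nat_list m))).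
  assert (A : turing_jump X x i = 1 /\ (exists l', tight X x l' /\ changes M k l l' = true) \/
    turing_jump X x i = 0 /\ forall l', tight X x l' -> changes M k l l' = false).
  { destruct (H (false, (k, l))) as [[H1 [l' [H2 H3]]]|[H1 H2]]; [left|right]; split; auto.
    - apply Bool.andb_true_iff in H2 as [_ H2]; eauto.
    - intros l' T; destruct (changes M k l l') eqn:E; auto; destruct H2; exists l'; split; auto.
      unfold query_test; cbn [fst snd]; rewrite E; cbn [orb].
      now rewrite (changes_prefix _ _ _ _ E). }
  (* The question asks for a tight list extending [nat_list m]; prefixes of tight lists are tight,
     so this amounts to tightness of [nat_list m] itself. *)
  assert (B : turing_jump X x j = 1 /\ tight X x (nat_list m) \/
    turing_jump X x j = 0 /\ ~ tight X x (nat_list m)).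
  { destruct (H (true, (k, nat_list m))) as [[H1 [l' [H2 H3]]]|[H1 H2]]; [left|right]; split; auto.
    - apply Bool.andb_true_iff in H2 as [H2 _]; now apply (tight_prefix X x _ l').
    - intros T; apply H2; exists (nat_list m); split; auto.
      unfold query_test; cbn [fst snd]; now rewrite is_prefix_refl. }
  (* A prefix of this length contains both bits that may be consulted. *)
  exists (S (i + j)); intros n; unfold search_next; cbn [fst snd]; fold i j.
  rewrite length_map, length_seq.
  assert (N : forall c, c < n -> nth c (map (turing_jump X x) (seq 0 n)) 0 = turing_jump X x c).
  { intros c Hc; rewrite (nth_indep _ 0 (turing_jump X x 0)), map_nth, seq_nth
      by (rewrite ?length_map, ?length_seq; lia); auto. }
  destruct (Nat.ltb_spec i n) as [Li|Li]; [rewrite N by auto|split; [easy|lia]].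
  destruct A as [[-> [l' [T1 T2]]]|[-> A]]; cbn [Nat.eqb].
  2: { split; [|easy]; intros z E; injection E as <-; now constructor. }
  destruct (changes M k l (nat_list m)) eqn:E.
  2: { split; [|easy]; intros z Z; injection Z as <-; apply step_skip with l'; auto.
       now rewrite E. }
  destruct (Nat.ltb_spec j n) as [Lj|Lj]; [rewrite N by auto|split; [easy|lia]].
  destruct B as [[-> B]|[-> B]]; cbn [Nat.eqb]; (split; [|easy]); intros z Z; injection Z as <-.
  - now apply step_extend.
  - apply step_skip with l'; auto; now intros [].
Qed.

(** For k at most n, the bounds 2^-(n+1) and 2^-(k+1) add up to at most 2^-k. *)
Lemma tight_name (X : computable_metric_space) (x : Base X) p :
  (forall m, (dist X x (point X (p m)) < / 2 ^ S m)%R) -> cauchy_rep X p x.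
Proof.
  intros T; split.
  - intros k n L; pose proof (T k) as Tk; pose proof (T n) as Tn.
    pose proof (inv_pow2_mono (S k) (S n) ltac:(lia)) as Mo; rewrite (inv_pow2_S k) in *.
    pose proof (dist_tri X (point X (p n)) (point X (p k)) x) as D.
    rewrite (dist_sym X (point X (p n)) x) in D; lra.
  - intros eps He; destruct (inv_pow2_small eps He) as [N HN]; exists N; intros n L.
    unfold Rdist; rewrite Rminus_0_r, dist_sym, Rabs_pos_eq by (apply Rge_le, dist_pos).
    apply Rlt_trans with (/ 2 ^ S n)%R; auto; apply HN; lia.
Qed.

Lemma fix_letter_cases a : fix_letter a = stroke \/ fix_letter a = separator.
Proof. unfold fix_letter; destruct (_ =? _); auto. Qed.

Lemma search_step_letter (X : computable_metric_space) M (x : Base X) s s' a :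
  search_step X M x s s' a -> a <> 4.
Proof.
  intros [k l m A|k l l' m T A|k l l' m T A A']; try easy.
  destruct (fix_letter_cases (cell_after M l k)) as [-> | ->]; easy.
Qed.

Section Search.

Context (X : computable_metric_space) (M : machine) (x : Base X).
Context (core : nat -> search) (letter : nat -> nat) (o : nat -> tape).

Hypothesis core_0 : core 0 = (0, ([], 0)).
(** The search idles while the known prefix of the jump is too short; the next hypothesis says that
    every such wait ends. *)
Hypothesis core_S : forall n, core (S n) = core n /\ letter (S n) = 0 \/
  search_step X M x (core n) (core (S n)) (letter (S n)).
Hypothesis core_moves : forall n, exists n', n <= n' /\ core n' = core n /\
  search_step X M x (core n') (core (S n')) (letter (S n')).
Hypothesis out_0 : o 0 = blank_tape.
Hypothesis out_S : forall n, o (S n) = out_step false (letter (S n)) (o n).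

Let count n := fst (core n).
Let stem n := fst (snd (core n)).
Let cursor n := snd (snd (core n)).

Lemma stem_mono n n' : n <= n' -> is_prefix (stem n) (stem n') = true.
Proof.
  induction 1 as [|n' L IH]; [apply is_prefix_refl|].
  apply is_prefix_trans with (stem n'); auto; unfold stem.
  destruct (core_S n') as [[-> _]|S']; [apply is_prefix_refl|].
  inversion S'; subst; cbn [fst snd]; try apply is_prefix_refl.
  eapply changes_prefix; eassumption.
Qed.

Lemma count_mono n n' : n <= n' -> count n <= count n'.
Proof.
  induction 1 as [|n' L IH]; auto; apply (Nat.le_trans _ _ _ IH); unfold count.
  destruct (core_S n') as [[-> _]|S']; auto; inversion S'; subst; cbn [fst snd]; lia.
Qed.

Lemma stem_tight n : tight X x (stem n).
Proof.
  induction n as [|n IH]; unfold stem in *.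
  - rewrite core_0; intros m Hm; simpl in Hm; lia.
  - destruct (core_S n) as [[-> _]|S']; auto.
    inversion S' as [k l m A B C|k l l' m T A B C|k l l' m T A A' B C];
      rewrite <- B in IH; cbn [fst snd] in *; auto.
Qed.

(** Skipping a code records its failure for the current cell and stem, and the cursor restarts at 0
    whenever one of these changes. *)
Lemma cursor_fresh n m : m < cursor n ->
  ~ (tight X x (nat_list m) /\ changes M (count n) (stem n) (nat_list m) = true).
Proof.
  revert m; induction n as [|n IH]; intros m; unfold cursor, count, stem in *;
    [rewrite core_0; simpl; lia|].
  destruct (core_S n) as [[-> _]|S']; auto.
  inversion S' as [k l m' A B C|k l l' m' T A B C|k l l' m' T A A' B C];
    rewrite <- B in IH; cbn [fst snd] in *; try lia.
  intros L; destruct (Nat.eq_dec m m') as [->|]; auto; apply IH; lia.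
Qed.

Lemma search_progress n : exists n', n <= n' /\ core (S n') <> core n' /\
  count n' = count n /\ stem n' = stem n /\
  (count (S n') = S (count n) \/
   count (S n') = count n /\ changes M (count n) (stem n) (stem (S n')) = true).
Proof.
  (* Induction on the distance from the cursor to the code of a suitable list: each skip shortens
     it, and by [cursor_fresh] the cursor cannot pass that code. Meeting another suitable list
     earlier is progress as well. *)
  assert (A : forall d n, (exists l, tight X x l /\ changes M (count n) (stem n) l = true /\
    enc l < d + cursor n) -> exists n', n <= n' /\ core (S n') <> core n' /\
  count n' = count n /\ stem n' = stem n /\
  (count (S n') = S (count n) \/
   count (S n') = count n /\ changes M (count n) (stem n) (stem (S n')) = true)).
  { clear n; induction d as [|d IH]; intros n [l [T [C L]]].
    - exfalso; apply (cursor_fresh n (enc l) L); now rewrite nat_list_enc.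
    - destruct (core_moves n) as [n' [Ln [E S']]].
      unfold cursor, count, stem in *; rewrite <- E in *.
      inversion S' as [k t m A B F G|k t t' m T' A B F G|k t t' m T' A A' B F G];
        rewrite <- B in *; cbn [fst snd] in *.
      + rewrite A in C by auto; discriminate.
      + exists n'; rewrite <- F, <- B; cbn [fst snd]; repeat split; auto.
        intros Z; injection Z as Z _; apply changes_length in A; subst; lia.
      + destruct (IH (S n')) as [n2 [L2 [N2 [C2 [S2 H2]]]]].
        { exists l; rewrite <- F; cbn [fst snd]; repeat split; auto; lia. }
        exists n2; rewrite <- F in *; cbn [fst snd] in *; repeat split; auto; lia. }
  destruct (excluded_middle_informative (exists l, tight X x l /\
    changes M (count n) (stem n) l = true)) as [[l [T C]]|N].
  - apply (A (S (enc l)) n); exists l; repeat split; auto; lia.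
  - destruct (core_moves n) as [n' [Ln [E S']]].
    unfold cursor, count, stem in *; rewrite <- E in *.
    inversion S' as [k t m B B' F G|k t t' m T' B B' F G|k t t' m T' B A' B' F G];
      rewrite <- B' in *; cbn [fst snd] in *; try (destruct N; eauto; fail).
    exists n'; rewrite <- F, <- B'; cbn [fst snd]; repeat split; auto.
    intros Z; injection Z; lia.
Qed.

(** A letter is printed only when no tight extension of the stem changes its cell. Later stems
    extend that one, so the letter stays correct for all their tight extensions. *)
Lemma search_output n : pos (o n) = count n /\ forall j l, j < count n -> tight X x l ->
  is_prefix (stem n) l = true -> cells (o n) j = fix_letter (cell_after M l j).
Proof.
  induction n as [|n [IH1 IH2]]; unfold count, stem in *.
  - rewrite out_0, core_0; split; auto; simpl; lia.
  - rewrite out_S.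
    destruct (core_S n) as [[-> ->]|S']; [now split|].
    inversion S' as [k l m A B F G|k l l' m T A B F G|k l l' m T A A' B F G];
      rewrite <- B in *; cbn [fst snd out_step] in *; auto.
    + set (a := fix_letter (cell_after M l k)).
      assert (E : out_step false a (o n) = act (Action (scanned (o n)) a Right) (o n))
        by (unfold a; destruct (fix_letter_cases (cell_after M l k)) as [-> | ->]; auto).
      rewrite E; cbn [pos cells act shift print shift_pos]; rewrite IH1; split; auto.
      intros j l' Hj T P; destruct (Nat.eqb_spec j k) as [->|]; [|apply IH2; auto; lia].
      unfold a; f_equal; specialize (A l' T); unfold changes in A; rewrite P in A.
      cbn [andb] in A; apply Bool.negb_false_iff, Nat.eqb_eq in A; auto.
    + split; auto; intros j l2 Hj T2 P; apply IH2; auto.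
      apply is_prefix_trans with l'; auto; eapply changes_prefix; eassumption.
Qed.

(** The stems may stop growing; positions that no stem reaches are then filled with any sufficiently
    close point of the dense sequence, chosen classically. *)
Lemma stem_limit : exists p, (forall m, (dist X x (point X (p m)) < / 2 ^ S m)%R) /\
  forall n i, i < length (stem n) -> nth i (stem n) 0 = p i.
Proof.
  assert (A : forall m, exists c, (dist X x (point X c) < / 2 ^ S m)%R /\
    forall n, m < length (stem n) -> nth m (stem n) 0 = c).
  { intros m; destruct (excluded_middle_informative (exists n, m < length (stem n))) as [[n L]|N].
    - exists (nth m (stem n) 0); split; [now apply stem_tight|]; intros n' L'.
      destruct (Nat.le_ge_cases n n') as [C|C];
        pose proof (stem_mono _ _ C) as P; apply is_prefix_spec in P as [_ P].
      + now rewrite P.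
      + now rewrite P.
    - destruct (point_dense X x (/ 2 ^ S m)%R (inv_pow2_pos _)) as [c Hc].
      exists c; split; [now rewrite dist_sym|]; intros n L; destruct N; eauto. }
  set (f := fun m => constructive_indefinite_description _ (A m)).
  exists (fun m => proj1_sig (f m)); split.
  - intros m; apply (proj2_sig (f m)).
  - intros n i; apply (proj2_sig (f i)).
Qed.

(* If [M] converges on the limit of the stems, no cell can change forever. *)
Lemma search_converges : exists p, cauchy_rep X p x /\ forall r,
  converges M (infinite_word p) r ->
  forall j, exists n0, forall n, n0 <= n -> cells (o n) j = infinite_word r j.
Proof.
  destruct stem_limit as [p [T S']]; exists p; split; [now apply tight_name|]; intros r C.
  set (front := fun n => map p (seq 0 n)).
  assert (Fl : forall n, length (front n) = n)
    by (intros; unfold front; now rewrite length_map, length_seq).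
  assert (Fn : forall n i, i < n -> nth i (front n) 0 = p i).
  { intros n i L; unfold front.
    rewrite (nth_indep _ 0 (p 0)), map_nth, seq_nth
      by (rewrite ?length_map, ?length_seq; lia); auto. }
  assert (Ft : forall n, tight X x (front n)).
  { intros n m Hm; rewrite Fl in Hm; rewrite Fn by auto; apply T. }
  assert (Fs : forall n, stem n = front (length (stem n))).
  { intros n; apply nth_ext with 0 0; [now rewrite Fl|].
    intros i L; rewrite Fn by auto; now apply S'. }
  assert (Fp : forall n n', n <= n' -> is_prefix (front n) (front n') = true).
  { intros n n' L; apply is_prefix_spec; rewrite !Fl; split; auto.
    intros i Hi; rewrite !Fn by lia; auto. }
  assert (V : forall j, exists n0, forall n, n0 <= n -> cell_after M (front n) j = infinite_word r j).
  { intros j; destruct (C j) as [t0 Ht]; exists t0; intros n L.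
    unfold cell_after; rewrite fcell_run, Fl, <- (Ht n L).
    destruct (run_local M (word_of (letters (front n))) (infinite_word p) n) as [_ [_ [-> _]]]; auto.
    apply word_of_letters; [now rewrite Fl|auto]. }
  (* If cell [K] were never settled, it would change along ever longer stems; but stems are prefixes
     of [p], and on long prefixes the cell already has its final letter. *)
  assert (G : forall K, exists n, K <= count n).
  { induction K as [|K [n IH]]; [exists 0; lia|].
    destruct (excluded_middle_informative (exists n', S K <= count n')) as [|N]; auto; exfalso.
    assert (EK : forall n', n <= n' -> count n' = K).
    { intros n' L; pose proof (count_mono n n' L).
      destruct (Nat.le_gt_cases (S K) (count n')); [destruct N; eauto|lia]. }
    assert (P : forall n', n <= n' -> exists n2, n' <= n2 /\
      changes M K (stem n') (stem n2) = true).
    { intros n' L; destruct (search_progress n') as [n2 [L2 [_ [_ [_ H]]]]].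
      rewrite (EK n' L), (EK (S n2)) in H by lia; destruct H as [H|[_ H]]; [lia|].
      exists (S n2); split; auto. }
    assert (Q : forall t, exists n', n <= n' /\ t <= length (stem n')).
    { induction t as [|t [n' [L Ht]]]; [exists n; split; auto; lia|].
      destruct (P n' L) as [n2 [L2 H2]]; apply changes_length in H2.
      exists n2; split; lia. }
    destruct (V K) as [t0 Ht0], (Q t0) as [n' [L Ht]], (P n' L) as [n2 [L2 H2]].
    pose proof (changes_length _ _ _ _ H2) as H3; apply changes_cell in H2.
    rewrite (Fs n'), (Fs n2), !Ht0 in H2 by lia; easy. }
  intros j; destruct (G (S j)) as [n0 Hn], (V j) as [t0 Ht]; exists n0; intros n L.
  pose proof (count_mono n0 n L).
  destruct (search_output n) as [_ O].
  (* A prefix of [p] long enough to extend the stem and to show the final letter of cell [j]. *)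
  rewrite (O j (front (length (stem n) + t0))); auto;
    [|lia|rewrite (Fs n) at 1; apply Fp; lia].
  rewrite Ht by lia; destruct (infinite_word_letter r j) as [-> | ->]; reflexivity.
Qed.

End Search.

Lemma oracle_machine X M : exists K, one_way K /\ forall x, exists p, cauchy_rep X p x /\
  forall r, converges M (infinite_word p) r ->
            converges K (infinite_word (turing_jump X x)) r.
Proof.
  destruct (query_index X M) as [index [Ci Hi]].
  destruct (transducer_machine false (oracle_next index M) oracle_action
    (comp_oracle_next index M Ci)) as [D [_ [OW HD]]]; [unfold oracle_action; comp|].
  set (s0 := (([], 0), ((0, ([], 0)), 0)) : sstate).
  exists (D s0); split; [now apply OW|]; intros x.
  set (u := infinite_word (turing_jump X x)).
  set (st := tr_state (oracle_next index M) u s0).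
  set (o := tr_output false (oracle_next index M) oracle_action u s0).
  assert (R : forall n, fst (st n) = tr_state read_letter u ([], 0) n).
  { induction n as [|n IH]; auto; unfold st in *; cbn [tr_state]; now rewrite <- IH. }
  assert (N : forall n, snd (st (S n)) =
    match search_next index M (fst (tr_state read_letter u ([], 0) (S n))) (fst (snd (st n))) with
    | Some z => z | None => (fst (snd (st n)), 0) end).
  { intros n; rewrite <- R; reflexivity. }
  assert (Sp := search_next_spec X M index x (fun e => Hi e x)).
  assert (CS : forall n, fst (snd (st (S n))) = fst (snd (st n)) /\ snd (snd (st (S n))) = 0 \/
    search_step X M x (fst (snd (st n))) (fst (snd (st (S n)))) (snd (snd (st (S n))))).
  { intros n; rewrite N; destruct (search_next _ _ _ _) as [z|] eqn:E; [right|now left].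
    destruct (reader_state (turing_jump X x) (S n)) as [m [_ E']]; unfold u in E.
    rewrite E' in E; destruct (Sp (fst (snd (st n)))) as [n0 H].
    now apply (proj1 (H m) z). }
  destruct (search_converges X M x (fun n => fst (snd (st n))) (fun n => snd (snd (st n))) o)
    as [p [Np Hp]]; auto.
  { intros n; destruct (Sp (fst (snd (st n)))) as [n0 H].
    destruct (reader_length (turing_jump X x) n0) as [n1 L1].
    (* Either a proper step occurs among the next inputs or the search state is still unchanged when
       the known prefix of the jump has become long enough to force one. *)
    assert (A : forall d, (exists n', n <= n' /\ fst (snd (st n')) = fst (snd (st n)) /\
      search_step X M x (fst (snd (st n'))) (fst (snd (st (S n')))) (snd (snd (st (S n'))))) \/
      fst (snd (st (n + d))) = fst (snd (st n))).
    { induction d as [|d [IH|IH]]; [right; now rewrite Nat.add_0_r|now left|].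
      destruct (CS (n + d)) as [[E _]|S'].
      - right; rewrite Nat.add_succ_r; congruence.
      - left; exists (n + d); split; [lia|now split]. }
    destruct (A n1) as [Y|E]; auto.
    exists (n + n1); split; [lia|]; split; auto.
    specialize (L1 (S (n + n1)) ltac:(lia)); specialize (N (n + n1)).
    destruct (reader_state (turing_jump X x) (S (n + n1))) as [m [_ E']].
    fold u in L1, E'; rewrite E' in L1, N; cbn [fst] in L1, N.
    rewrite length_map, length_seq in L1; rewrite E in N |- *.
    destruct (search_next _ _ _ _) as [z|] eqn:F; [|now apply (H m) in F].
    rewrite N; now apply (H m). }
  exists p; split; auto; intros r C j.
  destruct (Hp r C j) as [n0 H].
  destruct (HD s0 u (infinite_word_le _)) as [[_ HO] _].
  { intros n; unfold oracle_action; fold st.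
    destruct (CS n) as [[_ E]|S']; cbn [Nat.add]; [rewrite E; easy|].
    now apply (search_step_letter X M x _ _ _ S'). }
  destruct (HO n0) as [t0 Ht]; exists t0; intros t Lt.
  destruct (Ht t Lt) as [m [Lm ->]]; fold o; auto.
Qed.

(** * Assembling the equivalence *)

Lemma converges_unique M u r r' : converges M u r -> converges M u r' -> r = r'.
Proof.
  intros C C'; apply infinite_word_inj; intros k.
  destruct (C k) as [t T], (C' k) as [t' T'].
  rewrite <- (T (t + t')), <- (T' (t + t')) by lia; reflexivity.
Qed.

Theorem theorem5p12 (X Y : computable_metric_space)
    (f : Base X -> Base Y -> Prop) :
  limit_computable (cauchy_rep X) (cauchy_rep Y) f <->
  exists g : Baire -> Base Y -> Prop,
    single_valued g /\
    computable baire_rep (cauchy_rep Y) g /\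
    refines (fun x y => g (turing_jump X x) y) f.
Proof.
  split.
  - intros [F [SF [[M HM] HF]]].
    destruct (oracle_machine X M) as [K [OW HK]].
    set (G := fun q r => (exists x, dom f x /\ q = turing_jump X x) /\
                         converges K (infinite_word q) r).
    assert (SG : single_valued G).
    { intros q r r' [_ C] [_ C']; exact (converges_unique K _ r r' C C'). }
    set (g := fun q y => exists r, G q r /\ cauchy_rep Y r y).
    assert (Sg : single_valued g).
    { intros q y y' [r [Gr Ry]] [r' [Gr' Ry']].
      rewrite (SG q r' r Gr' Gr) in Ry'; exact (name_unique Y r y y' Ry Ry'). }
    (* The oracle machine belongs to a name [p] of its own construction. The realizer is defined on
       [p], so [M] converges there and the oracle machine reaches the same limit. *)
    assert (A : forall x, dom f x -> exists y, g (turing_jump X x) y /\ f x y).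
    { intros x Dx; destruct (HK x) as [p [Np Cp]].
      destruct (HF p x Np Dx) as [r [y [Fr [Ry Fy]]]].
      exists y; split; auto; exists r; split; auto; split; [now exists x|].
      apply Cp; intros k; exact (HM p r Fr k). }
    exists g; split; auto; split.
    + exists G; split; auto; split.
      * exists K; split; auto; intros q r [_ C]; exact C.
      * intros p q E [y [r [Gr Ry]]]; red in E; subst; exists r, y; split; [exact Gr|split; [exact Ry|now exists r]].
    (* Since [g] is single-valued, the one value known to lie in [f x] is the only one. *)
    + intros x Dx; destruct (A x Dx) as [y [Gy Fy]]; split; [now exists y|].
      intros y' Gy'; now rewrite (Sg _ y' y Gy' Gy).
  - intros [g [Sg [[FG [SFG [[M [OW HM]] HG]]] Hf]]].
    destruct (limit_machine X M OW) as [L HL].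
    (* A name determines its point, hence the jump and the value of [FG]; this makes the realizer
       single-valued. *)
    exists (fun p r => exists x, cauchy_rep X p x /\ dom f x /\ FG (turing_jump X x) r).
    split; [|split].
    + intros p r r' [x [Nx [_ Hr]]] [x' [Nx' [_ Hr']]].
      rewrite (name_unique X p x' x Nx' Nx) in Hr'; exact (SFG _ r r' Hr Hr').
    + exists L; intros p r [x [Nx [_ Hr]]]; apply (HL p x r Nx); exact (HM _ r Hr).
    + intros p x Nx Dx; destruct (Hf x Dx) as [Dg Hgf].
      destruct (HG _ _ eq_refl Dg) as [r [y [Hr [Ry Gy]]]].
      exists r, y; split; [now exists x|]; auto.
Qed.
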